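(* Let $\boldsymbol\mu_b\in H^1(\Omega,\mathcal P(D))$. Then there exists at least one solution of the Dirichlet problem with boundary values $\boldsymbol\mu_b$, i.e. at least one minimizer of $$\min_{\boldsymbol\mu}\left\{\mathrm{Dir}(\boldsymbol\mu):\ \boldsymbol\mu\in H^1(\Omega,\mathcal P(D))\ \text{and}\ \boldsymbol\mu|_{\partial\Omega}=\boldsymbol\mu_b|_{\partial\Omega}\right\}.$$
   Context: Setting. $p,q\ge1$ are integers. $\Omega\subset\mathbb R^p$ is compact and connected, has non-empty interior $\mathring\Omega$, Lipschitz boundary (around any boundary point, up to a rotation, $\Omega$ is the epigraph of a Lipschitz function) and Lebesgue measure $1$. $D\subset\mathbb R^q$ is compact and convex with non-empty interior. $\mathcal P(D)$ is the set of Borel probability measures on $D$ with the quadratic Wasserstein distance $W_2$. $L^2(\Omega,\mathcal P(D))$ is the set of measurable maps $\boldsymbol\mu:\Omega\to\mathcal P(D)$ modulo a.e. equality; such a $\boldsymbol\mu$ is identified with the probability measure $\boldsymbol\mu(\mathrm d\xi,\mathrm dx)=\boldsymbol\mu(\xi,\mathrm dx)\,\mathrm d\xi$ on $\Omega\times D$. Dirichlet energy. $\nabla_\Omega\cdot$ is the divergence in $\xi\in\Omega$, $\nabla_D$ the gradient in $x\in D$; for $\varphi$ valued in $\mathbb R^p$, $(\nabla_D\varphi)^{\alpha i}=\partial_{x_i}\varphi^\alpha$. For $\mathbf E\in\mathcal M(\Omega\times D,\mathbb R^{pq})$ (finite vector measures), $(\boldsymbol\mu,\mathbf E)$ satisfies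 the continuity equation if $\iint\nabla_\Omega\cdot\varphi\,\mathrm d\boldsymbol\mu+\iint\nabla_D\varphi\cdot\mathrm d\mathbf E=0$ for all $\varphi\in C^1(\Omega\times D,\mathbb R^p)$ whose support is contained in $X\times D$ for some compact $X\subset\mathring\Omega$ (no support condition in $D$). In that case $$\mathrm{Dir}(\boldsymbol\mu,\mathbf E):=\sup\Big\{\iint a\,\mathrm d\boldsymbol\mu+\iint b\cdot\mathrm d\mathbf E:\ (a,b)\in C(\Omega\times D,\mathbb R\times\mathbb R^{pq}),\ a+\tfrac12|b|^2\le0\Big\}$$ (which, when finite, equals $\iint\frac12|\mathbf v|^2\mathrm d\boldsymbol\mu$ with $\mathbf E=\mathbf v\boldsymbol\mu$). $\mathrm{Dir}(\boldsymbol\mu)$ is the infimum of $\mathrm{Dir}(\boldsymbol\mu,\mathbf E)$ over all $\mathbf E$ such that $(\boldsymbol\mu,\mathbf E)$ satisfies the continuity equation ($+\infty$ if there is none), and $H^1(\Omega,\mathcal P(D))=\{\boldsymbol\mu\in L^2(\Omega,\mathcal P(D)):\mathrm{Dir}(\boldsymbol\mu)<+\infty\}$. Boundary values. For $\boldsymbol\mu\in H^1(\Omega,\mathcal P(D))$ and $\varphi\in C^1(\Omega\times D,\mathbb R^p)$ (no support condition), $\mathrm{BT}_{\boldsymbol\mu}(\varphi):=\iint\nabla_\Omega\cdot\varphi\,\mathrm d\boldsymbol\mu+\iint\nabla_D\varphi\cdot\mathrm d\mathbf E$, where $\mathbf E$ is any measure such that $(\boldsymbol\mu,\mathbf E)$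 satisfies the continuity equation and $\mathrm{Dir}(\boldsymbol\mu,\mathbf E)<+\infty$ (the value does not depend on $\mathbf E$). $\boldsymbol\mu|_{\partial\Omega}=\boldsymbol\nu|_{\partial\Omega}$ means $\mathrm{BT}_{\boldsymbol\mu}=\mathrm{BT}_{\boldsymbol\nu}$. *)

(* Defs.v *)
From HB Require Import structures.
From mathcomp Require Import all_boot all_order all_algebra.
From mathcomp Require Import all_classical all_reals all_analysis.

Set Implicit Arguments.
Unset Strict Implicit.
Unset Printing Implicit Defensive.
Import Order.TTheory GRing.Theory Num.Theory.
Import numFieldNormedType.Exports.

Local Open Scope classical_set_scope.
Local Open Scope ring_scope.

(* R^n is 'rV[R]_n.  Its library topology comes from the sup norm and is the
   Euclidean one; its sigma-algebra is the Borel one, generated by the open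
   sets. *)
HB.instance Definition _ (R : realType) (m n : nat) :=
  @isMeasurable.Build (sigma_display (@open 'M[R]_(m, n))) 'M[R]_(m, n)
    <<s (@open 'M[R]_(m, n)) >>
    (@sigma_algebra0 _ setT _) (@sigma_algebraC _ _)
    (@sigma_algebra_bigcup _ setT _).

Section lebesgue_measure_rV.
Context (R : realType).

Lemma open_measurable_mx (m n : nat) (U : set 'M[R]_(m, n)) :
  open U -> measurable U.
Proof. by move=> oU; exact: sub_sigma_algebra. Qed.

Lemma measurable_fun_rV d (T : measurableType d) (n : nat)
    (f : T -> 'rV[R]_n) :
  (forall i, measurable_fun setT (fun t => f t 0 i)) -> measurable_fun setT f.
Proof.
move=> mf; apply: (@measurability _ _ _ _ setT f open) => // _ [U oU <-].
pose B (ak : 'rV[rat]_n * nat) : set 'rV[R]_n :=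
  [set y | forall i, ball (ratr (ak.1 0 i) : R) ak.2.+1%:R^-1 (y 0 i)].
pose F ak := if `[< B ak `<=` U >] then B ak else set0.
have UE : U = \bigcup_ak F ak.
  apply/seteqP; split=> [x Ux|x [ak _]]; last first.
    by rewrite /F; case: asboolP => // akU; exact: akU.
  have /nbhs_ballP[e /= e0 eU] : nbhs x U by exact: open_nbhs_nbhs.
  have [k _ ke] := near_infty_natSinv_lt (PosNum (divr_gt0 e0 (ltr0n R 2))).
  have kE : k.+1%:R^-1 < e / 2 := ke k (leqnn k).
  have k0 : (0 : R) < k.+1%:R^-1 by rewrite invr_gt0 ltr0n.
  have ha (i : 'I_n) : exists r : rat, ball (ratr r : R) k.+1%:R^-1 (x 0 i).
    have lt1 : x 0 i - k.+1%:R^-1 < x 0 i + k.+1%:R^-1 :> R.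
      by rewrite ltrD2l gtrN.
    have [r] := rat_in_itvoo lt1.
    rewrite in_itv/= => /andP[r1 r2]; exists r.
    by rewrite /ball/= ltr_distl r1 r2.
  pose a := \row_i sval (cid (ha i)).
  have Bx : B (a, k) x.
    by move=> i /=; rewrite /a mxE; exact: (svalP (cid (ha i))).
  exists (a, k) => //; rewrite /F; case: asboolP => // -[] y By.
  apply: eU; split=> // i j; rewrite ord1.
  apply: le_ball (ball_triangle (ball_sym (Bx j)) (By j)) => /=.
  by rewrite (splitr e) lerD// ltW.
rewrite setTI UE preimage_bigcup; apply: countable_bigcupT_measurable => // ak.
rewrite /F; case: asboolP => _; last by rewrite preimage_set0.
rewrite (_ : f @^-1` B ak = \bigcap_(i in [set: 'I_n])
    (fun t => f t 0 i) @^-1` (ball (ratr (ak.1 0 i) : R) ak.2.+1%:R^-1)).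
  apply: fin_bigcap_measurable => // i _; rewrite -[X in measurable X]setTI.
  by apply: mf => //; rewrite ball_itv; exact: measurable_itv.
by apply/seteqP; split=> [t tB i _|t tB i]; [exact: tB|exact: (tB i)].
Qed.

Definition snoc_rV (n : nat) (z : ('rV[R]_n * R)%type) : 'rV[R]_n.+1 :=
  row_mx (const_mx z.2 : 'M[R]_1) z.1.

Lemma measurable_coord_rV (n : nat) (i : 'I_n) :
  measurable_fun setT (fun x : 'rV[R]_n => x 0 i).
Proof.
apply: (measurability _ (measurable_realfun.RGenOInfty.measurableE R)) => // _ [_ [a ->] <-].
rewrite setTI; apply: open_measurable_mx.
by apply: open_comp (interval_open _ _) => // x _; exact: coord_continuous.
Qed.

Lemma snoc_rV0 (n : nat) (z : ('rV[R]_n * R)%type) :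
  snoc_rV z 0 ord0 = z.2.
Proof.
rewrite /snoc_rV (_ : ord0 = lshift n (ord0 : 'I_1) :> 'I_n.+1); last exact/val_inj.
by rewrite (@row_mxEl _ 1 1 n) mxE.
Qed.

Lemma snoc_rVS (n : nat) (z : ('rV[R]_n * R)%type) (j : 'I_n) :
  snoc_rV z 0 (lift ord0 j) = z.1 0 j.
Proof.
rewrite /snoc_rV (_ : lift ord0 j = rshift 1 j :> 'I_n.+1); last exact/val_inj.
exact: (@row_mxEr _ 1 1 n).
Qed.

Lemma measurable_snoc_rV (n : nat) : measurable_fun setT (@snoc_rV n).
Proof.
apply: measurable_fun_rV => i; case: (unliftP ord0 i) => [j ->|->].
  under eq_fun do rewrite snoc_rVS.
  exact: (measurableT_comp (measurable_coord_rV j) measurable_fst).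
by under eq_fun do rewrite snoc_rV0; exact: measurable_snd.
Qed.

Definition snoc_measure (n : nat) (m : {measure set 'rV[R]_n -> \bar R}) :
    {measure set 'rV[R]_n.+1 -> \bar R} :=
  measure_function_pushforward__canonical__measure_function_Measure
    (m \x @lebesgue_measure R)%E (@measurable_snoc_rV n).

(* Lebesgue measure on R^n, as an iterated product; see lebesgue_rV_box. *)
Fixpoint lebesgue_rV (n : nat) : {measure set 'rV[R]_n -> \bar R} :=
  if n is n'.+1 then snoc_measure (lebesgue_rV n')
  else \d_(0 : 'rV[R]_0).

Lemma lebesgue_rV_box (n : nat) (a b : 'rV[R]_n) :
  (forall i, a 0 i <= b 0 i) ->
  lebesgue_rV n [set x | forall i, a 0 i <= x 0 i <= b 0 i] =
  (\prod_i (b 0 i - a 0 i))%:E.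
Proof.
elim: n => [|n IHn] in a b * => ab.
  by rewrite big_ord0 /= diracE mem_set// => -[].
pose a' : 'rV[R]_n := \row_i a 0 (lift ord0 i).
pose b' : 'rV[R]_n := \row_i b 0 (lift ord0 i).
pose B := [set x : 'rV[R]_n | forall i, a' 0 i <= x 0 i <= b' 0 i].
have mB : measurable B.
  rewrite (_ : B = \bigcap_(i in [set: 'I_n])
      (fun x : 'rV[R]_n => x 0 i) @^-1` `[a' 0 i, b' 0 i]%classic).
    apply: fin_bigcap_measurable => // i _; rewrite -[X in measurable X]setTI.
    exact: (measurable_coord_rV i measurableT (measurable_itv `[a' 0 i, b' 0 i])).
  apply/seteqP; split=> [x Bx i _|x Bx i] /=; first by rewrite in_itv/=.
  by have := Bx i I; rewrite /= in_itv/=.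
transitivity ((lebesgue_rV n \x @lebesgue_measure R)%E
    (B `*` `[a 0 ord0, b 0 ord0]%classic)).
  rewrite /= /pushforward; congr (product_measure1 _ _ _).
  apply/seteqP; split=> [[x t] /= H|[x t] /= [H1 H2] i].
    split=> [i|]; last by have := H ord0; rewrite snoc_rV0/= in_itv/=.
    by have := H (lift ord0 i); rewrite snoc_rVS !mxE.
  case: (unliftP ord0 i) => [j ->|->]; last first.
    by rewrite snoc_rV0/=; rewrite in_itv/= in H2.
  by have := H1 j; rewrite snoc_rVS !mxE.
rewrite product_measure1E; [|exact: mB|exact: measurable_itv].
rewrite IHn; last by move=> i; rewrite !mxE.
have := lebesgue_measure_itv `[a 0 ord0, b 0 ord0]; rewrite /= lte_fin => {1}->.
rewrite big_ord_recl muleC.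
rewrite (eq_bigr (fun i => b 0 (lift ord0 i) - a 0 (lift ord0 i))); last first.
  by move=> i _; rewrite !mxE.
have [_|ba] := ltP (a 0 ord0) (b 0 ord0); first by rewrite -EFinB -EFinM.
by rewrite mul0e (_ : b 0 ord0 = a 0 ord0) ?subrr ?mul0r//; apply/le_anti/andP.
Qed.

End lebesgue_measure_rV.

Section domains.
Context (R : realType).

(* Around each boundary point, some orthogonal change of coordinates turns
   Omega into the set above the graph of a Lipschitz function; the vertical
   coordinate is the j-th one and col' j keeps the other n - 1.  Orthogonal
   maps of determinant -1 are allowed: in dimension 1 they are needed at the
   right end of an interval. *)
Definition lipschitz_boundary (n : nat) (Omega : set 'rV[R]_n) :=
  forall xi0, (closure Omega `\` interior Omega) xi0 ->
  exists (Q : 'M[R]_n) (j : 'I_n) (f : 'rV[R]_n.-1 -> R),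
    [/\ Q *m Q^T = 1%:M, lipschitz f &
      \forall xi \near xi0,
        Omega xi <-> f (col' j (xi *m Q)) <= (xi *m Q) 0 j].

End domains.

Section wasserstein.
Context (R : realType) (q : nat) (D : set 'rV[R]_q).

(* P(D): Borel probability measures on R^q carried by D. *)
Definition prob_on : set (probability 'rV[R]_q R) := [set nu | nu D = 1%E].

Definition coupling (nu nu' : probability 'rV[R]_q R) :
    set (probability ('rV[R]_q * 'rV[R]_q)%type R) :=
  [set gam | forall A, measurable A ->
    gam (A `*` setT) = nu A /\ gam (setT `*` A) = nu' A].

Definition W2 (nu nu' : probability 'rV[R]_q R) : \bar R :=
  poweR (ereal_inf
    [set (\int[gam : probability _ _]_z (\sum_i (z.1 0 i - z.2 0 i) ^+ 2)%:E)%E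
      | gam in coupling nu nu']) 2^-1.

Definition W2_open (U : set (probability 'rV[R]_q R)) :=
  U `<=` prob_on /\
  forall nu, U nu -> exists2 e : R, 0 < e &
    forall nu', prob_on nu' -> (W2 nu nu' < e%:E)%E -> U nu'.

End wasserstein.

Section dirichlet.
Context (R : realType) (p q : nat).
Context (Omega : set 'rV[R]_p) (D : set 'rV[R]_q).

Local Notation X := ('rV[R]_p * 'rV[R]_q)%type.
(* Values outside Omega are irrelevant. *)
Local Notation pmap := ('rV[R]_p -> probability 'rV[R]_q R).
(* Vector measures with values in R^{pq}, by components. *)
Local Notation vmeas := ('I_p -> 'I_q -> {charge set X -> \bar R}).

(* Measurable maps Omega -> P(D), for the Borel sigma-algebra of W2.  Everything
   below depends only on the class of mu modulo almost everywhere equality. *)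
Definition L2_map (mu : pmap) :=
  (forall xi, Omega xi -> prob_on D (mu xi)) /\
  (forall U, W2_open D U -> measurable (Omega `&` mu @^-1` U)).

(* Integral against mu(xi, dx) dxi. *)
Definition integral_pmap (mu : pmap) (f : X -> R) : R :=
  \int[lebesgue_rV R p]_(xi in Omega) \int[mu xi]_(x in D) f (xi, x).

(* Finite vector measures on Omega x D, as measures on the whole space that
   vanish outside Omega x D. *)
Definition vmeas_on (E : vmeas) :=
  forall al i A, measurable A -> A `&` (Omega `*` D) = set0 -> E al i A = 0%E.

(* The choice of the Hahn decomposition does not affect the integral. *)
Definition integral_charge (nu : {charge set X -> \bar R}) (f : X -> R) : R :=
  let hN := cid (svalP (cid (Hahn_decomposition nu))) in
  \int[jordan_pos (svalP hN)]_(z in Omega `*` D) f z -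
  \int[jordan_neg (svalP hN)]_(z in Omega `*` D) f z.

Definition integral_vmeas (E : vmeas) (b : X -> 'M[R]_(p, q)) : R :=
  \sum_al \sum_i integral_charge (E al i) (fun z => b z al i).

(* C^1(Omega x D, R^p): a map phi stands for its restriction to Omega x D, which
   also determines its derivatives there, by density of the interior. *)
Definition C1_map (phi : X -> 'rV[R]_p) :=
  (forall z, differentiable phi z) /\
  (forall v, continuous (fun z => 'D_v phi z)).

Definition div_Omega (phi : X -> 'rV[R]_p) (z : X) : R :=
  \sum_al ('D_(delta_mx 0 al, 0) phi z) 0 al.

Definition grad_D (phi : X -> 'rV[R]_p) (z : X) : 'M[R]_(p, q) :=
  \matrix_(al, i) ('D_(0, delta_mx 0 i) phi z) 0 al.

(* K `*` D contains the support in Omega x D; no condition in D. *)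
Definition compact_support_Omega (phi : X -> 'rV[R]_p) :=
  exists K : set 'rV[R]_p, [/\ compact K, K `<=` interior Omega &
    forall xi x, Omega xi -> D x -> ~ K xi -> phi (xi, x) = 0].

Definition boundary_term (mu : pmap) (E : vmeas) (phi : X -> 'rV[R]_p) : R :=
  integral_pmap mu (div_Omega phi) + integral_vmeas E (grad_D phi).

Definition continuity_equation (mu : pmap) (E : vmeas) :=
  vmeas_on E /\
  forall phi, C1_map phi -> compact_support_Omega phi -> boundary_term mu E phi = 0.

Definition Dir_pair (mu : pmap) (E : vmeas) : \bar R :=
  ereal_sup [set r | exists (a : X -> R) (b : X -> 'M[R]_(p, q)),
    [/\ {within Omega `*` D, continuous a}, {within Omega `*` D, continuous b},
      (forall z, (Omega `*` D) z ->
        a z + 2^-1 * (\sum_al \sum_i b z al i ^+ 2) <= 0) &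
      r = (integral_pmap mu a + integral_vmeas E b)%:E]].

Definition Dir (mu : pmap) : \bar R :=
  ereal_inf [set Dir_pair mu E | E in continuity_equation mu].

Definition H1_map (mu : pmap) := L2_map mu /\ (Dir mu < +oo)%E.

(* The boundary values of mu are tested with any E of finite energy solving
   the continuity equation, the value being independent of E. *)
Definition finite_momentum (mu : pmap) (E : vmeas) :=
  continuity_equation mu E /\ (Dir_pair mu E < +oo)%E.

Definition same_boundary_values (mu nu : pmap) :=
  forall E F, finite_momentum mu E -> finite_momentum nu F ->
  forall phi, C1_map phi -> boundary_term mu E phi = boundary_term nu F phi.

Definition dirichlet_solution (mub mu : pmap) :=
  [/\ H1_map mu, same_boundary_values mu mub &
    forall nu, H1_map nu -> same_boundary_values nu mub -> (Dir mu <= Dir nu)%E].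

End dirichlet.

(* Main.v *)
Require Import Defs.
From HB Require Import structures.
From mathcomp Require Import all_boot all_order all_algebra.
From mathcomp Require Import all_classical all_reals all_analysis.
From mathcomp Require Import measurable_realfun ring lra.

(** The direct method.  Take a minimizing sequence mu_n and a momentum F of the
boundary datum, and write T for its boundary term.  Since mu_n has the same
boundary term, Fenchel-Young turns the bound on its energy into
  T phi - int div phi dmu_n - 1/2 int |grad phi|^2 dmu_n <= inf + 1/n
for every C^1 map phi, where the momentum of mu_n has disappeared.  This
inequality passes to the limit along an ultrafilter.  Conversely, it forces
the functional T - int div dmu to be given by a momentum v mu with
1/2 int |v|^2 dmu <= inf, by Riesz representation in L^2(mu).

Compactness of L^2(Omega, P(D)): the ultralimits of the set functions
A |-> int_A mu_n(xi)(C_w) dxi, for C_w in a tree of cells of D with vanishing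
diameters, have densities m(xi, w) by Radon-Nikodym, and the limit mu(xi) is
the law, under a uniform variable, of the quantile map of m(xi, .).  The
quantile coupling makes xi |-> mu(xi) measurable for W_2.

Boundary terms do not depend on the momentum because Lipschitz boundaries are
Lebesgue-null, so that C^1 cutoffs exhaust Omega up to a null set. *)

Set Implicit Arguments.
Unset Strict Implicit.
Unset Printing Implicit Defensive.
Import Order.TTheory GRing.Theory Num.Theory.
Import numFieldNormedType.Exports.

Local Open Scope classical_set_scope.
Local Open Scope ring_scope.

(** * Measurable maps into P(D) *)

(** Lower semicontinuity of the energy by itself would call for compactness of the momenta as well
    as of the maps. Once the momentum is eliminated, only integrals of continuous functions against
    [mu_n] have to pass to the limit, and a momentum is rebuilt once, for the limit map. The
    inequality is kept for all C^1 maps, not only those vanishing near the boundary, so the rebuilt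
    momentum yields the continuity equation and the boundary values together. Along an ultrafilter
    every bounded real sequence converges, which replaces a diagonal extraction over words and sets.
    Cells record membership in the first N boxes of a countable base, so they are Borel but in
    general not closed, and a limit of points of a cell may leave it. Hence the limit law is not
    identified through its mass on cells: integrals of continuous functions are compared with finite
    sums over cells, for the sequence and for the limit alike. Parametrizing all the laws by one
    uniform variable gives explicit couplings, hence the upper bounds on [W2] behind
    measurability. *)

Section kernel_of_L2_map.
Context (R : realType) (q : nat).
Implicit Types nu : probability 'rV[R]_q R.

Lemma measurable_sqdist :
  measurable_fun setT (fun z : 'rV[R]_q * 'rV[R]_q => \sum_i (z.1 0 i - z.2 0 i) ^+ 2).
Proof.
apply: measurable_sum => i; apply: measurable_funX; apply: measurable_funB.
  exact: (measurableT_comp (measurable_coord_rV i) measurable_fst).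
exact: (measurableT_comp (measurable_coord_rV i) measurable_snd).
Qed.

Lemma sqdist_ge0 (z : 'rV[R]_q * 'rV[R]_q) : 0 <= \sum_i (z.1 0 i - z.2 0 i) ^+ 2.
Proof. by apply: sumr_ge0 => i _; exact: sqr_ge0. Qed.

Local Open Scope ereal_scope.

Lemma poweR_half_sqr (e : R) : (0 <= e)%R -> (e ^+ 2)%:E `^ 2^-1 = e%:E.
Proof. by move=> e0; rewrite poweR_EFin -powR_mulrn// -powRrM divff// powRr1. Qed.

Lemma W2_lt_coupling nu nu' (e : R) : (0 < e)%R -> W2 nu nu' < e%:E ->
  exists2 gam, coupling nu nu' gam &
    \int[gam]_z (\sum_i (z.1 0 i - z.2 0 i) ^+ 2)%:E < (e ^+ 2)%:E.
Proof.
move=> e0 W; suff : ereal_inf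
    [set (\int[gam : probability _ _]_z (\sum_i (z.1 0 i - z.2 0 i) ^+ 2)%:E)%E
      | gam in coupling nu nu'] < (e ^+ 2)%:E.
  by move/ereal_inf_lt => [_ [gam cgam <-] lt]; exists gam.
rewrite ltNge; apply/negP => le; move: W; apply/negP; rewrite -leNgt.
rewrite -(poweR_half_sqr (ltW e0)) /W2; apply: gt0_ler_poweR => //.
- by rewrite in_itv/= leey andbT lee_fin sqr_ge0.
- rewrite in_itv/= leey andbT; apply: le_ereal_inf_tmp => _ [gam _ <-].
  by apply: integral_ge0 => z _; rewrite lee_fin sqdist_ge0.
Qed.

Lemma coupling_W2_lt nu nu' (e : R) gam : (0 < e)%R -> coupling nu nu' gam ->
  \int[gam]_z (\sum_i (z.1 0 i - z.2 0 i) ^+ 2)%:E < (e ^+ 2)%:E ->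
  W2 nu nu' < e%:E.
Proof.
move=> e0 cgam lt; set I := (X in X < _) in lt.
have I0 : 0 <= I by apply: integral_ge0 => z _; rewrite lee_fin sqdist_ge0.
have If : I \is a fin_num by rewrite ge0_fin_numE// (lt_trans lt)// ltry.
apply: (@le_lt_trans _ _ (I `^ 2^-1)).
  apply: gt0_ler_poweR; rewrite ?invr_ge0//.
  - rewrite in_itv/= leey andbT; apply: le_ereal_inf_tmp => _ [g _ <-].
    by apply: integral_ge0 => z _; rewrite lee_fin sqdist_ge0.
  - by rewrite in_itv/= leey andbT.
  - by apply: ereal_inf_lbound; exists gam.
rewrite -(poweR_half_sqr (ltW e0)); move: I0 lt; rewrite -(fineK If) lee_fin lte_fin => I0 lt.
rewrite !poweR_EFin lte_fin; apply: gt0_ltr_powR => //.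
by rewrite nnegrE sqr_ge0.
Qed.

Definition inner_core (U : set 'rV[R]_q) (e : R) := [set x | ball x e `<=` U].

Lemma measurable_inner_core U e : measurable (inner_core U e).
Proof.
rewrite -[X in measurable X]setCK; apply: measurableC; apply: open_measurable_mx.
rewrite (_ : ~` _ = \bigcup_(y in ~` U) ball y e).
  by apply: bigcup_open => y _; exact: ball_open.
apply/seteqP; split=> [x /= /existsNP[y /not_implyP[xy Uy]]|x [y Uy xy] /= H].
  by exists y => //; exact: ball_sym.
by apply: Uy; apply: H; exact: ball_sym.
Qed.

(** A point [x] of the core paired with [y] outside [U] has a coordinate differing by at least [d],
    since balls are those of the sup norm. The Euclidean cost is then at least [d ^+ 2], and
    Markov's inequality bounds the mass of such pairs. *)
Lemma coupling_inner_core nu nu' gam U (d : R) : (0 < d)%R -> coupling nu nu' gam ->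
  measurable U ->
  (d ^+ 2)%:E * nu (inner_core U d) <= (d ^+ 2)%:E * nu' U +
    \int[gam]_z (\sum_i (z.1 0 i - z.2 0 i) ^+ 2)%:E.
Proof.
move=> d0 cgam mU; pose F := inner_core U d.
have mF : measurable F by exact: measurable_inner_core.
pose c (z : 'rV[R]_q * 'rV[R]_q) := (\sum_i (z.1 0 i - z.2 0 i) ^+ 2)%R.
have mc : measurable_fun setT c by exact: measurable_sqdist.
pose B := [set z | (d ^+ 2 <= c z)%R].
have mB : measurable B.
  have := mc measurableT _ (measurable_itv `[(d ^+ 2)%R, +oo[).
  by rewrite setTI; congr measurable; apply/seteqP; split=> z /=;
    rewrite in_itv/= andbT.
have sub : F `*` setT `<=` (setT `*` U) `|` B.
  move=> [x y] /= [Fx _]; have [Uy|nUy] := pselect (U y); first by left.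
  right; rewrite /B/= leNgt; apply/negP => lt; apply: nUy; apply: Fx.
  split=> // i j; rewrite ord1 /ball/=.
  rewrite -(ltr_pXn2r (n := 2))// ?nnegrE// ?(ltW d0)// real_normK ?num_real//.
  apply: le_lt_trans lt; rewrite /c/= (bigD1 j)//= lerDl.
  by apply: sumr_ge0 => k _; exact: sqr_ge0.
have -> : nu F = gam (F `*` setT) by have [->] := cgam _ mF.
have -> : nu' U = gam (setT `*` U) by have [_ ->] := cgam _ mU.
have mT : measurable (setT `*` U : set ('rV[R]_q * 'rV[R]_q)).
  by apply: measurableX.
apply: (@le_trans _ _ ((d ^+ 2)%:E * (gam (setT `*` U) + gam B))).
  apply: lee_pmul => //; first by rewrite lee_fin sqr_ge0.
  apply: le_trans (measureU2 _ mT mB).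
  by apply: le_measure => //; rewrite inE; [exact: measurableX|exact: measurableU].
rewrite ge0_muleDr//; apply: leeD => //.
rewrite -integral_cst//.
apply: (@le_trans _ _ (\int[gam]_(z in B) (c z)%:E)).
  apply: ge0_le_integral => //=.
  - by move=> z _; rewrite lee_fin sqr_ge0.
  - by apply/measurable_EFinP; exact: measurable_funTS.
apply: ge0_subset_integral => //; first by apply/measurable_EFinP.
by move=> z _; rewrite lee_fin sqdist_ge0.
Qed.

(** [U] is the increasing union of its cores, so the strict inequality already holds for some core,
    of width [d], with an excess [s]. A plan of cost less than [d ^+ 2 * s] loses mass less than
    [s], whence the radius [d * sqrt s]. *)
Lemma W2_open_mass (D : set 'rV[R]_q) (U : set 'rV[R]_q) (r : R) : open U ->
  W2_open D (prob_on D `&` [set nu | r%:E < nu U]).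
Proof.
move=> oU; split; first by move=> nu [].
move=> nu [Dnu rU].
have mU : measurable U by exact: open_measurable_mx.
pose F n := inner_core U n.+1%:R^-1.
have mF n : measurable (F n) by exact: measurable_inner_core.
have UE : \bigcup_n F n = U.
  apply/seteqP; split=> [x [n _ Fx]|x Ux].
    by apply: Fx; apply: ballxx; rewrite invr_gt0.
  have /nbhs_ballP[e /= e0 eU] : nbhs x U by exact: open_nbhs_nbhs.
  have [k _ ke] := near_infty_natSinv_lt (PosNum e0).
  exists k => // y xy; apply: eU; apply: le_ball xy; apply: ltW.
  exact: (ke k (leqnn k)).
have [n rF] : exists n, r%:E < nu (F n).
  apply: contrapT => /forallNP H; move: rU; apply/negP; rewrite -leNgt -UE.
  have cv : (nu \o F) x @[x --> \oo] --> nu (\bigcup_n F n).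
    apply: nondecreasing_cvg_mu => //; first by rewrite UE.
    move=> m n mn; apply/subsetPset => x Fx; apply: subset_trans Fx.
    by apply: le_ball; rewrite lef_pV2 ?posrE// ler_nat.
  rewrite -(cvg_lim _ cv)//; apply: lime_le; first by apply/cvg_ex; eexists; exact: cv.
  by apply: nearW => m /=; rewrite leNgt; apply/negP; exact: H.
pose d : R := n.+1%:R^-1%R; have d0 : (0 < d)%R by rewrite invr_gt0.
have Ff : nu (F n) \is a fin_num by exact: fin_num_measure.
pose s := (fine (nu (F n)) - r)%R.
have s0 : (0 < s)%R by rewrite subr_gt0 -lte_fin fineK.
exists (d * Num.sqrt s)%R; first by rewrite mulr_gt0// sqrtr_gt0.
move=> nu' Dnu' /W2_lt_coupling[|gam cgam]; first by rewrite mulr_gt0// sqrtr_gt0.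
rewrite exprMn sqr_sqrtr ?(ltW s0)// => lt; split => //=.
have := coupling_inner_core d0 cgam mU; rewrite -/(F n) => le.
have U'f : nu' U \is a fin_num by exact: fin_num_measure.
set I := (X in X < _) in lt.
have I0 : 0 <= I by apply: integral_ge0 => z _; rewrite lee_fin sqdist_ge0.
have If : I \is a fin_num by rewrite ge0_fin_numE// (lt_trans lt)// ltry.
move: le lt; rewrite -/I -(fineK Ff) -(fineK U'f) -(fineK If).
rewrite -!EFinM -EFinD lee_fin !lte_fin -(ltr_pM2l (exprn_gt0 2 d0)) => le lt.
by move: lt; rewrite /s mulrBr => lt; lra.
Qed.

Lemma compact_measurable_mx (m n : nat) (K : set 'M[R]_(m, n)) :
  compact K -> measurable K.
Proof.
move=> cK; rewrite -[K]setCK; apply: measurableC; apply: open_measurable_mx.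
by apply: closed_openC; apply: compact_closed => //; exact: norm_hausdorff.
Qed.

(* Chebyshev's inequality on a coupling shows that nu |-> nu U is lower
   semicontinuous for W_2 when U is open. *)
Lemma measurable_mass_L2_map (p : nat) (Omega : set 'rV[R]_p) (D : set 'rV[R]_q) mu :
  measurable Omega -> L2_map Omega D mu ->
  forall C, measurable C -> measurable_fun Omega (fun xi => mu xi C).
Proof.
move=> mO [muD mmu] C mC.
pose P := [set C | measurable_fun Omega (fun xi => mu xi C)].
suff : <<s open >> C -> P C by exact.
apply: dynkin_induction => //=; rewrite /P.
- by move=> A B; exact: openI.
- apply: (eq_measurable_fun (cst 1)); last exact: measurable_cst.
  by move=> x _; rewrite probability_setT.
- move=> U oU /=.
  apply: (measurability _ (ErealGenOInfty.measurableE R)) => // _ [_ [r ->] <-].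
  have := mmu _ (W2_open_mass D r oU); congr measurable.
  apply/seteqP; split=> x /= [Ox]; rewrite in_itv/= andbT; first by move=> [].
  by move=> rx; split=> //; split=> //; exact: muD.
- move=> S mS mfS; apply: (eq_measurable_fun (fun xi => 1 - mu xi S)).
    by move=> x _; rewrite probability_setC.
  by apply: emeasurable_funB => //; exact: measurable_cst.
- move=> F mF tF mfF.
  apply: (eq_measurable_fun (fun xi => \sum_(0 <= i <oo) mu xi (F i))).
    by move=> x _; rewrite measure_semi_bigcup//; exact: bigcupT_measurable.
  by apply: ge0_emeasurable_sum => // k _; exact: mfF.
Qed.

End kernel_of_L2_map.

Section integral_functional.
Context d (T : measurableType d) (R : realType) (mu : {measure set T -> \bar R}).
Local Open Scope ereal_scope.

Import HBNNSimple.

(* The standard machine: a monotone-continuous cone functional agreeing with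
   mu on indicators is integration against mu. *)
Lemma ge0_integral_functional (Phi : (T -> \bar R) -> \bar R) :
  (forall A, measurable A -> Phi (fun x => (\1_A x)%:E) = mu A) ->
  (forall f g, measurable_fun setT f -> measurable_fun setT g ->
    (forall x, 0 <= f x) -> (forall x, 0 <= g x) ->
    Phi (fun x => f x + g x) = Phi f + Phi g) ->
  (forall r f, (0 <= r)%R -> measurable_fun setT f -> (forall x, 0 <= f x) ->
    Phi (fun x => r%:E * f x) = r%:E * Phi f) ->
  (forall f_ : nat -> T -> \bar R, (forall n, measurable_fun setT (f_ n)) ->
    (forall n x, 0 <= f_ n x) -> (forall x, nondecreasing_seq (f_ ^~ x)) ->
    Phi (fun x => lim (f_ n x @[n --> \oo])) = lim (Phi (f_ n) @[n --> \oo])) ->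
  forall f, measurable_fun setT f -> (forall x, 0 <= f x) ->
    \int[mu]_x f x = Phi f.
Proof.
move=> PhiI PhiD PhiZ Phil f mf f0.
have Phi0 : Phi (cst 0) = 0.
  transitivity (Phi (fun x => (\1_set0 x)%:E)); last by rewrite PhiI// measure0.
  by congr Phi; apply/funext => x; rewrite indic0.
pose f_ := nnsfun_approx measurableT mf.
have fE : f = fun x => lim ((f_ n x)%:E @[n --> \oo]).
  by apply/funext => x; apply/esym/cvg_lim => //; exact: cvg_nnsfun_approx.
have mf_ n : measurable_fun setT (fun x => (f_ n x)%:E) by exact/measurable_EFinP.
have f_0 n x : 0 <= (f_ n x)%:E by rewrite lee_fin.
have f_nd x : nondecreasing_seq (fun n => (f_ n x)%:E).
  by move=> a b ab; rewrite lee_fin; exact/lefP/nd_nnsfun_approx.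
rewrite fE (Phil (fun n x => (f_ n x)%:E)) // monotone_convergence//.
congr (lim (_ @ \oo)); apply/funext => n.
pose s := finmap.enum_fset (fset_set (range (f_ n))).
have sfE x : (f_ n x)%:E = \sum_(y <- s)
    (y%:E * (\1_(f_ n @^-1` [set y]) x)%:E).
  rewrite fimfunE fsbig_finite//= -sumEFin; apply: eq_bigr => r _.
  by rewrite EFinM.
rewrite (_ : (fun x => (f_ n x)%:E) = fun x => \sum_(y <- s)
    (y%:E * (\1_(f_ n @^-1` [set y]) x)%:E)); last exact/funext.
have mI (y : R) : measurable_fun setT (fun x => (\1_(f_ n @^-1` [set y]) x)%:E : \bar R).
  by apply/measurable_EFinP; exact: measurable_indic.
have r0 y : y \in s -> (0 <= y)%R.
  by rewrite /s in_fset_set// inE => -[x _ <-].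
elim: s r0 {sfE} => [|y s IHs] r0.
  rewrite (_ : (fun x : T => _) = cst 0); last by apply/funext => x; rewrite big_nil.
  by rewrite integral0 Phi0.
have y0 : (0 <= y)%R by apply: r0; rewrite inE eqxx.
have s0 z : z \in s -> (0 <= z)%R by move=> zs; apply: r0; rewrite inE zs orbT.
rewrite (_ : (fun x : T => _) = fun x => y%:E * (\1_(f_ n @^-1` [set y]) x)%:E +
   \sum_(y <- s) (y%:E * (\1_(f_ n @^-1` [set y]) x)%:E)); last first.
  by apply/funext => x; rewrite big_cons.
have t0 (z : R) x : (0 <= z)%R -> 0 <= z%:E * (\1_(f_ n @^-1` [set z]) x)%:E.
  by move=> z0; rewrite mule_ge0 ?lee_fin.
have S0 x : 0 <= \sum_(y <- s) (y%:E * (\1_(f_ n @^-1` [set y]) x)%:E).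
  by rewrite big_seq; apply: sume_ge0 => z zs; exact/t0/s0.
have mS : measurable_fun setT
    (fun x => \sum_(y <- s) (y%:E * (\1_(f_ n @^-1` [set y]) x)%:E)).
  by apply: emeasurable_sum => z; exact: measurable_funeM.
have mt : measurable_fun setT (fun x => y%:E * (\1_(f_ n @^-1` [set y]) x)%:E).
  exact: measurable_funeM.
rewrite ge0_integralD//; last by move=> x _; exact: t0.
rewrite PhiD//; last by move=> x; exact: t0.
rewrite IHs//; congr (_ + _).
rewrite PhiZ// ?PhiI// ge0_integralZl//.
by rewrite integral_indic// setIT.
Qed.

End integral_functional.

(** * The measure mu(xi, dx) dxi and Fubini's theorem *)

Section joint_measure.
Context d1 d2 (T1 : measurableType d1) (T2 : measurableType d2) (R : realType).
Context (m : {measure set T1 -> \bar R}) (O : set T1) (mO : measurable O)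
  (O_fin : (m O < +oo)%E).
Context (k : T1 -> probability T2 R)
  (mk : forall C, measurable C -> measurable_fun O (fun x => k x C)).
Local Open Scope ereal_scope.

(** The masses of [k] are measurable on [O] only; extending by the zero measure gives a finite
    kernel on the whole of [T1]. *)
Definition zero_ext_kernel (x : T1) : {measure set T2 -> \bar R} :=
  if x \in O then k x : {measure set T2 -> \bar R} else mzero.

Lemma measurable_zero_ext_kernel C : measurable C ->
  measurable_fun setT (fun x => zero_ext_kernel x C).
Proof.
move=> mC; rewrite (_ : (fun x => _) = ((fun x => k x C) \_ O)).
  by apply/(measurable_restrictT _ _).1 => //; exact: mk.
by apply/funext => x; rewrite /zero_ext_kernel patchE; case: ifPn.
Qed.

HB.instance Definition _ := isKernel.Build _ _ _ _ _ zero_ext_kernel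
  measurable_zero_ext_kernel.

Lemma zero_ext_kernel_uub : measure_fam_uub zero_ext_kernel.
Proof.
exists 2%R => x; rewrite /zero_ext_kernel; case: ifPn => _.
  by rewrite [X in X < _](probability_setT (k x)) lte_fin ltr1n.
by rewrite /mzero/= lte_fin ltr0n.
Qed.

HB.instance Definition _ := Kernel_isFinite.Build _ _ _ _ _ zero_ext_kernel
  zero_ext_kernel_uub.

Lemma measurable_zero_ext_integral (f : T1 * T2 -> \bar R) :
  measurable_fun setT f -> (forall z, 0 <= f z) ->
  measurable_fun setT (fun x => \int[zero_ext_kernel x]_y f (x, y)).
Proof. by move=> mf f0; apply: measurable_fun_integral_finite_kernel. Qed.

(** The proofs are arguments so that the finite measure structure built below, which rests on them,
    can be inferred from the term alone. *)
Definition joint_measure (_ : measurable O) (_ : m O < +oo)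
    (_ : forall C, measurable C -> measurable_fun O (fun x => k x C))
    (A : set (T1 * T2)) : \bar R :=
  \int[m]_(x in O) zero_ext_kernel x (xsection A x).

Local Notation J := (joint_measure mO O_fin mk).

Let measurable_sec A : measurable A ->
  measurable_fun O (fun x => zero_ext_kernel x (xsection A x)).
Proof.
move=> mA; apply: measurable_funTS.
by apply: measurable_fun_xsection_finite_kernel; rewrite inE.
Qed.

Let joint0 : J set0 = 0.
Proof.
by rewrite /joint_measure integral0_eq// => x _; rewrite xsection0 measure0.
Qed.

Let joint_ge0 A : 0 <= J A.
Proof. by apply: integral_ge0 => x _. Qed.

Let joint_sigma_additive : semi_sigma_additive J.
Proof.
move=> F mF tF mUF.
rewrite [X in _ --> X](_ : _ =
    \int[m]_(x in O) (\sum_(0 <= n <oo) zero_ext_kernel x (xsection (F n) x))); last first.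
  apply: eq_integral => x _; rewrite xsection_bigcup measure_semi_bigcup//.
  - by move=> i; exact: measurable_xsection.
  - exact: trivIset_xsection.
  - by apply: bigcupT_measurable => i; exact: measurable_xsection.
rewrite integral_nneseries//; last by move=> n; exact: measurable_sec.
by apply: is_cvg_nneseries => n _ _; exact: joint_ge0.
Qed.

HB.instance Definition _ := isMeasure.Build _ _ _ J
  joint0 joint_ge0 joint_sigma_additive.

Let joint_fin : fin_num_fun J.
Proof.
move=> A mA; rewrite ge0_fin_numE//; apply: le_lt_trans O_fin.
rewrite -[leRHS]mul1e -integral_cst//; apply: ge0_le_integral => //.
- exact: measurable_sec.
- move=> x Ox; rewrite /zero_ext_kernel mem_set//; apply: probability_le1.
  exact: measurable_xsection.
Qed.

HB.instance Definition _ := Measure_isFinite.Build _ _ _ J joint_fin.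

Lemma joint_measureX A C : measurable A -> measurable C ->
  J (A `*` C) = \int[m]_(x in O `&` A) k x C.
Proof.
move=> mA mC; rewrite /joint_measure integral_mkcondr; apply: eq_integral => x.
rewrite inE => Ox; rewrite patchE /zero_ext_kernel mem_set//; case: ifPn => xA.
  by rewrite in_xsectionX// inE.
by rewrite notin_xsectionX// measure0.
Qed.

Lemma ge0_integral_joint_measure (f : T1 * T2 -> \bar R) :
  measurable_fun setT f -> (forall z, 0 <= f z) ->
  \int[J]_z f z = \int[m]_(x in O) \int[k x]_y f (x, y).
Proof.
move=> mf f0; transitivity (\int[m]_(x in O) \int[zero_ext_kernel x]_y f (x, y)).
  apply: (ge0_integral_functional (Phi := fun f =>
      \int[m]_(x in O) \int[zero_ext_kernel x]_y f (x, y))) => //.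
  - move=> A mA; apply: eq_integral => x _.
    transitivity (\int[zero_ext_kernel x]_y (\1_(xsection A x) y)%:E); last first.
      by rewrite integral_indic ?setIT//; exact: measurable_xsection.
    apply: eq_integral => y _; congr (_%:E); rewrite !indicE; congr (_%:R).
    by rewrite mem_xsection.
  - move=> g h mg mh g0 h0; rewrite -ge0_integralD//; last 4 first.
    + by move=> x _; apply: integral_ge0.
    + by apply: measurable_funTS; exact: measurable_zero_ext_integral.
    + by move=> x _; apply: integral_ge0.
    + by apply: measurable_funTS; exact: measurable_zero_ext_integral.
    apply: eq_integral => x _; rewrite ge0_integralD//; exact: measurable_fun_pair2.
  - move=> r g r0 mg g0; rewrite -ge0_integralZl//; last 2 first.
    + by apply: measurable_funTS; exact: measurable_zero_ext_integral.
    + by move=> x _; apply: integral_ge0.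
    apply: eq_integral => x _; rewrite ge0_integralZl//; exact: measurable_fun_pair2.
  - move=> f_ mf_ f_0 f_nd.
    rewrite -monotone_convergence//; last 3 first.
    + move=> n; apply: measurable_funTS; exact: measurable_zero_ext_integral.
    + by move=> n x _; apply: integral_ge0.
    + move=> x _ a b ab; apply: ge0_le_integral => //.
      * exact: measurable_fun_pair2.
      * exact: measurable_fun_pair2.
      * by move=> y _; exact: f_nd.
    apply: eq_integral => x _; rewrite monotone_convergence// => n.
    exact: measurable_fun_pair2.
by apply: eq_integral => x xO; rewrite /zero_ext_kernel xO.
Qed.

End joint_measure.

Lemma bounded_integrable d (T : measurableType d) (R : realType)
    (mu : {measure set T -> \bar R}) (A : set T) (f : T -> R) (M : R) :
  measurable A -> (mu A < +oo)%E -> measurable_fun A f ->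
  (forall x, A x -> `|f x| <= M) -> mu.-integrable A (EFin \o f).
Proof.
move=> mA Afin mf fM; apply: measurable_bounded_integrable => //.
exists M; split; first exact: num_real.
by move=> y My x Ax; apply: le_trans (ltW My); exact: fM.
Qed.

Section Rintegral_joint_measure.
Context d1 d2 (T1 : measurableType d1) (T2 : measurableType d2) (R : realType).
Context (m : {measure set T1 -> \bar R}) (O : set T1) (mO : measurable O)
  (O_fin : (m O < +oo)%E).
Context (k : T1 -> probability T2 R)
  (mk : forall C, measurable C -> measurable_fun O (fun x => k x C)).
Local Notation J := (joint_measure mO O_fin mk).

Lemma joint_measureT : J setT = m O.
Proof.
rewrite -setXTT joint_measureX// setIT.
rewrite (eq_integral (cst 1%E)); last by move=> x _; rewrite probability_setT.
by rewrite integral_cst// mul1e.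
Qed.

(** Tonelli is applied to [g + N], with [g] the extension of [f] by zero and [N] a bound for it. The
    constant then cancels, because both sides integrate it to [N] times the mass of [O]. *)
Lemma Rintegral_joint_measure (D : set T2) (f : T1 * T2 -> R) (M : R) :
  measurable D -> measurable_fun (O `*` D) f ->
  (forall z, (O `*` D) z -> `|f z| <= M) ->
  \int[m]_(x in O) \int[k x]_(y in D) f (x, y) = \int[J]_(z in O `*` D) f z.
Proof.
move=> mD mf fM.
have mOD : measurable (O `*` D) by exact: measurableX.
pose g := f \_ (O `*` D).
have mg : measurable_fun setT g by apply/(measurable_restrictT _ _).1.
pose N := Num.max M 0.
have N0 : 0 <= N by rewrite le_max lexx orbT.
have gN z : `|g z| <= N.
  rewrite /g patchE; case: ifPn => [|_]; last by rewrite normr0.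
  by rewrite inE => /fM fM'; rewrite le_max fM'.
have mgx x : measurable_fun setT (fun y => g (x, y)) by exact: measurable_fun_pair2.
have fk x : (k x setT < +oo)%E by rewrite probability_setT ltry.
have igx x : (k x).-integrable setT (EFin \o (fun y => g (x, y))).
  by apply: (bounded_integrable (M := N) measurableT (fk x) (mgx x)) => y _.
have iN x : (k x).-integrable setT (EFin \o cst N).
  by apply: (bounded_integrable (M := N) measurableT (fk x)) => // y _; rewrite /= ger0_norm.
have kN x : \int[k x]_y cst N y = N.
  rewrite Rintegral_cst// (_ : fine _ = 1) ?mulr1//.
  by rewrite [X in fine X](probability_setT (k x)).
pose h x := \int[k x]_y g (x, y).
have hN x : `|h x| <= N.
  apply: le_trans (le_normr_Rintegral measurableT (igx x)) _.
  rewrite -[leRHS](kN x); apply: le_Rintegral => //; last exact: iN.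
  exact: integrable_norm (igx x).
have hE x : (\int[k x]_y (g (x, y) + N)%:E)%E = (h x + N)%:E.
  rewrite -[X in _ = (h x + X)%:E](kN x) /h.
  rewrite -(RintegralD measurableT (igx x) (iN x)) /Rintegral fineK//.
  apply: integrable_fin_num => //.
  apply: (bounded_integrable (M := N + N) (f := fun y => g (x, y) + N)
    measurableT (fk x)).
    exact: measurable_funD.
  by move=> y _; rewrite (le_trans (ler_normD _ _))// lerD// ger0_norm.
have mh : measurable_fun O h.
  have : measurable_fun setT (fun x => \int[zero_ext_kernel O k x]_y (g (x, y) + N)%:E)%E.
    apply: (@measurable_zero_ext_integral _ _ _ _ _ _ mO _ mk (fun z => (g z + N)%:E)) => //.
      by apply/measurable_EFinP; exact: measurable_funD.
    by move=> z; rewrite lee_fin -lerBlDr sub0r; have := gN z; rewrite ler_norml => /andP[].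
  move/(measurable_funTS (D := O)) => mh.
  apply: (eq_measurable_fun (fun x => (h x + N) - N)); first by move=> x _; rewrite addrK.
  apply: measurable_funB => //; apply/measurable_EFinP.
  by apply: eq_measurable_fun mh => x xO; rewrite /= -hE /zero_ext_kernel xO.
have ih : m.-integrable O (EFin \o h).
  by apply: (bounded_integrable (M := N)).
have Jfin : (J setT < +oo)%E by rewrite joint_measureT.
have ig : J.-integrable setT (EFin \o g).
  by apply: (bounded_integrable (M := N)).
have iNJ : J.-integrable setT (EFin \o cst N).
  by apply: (bounded_integrable (M := N)) => // y _; rewrite /= ger0_norm.
have iNO : m.-integrable O (EFin \o cst N).
  by apply: (bounded_integrable (M := N)) => // y _; rewrite /= ger0_norm.
transitivity (\int[m]_(x in O) h x).
  apply: eq_Rintegral => x; rewrite inE => Ox; rewrite Rintegral_mkcond.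
  apply: eq_Rintegral => y _; rewrite /g !patchE; congr (if _ then _ else _).
  by apply/idP/idP; rewrite !inE//= => -[].
rewrite [RHS]Rintegral_mkcond -/g.
suff : \int[m]_(x in O) (h x + N) = \int[J]_z (g z + N).
  by rewrite !RintegralD// !Rintegral_cst//= joint_measureT => /addIr.
rewrite /Rintegral; congr fine.
rewrite (ge0_integral_joint_measure mO O_fin mk (f := fun z => (g z + N)%:E)).
- by apply: eq_integral => x _; rewrite hE.
- by apply/measurable_EFinP; exact: measurable_funD.
- by move=> z; rewrite lee_fin -lerBlDr sub0r; have := gN z; rewrite ler_norml => /andP[].
Qed.

End Rintegral_joint_measure.

(** * Words and quantiles *)

Section words.
Context (R : realType) (n : nat).

Definition base_box (a : 'rV[rat]_n * nat) : set 'rV[R]_n :=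
  [set y | forall i, ball (ratr (a.1 0 i) : R) a.2.+1%:R^-1 (y 0 i)].

Lemma measurable_base_box a : measurable (base_box a).
Proof.
rewrite (_ : base_box a = \bigcap_(i in [set: 'I_n])
    (fun x => x 0 i) @^-1` (ball (ratr (a.1 0 i) : R) a.2.+1%:R^-1)).
  apply: fin_bigcap_measurable => // i _; rewrite -[X in measurable X]setTI.
  by apply: measurable_coord_rV => //; rewrite ball_itv; exact: measurable_itv.
by apply/seteqP; split=> [t tB i _|t tB i]; [exact: tB|exact: (tB i)].
Qed.

Lemma nbhs_base_box a x : base_box a x -> nbhs x (base_box a).
Proof.
move=> ax; pose P (i : 'I_1) (j : 'I_n) := ball (ratr (a.1 0 j) : R) a.2.+1%:R^-1.
exists P; last by move=> y /= Py i; exact: Py.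
by move=> i j; apply: open_nbhs_nbhs; split; [exact: ball_open|rewrite ord1; exact: ax].
Qed.

Lemma base_box_sub (x : 'rV[R]_n) (U : set 'rV[R]_n) : nbhs x U ->
  exists2 a, base_box a x & base_box a `<=` U.
Proof.
move=> /nbhs_ballP[e /= e0 eU].
have [k _ ke] := near_infty_natSinv_lt (PosNum (divr_gt0 e0 (ltr0n R 2))).
have kE : k.+1%:R^-1 < e / 2 := ke k (leqnn k).
have k0 : (0 : R) < k.+1%:R^-1 by rewrite invr_gt0 ltr0n.
have ha (i : 'I_n) : exists r : rat, ball (ratr r : R) k.+1%:R^-1 (x 0 i).
  have lt1 : x 0 i - k.+1%:R^-1 < x 0 i + k.+1%:R^-1 :> R by rewrite ltrD2l gtrN.
  have [r] := rat_in_itvoo lt1.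
  by rewrite in_itv/= => /andP[r1 r2]; exists r; rewrite /ball/= ltr_distl r1 r2.
pose a : 'rV[rat]_n := \row_i sval (cid (ha i)).
have Bx : base_box (a, k) x.
  by move=> i /=; rewrite /a mxE; exact: (svalP (cid (ha i))).
exists (a, k) => // y By; apply: eU; split=> // i j; rewrite ord1.
apply: le_ball (ball_triangle (ball_sym (Bx j)) (By j)) => /=.
by rewrite (splitr e) lerD// ltW.
Qed.

(** The boxes of the countable base are numbered by [pickle], so that every box is eventually
    tested; numbers coding no box give the constant bit [false]. *)
Definition bit (k : nat) (x : 'rV[R]_n) : bool :=
  if unpickle k is Some a then `[< base_box a x >] else false.

(* The most recent bit comes first, so that a longer word extends a shorter
   one by cons. *)
Fixpoint word (N : nat) (x : 'rV[R]_n) : seq bool :=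
  if N is N'.+1 then bit N' x :: word N' x else [::].

Lemma size_word N x : size (word N x) = N.
Proof. by elim: N => //= N ->. Qed.

Lemma eq_word_leq M N x y : (M <= N)%N -> word N x = word N y -> word M x = word M y.
Proof.
elim: N M => [M|N IHN M]; first by rewrite leqn0 => /eqP->.
rewrite leq_eqVlt => /predU1P[-> //|]; rewrite ltnS => /IHN h /= [_]; exact: h.
Qed.

Lemma eq_word_bit k N x y : (k < N)%N -> word N x = word N y -> bit k x = bit k y.
Proof. by move=> /eq_word_leq /[apply] /= -[]. Qed.

Lemma measurable_bit k : measurable_fun setT (bit k).
Proof.
rewrite /bit; case: (unpickle k) => [a|]; last exact: measurable_cst.
apply: (measurable_fun_bool true); rewrite setTI.
rewrite (_ : _ @^-1` _ = base_box a); first exact: measurable_base_box.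
by apply/seteqP; split=> x /= /asboolP.
Qed.

Lemma measurable_word N (w : seq bool) : measurable [set x | word N x = w].
Proof.
elim: N w => [|N IHN] w /=.
  have [->|w0] := eqVneq w [::].
    by rewrite (_ : [set x | _] = setT)//; apply/seteqP.
  rewrite (_ : [set x | _] = set0)//; apply/seteqP; split=> // x /= /esym/eqP.
  by rewrite (negbTE w0).
case: w => [|b w].
  by rewrite (_ : [set x | _] = set0)//; apply/seteqP; split=> x.
rewrite (_ : [set x | _] = bit N @^-1` [set b] `&` [set x | word N x = w]).
  apply: measurableI => //; rewrite -[X in measurable X]setTI.
  exact: measurable_bit.
by apply/seteqP; split=> x /=; [move=> [-> ->]|move=> [-> ->]].
Qed.

End words.

Section word_oscillation.
Context (R : realType) (p q : nat).
Context (Omega : set 'rV[R]_p) (D : set 'rV[R]_q).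
Hypotheses (cO : compact Omega) (cD : compact D).
Local Notation X := ('rV[R]_p * 'rV[R]_q)%type.
Local Notation K := (Omega `*` D).

Lemma within_box (f : X -> R) (z : X) (U : set R) :
  {within K, continuous f} -> K z -> nbhs (f z) U ->
  exists ab, [/\ base_box ab.1 z.1, base_box ab.2 z.2 &
    forall z', K z' -> base_box ab.1 z'.1 -> base_box ab.2 z'.2 -> U (f z')].
Proof.
move=> /subspace_continuousP fc Kz Uz; have := fc z Kz U Uz.
rewrite /nbhs /= => -[[A B] [/= Az Bz] AB].
have [a az aA] := base_box_sub Az; have [b bz bB] := base_box_sub Bz.
exists (a, b); split=> // -[x y] Kxy ax bY; apply: (AB (x, y)) => //=.
by split; [exact: aA|exact: bB].
Qed.

(** Around [z] a product of two base boxes keeps [f] within [e / 2] of [f z], and once [N] exceeds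
    the codes of both boxes, a point with the same words as a point of the product lies in it too.
    Compactness, in its near-covering form, makes [N] uniform. *)
Lemma word_oscillation (f : X -> R) (e : R) : {within K, continuous f} -> 0 < e ->
  exists N, forall z z', K z -> K z' -> word N z.1 = word N z'.1 ->
    word N z.2 = word N z'.2 -> `|f z - f z'| <= e.
Proof.
move=> fc e0.
pose P N z := forall z', K z -> K z' -> word N z.1 = word N z'.1 ->
  word N z.2 = word N z'.2 -> `|f z - f z'| <= e.
suff [N _ HN] : \forall N \near \oo, K `<=` P N.
  by exists N => z z' Kz; apply: (HN N (leqnn N) z Kz).
move/compact_near_coveringP : (compact_setX cO cD); apply => z Kz.
have e20 : 0 < e / 2 by rewrite divr_gt0.
have [[a b] /= [az bz H]] := within_box fc Kz (nbhsx_ballx (f z) _ e20).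
exists (base_box a `*` base_box b, [set N | (maxn (pickle a) (pickle b) < N)%N]).
  split=> /=; first by exists (base_box a, base_box b) => //; split; exact: nbhs_base_box.
  by exists (maxn (pickle a) (pickle b)).+1.
move=> -[z1 N] /= [[a1 b1]]; rewrite gtn_max => /andP[aN bN] z2 K1 K2 w1 w2.
have a2 : base_box a z2.1.
  by have := eq_word_bit aN w1; rewrite /bit pickleK asboolT// => /esym/asboolP.
have b2 : base_box b z2.2.
  by have := eq_word_bit bN w2; rewrite /bit pickleK asboolT// => /esym/asboolP.
have := ball_triangle (ball_sym (H _ K1 a1 b1)) (H _ K2 a2 b2).
by rewrite -splitr => /ltW.
Qed.

(** The sigma-algebra on pairs is the product one, so relatively open preimages have to be exhibited
    as countable unions of products of boxes. *)
Lemma measurable_within_continuous (f : X -> R) :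
  {within K, continuous f} -> measurable_fun K f.
Proof.
move=> fc; apply: (measurability _ (RGenOInfty.measurableE R)) => // _ [_ [r ->] <-].
pose box (ab : ('rV[rat]_p * nat) * ('rV[rat]_q * nat)) : set X :=
  base_box ab.1 `*` base_box ab.2.
pose F ab := if `[< K `&` box ab `<=` [set z | r < f z] >] then box ab else set0.
have mK : measurable K by apply: measurableX; exact: compact_measurable_mx.
rewrite (_ : K `&` _ = K `&` \bigcup_ab F ab).
  apply: measurableI => //; apply: countable_bigcupT_measurable => // ab.
  rewrite /F; case: asboolP => // _.
  by apply: measurableX; exact: measurable_base_box.
apply/seteqP; split=> z /= [Kz]; rewrite in_itv/= andbT.
  move=> rz; split=> //.
  have [|ab [az bz H]] := @within_box f z [set y | r < y] fc Kz.
    by apply: open_nbhs_nbhs; split => //; exact: open_gt.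
  exists ab => //; rewrite /F; case: asboolP => // -[] z' [Kz' [az' bz']].
  exact: H.
by move=> [ab _]; rewrite /F; case: asboolP => // h hz; split=> //; exact: h.
Qed.

Lemma within_continuous_bounded (f : X -> R) : {within K, continuous f} ->
  exists M : R, forall z, K z -> `|f z| <= M.
Proof.
move=> fc; have [M [_ HM]] : bounded_set (f @` K).
  apply: compact_bounded; apply: continuous_compact => //; exact: compact_setX.
exists (M + 1) => z Kz; apply: (HM (M + 1)); first by rewrite ltrDl.
by exists z.
Qed.

End word_oscillation.

(** * The uniform variable and the quantile map of a tree of masses *)

Section uniform01.
Context (R : realType).
Local Open Scope ereal_scope.

Definition unif01 : probability (measurableTypeR R) R := uniform_prob (@ltr01 R).

Lemma unif01_itv (a b : R) : (0 <= a)%R -> (a <= b)%R -> (b <= 1)%R ->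
  unif01 `[a, b[%classic = (b - a)%:E.
Proof.
move=> a0 ab b1; rewrite /= /uniform_prob.
transitivity (\int[lebesgue_measure]_(x in `[a, b[) (cst 1) x).
  apply: eq_integral => x; rewrite inE/= in_itv/= => /andP[ax xb].
  rewrite /uniform_pdf (le_trans a0 ax) (le_trans (ltW xb) b1)/=.
  by rewrite subr0 invr1.
rewrite integral_cst//= lebesgue_measure_itv/= mul1e lte_fin.
by move: ab; rewrite le_eqVlt => /predU1P[->|->]; rewrite ?ltxx ?subrr.
Qed.

Lemma unif01_setI (A : set R) : measurable A ->
  unif01 A = unif01 (A `&` `[0%R, 1%R[%classic).
Proof.
move=> mA; pose I01 : set R := `[0%R, 1%R[%classic.
have mI : measurable I01 by exact: measurable_itv.
have null : unif01 (A `\` I01) = 0.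
  apply: (@subset_measure0 _ _ _ unif01 _ (~` I01)) => //.
  - exact: measurableD.
  - exact: measurableC.
  - transitivity (1 - unif01 I01); first exact: probability_setC.
    by rewrite unif01_itv// subr0 subee.
by rewrite [LHS](measureDI unif01 mA mI) [X in X + _]null add0e.
Qed.

End uniform01.

Section binary_tree.
Context (R : realType) (q : nat) (D : set 'rV[R]_q).

(* m w is meant as the mass of the points of D with word w; the last clause
   excludes empty cells. *)
Definition tree_mass (m : seq bool -> R) :=
  [/\ m [::] = 1, (forall w, 0 <= m w),
    (forall w, m w = m (false :: w) + m (true :: w)) &
    (forall w, (forall y, D y -> word (size w) y <> w) -> m w = 0)].

(** The intervals of a tree only cover [0, 1). Other values of [t], negligible for [unif01], are
    sent to 0, so that the quantile is defined, with values in [D], for every real [t]. *)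
Definition clip01 (t : R) := if (0 <= t) && (t < 1) then t else 0.

Lemma clip01_itv t : 0 <= clip01 t < 1.
Proof. by rewrite /clip01; case: ifPn => // _; rewrite lexx ltr01. Qed.

(* [0, 1) is cut into the intervals [left_end m w, left_end m w + m w), for
   the words w of a given length; path_of m t N is the word of the interval
   containing t. *)
Fixpoint left_end (m : seq bool -> R) (w : seq bool) : R :=
  if w is b :: w' then left_end m w' + (if b then m (false :: w') else 0) else 0.

Fixpoint path_of (m : seq bool -> R) (t : R) (N : nat) : seq bool :=
  if N is N'.+1 then
    let w := path_of m t N' in ~~ (t < left_end m w + m (false :: w)) :: w
  else [::].

Lemma size_path_of m t N : size (path_of m t N) = N.
Proof. by elim: N => //= N ->. Qed.

Section one_tree.
Context (m : seq bool -> R) (hm : tree_mass m).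

Lemma path_of_itv t N : 0 <= t < 1 ->
  left_end m (path_of m t N) <= t < left_end m (path_of m t N) + m (path_of m t N).
Proof.
have [m1 m0 mD _] := hm.
move=> t01; elim: N => [|N /andP[IH1 IH2]] /=; first by rewrite m1 add0r.
case: ltP => /= h; first by rewrite addr0 IH1 h.
by rewrite h -addrA -mD IH2.
Qed.

(** With [path_of_itv], the [t] of path [w] are exactly those of its interval, which is what gives
    them measure [m w]. *)
Lemma itv_path_of t w : left_end m w <= t < left_end m w + m w ->
  path_of m t (size w) = w.
Proof.
have [m1 m0 mD _] := hm.
elim: w => [//|b w IHw] /= /andP[].
case: b => h1 h2.
  rewrite IHw.
    by rewrite ltNge h1.
  rewrite [m w]mD addrA h2 andbT; apply: le_trans h1.
  by rewrite lerDl.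
rewrite addr0 in h1 h2; rewrite IHw ?h2//.
by rewrite h1/= (lt_le_trans h2)// [m w]mD lerD2l lerDl.
Qed.

Lemma left_end_itv w : 0 <= left_end m w /\ left_end m w + m w <= 1.
Proof.
have [m1 m0 mD _] := hm; elim: w => [|b w [IH1 IH2]] /=.
  by rewrite m1 add0r.
case: b; split; rewrite ?addr_ge0//.
  by rewrite -addrA -mD.
by rewrite addr0 (le_trans _ IH2)// lerD2l [m w]mD lerDl.
Qed.

End one_tree.

Hypotheses (cD : compact D) (D0 : D !=set0).

Lemma word_close (e : R) : 0 < e -> exists N, forall x y, D x -> D y ->
  word N x = word N y -> forall i, `|x 0 i - y 0 i| <= e.
Proof.
move=> e0.
have h (i : 'I_q) : exists N, forall x y, D x -> D y ->
    word N x = word N y -> `|x 0 i - y 0 i| <= e.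
  have c1 : compact [set (0 : 'rV[R]_1)] by exact: compact_set1.
  have fc : {within [set (0 : 'rV[R]_1)] `*` D,
      continuous (fun z : 'rV[R]_1 * 'rV[R]_q => z.2 0 i)}.
    apply: continuous_subspaceT => z.
    apply: (@continuous_comp _ _ _ snd (fun x : 'rV[R]_q => x 0 i)).
      exact: cvg_snd.
    exact: coord_continuous.
  have [N HN] := word_oscillation c1 cD fc e0.
  by exists N => x y Dx Dy xy; apply: (HN (0, x) (0, y)).
pose N i := sval (cid (h i)).
exists (\max_i N i) => x y Dx Dy xy i; apply: (svalP (cid (h i))) => //.
by apply: eq_word_leq xy; exact: leq_bigmax.
Qed.

(** A cell that misses [D] gets an arbitrary point of [D], so that all approximate quantiles stay in
    [D]. *)
Definition cell_point (w : seq bool) : 'rV[R]_q :=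
  if pselect (exists2 y, D y & word (size w) y = w) is left h
  then sval (cid2 h) else sval (cid D0).

Lemma cell_pointD w : D (cell_point w).
Proof.
rewrite /cell_point; case: pselect => [h|_]; last exact: (svalP (cid D0)).
by case: (cid2 h).
Qed.

Lemma word_cell_point w : (exists2 y, D y & word (size w) y = w) ->
  word (size w) (cell_point w) = w.
Proof. by move=> h; rewrite /cell_point; case: pselect => // {}h; case: (cid2 h). Qed.

(** A Skorokhod-type representation: the nested cells along the path of [t] shrink to a point. As
    cells need not be closed, this point may lie outside them; only its distance to the cell points
    is controlled. *)
Definition quantile (m : seq bool -> R) (t : R) : 'rV[R]_q :=
  lim (cell_point (path_of m (clip01 t) N) @[N --> \oo]).

Section quantile.
Context (m : seq bool -> R) (hm : tree_mass m) (t : R).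
Local Notation u := (fun N => cell_point (path_of m (clip01 t) N)).

(** The interval of the path contains [clip01 t], so its length, which is a mass, is positive. By
    the last clause of [tree_mass] the cell meets [D], and its chosen point has the path as its
    word. *)
Lemma word_path_of M N : (M <= N)%N -> word M (u N) = path_of m (clip01 t) M.
Proof.
have [m1 m0 mD mz] := hm.
have wN N' : word N' (u N') = path_of m (clip01 t) N'.
  rewrite -{1}(size_path_of m (clip01 t) N'); apply: word_cell_point.
  apply: contrapT => /forall2NP h.
  have := path_of_itv hm N' (clip01_itv t); rewrite mz; last first.
    by move=> y Dy wy; case: (h y).
  by rewrite addr0 => /andP[a b]; have := le_lt_trans a b; rewrite ltxx.
move=> /subnK <-; elim: (N - M)%N => [|k IHk]; first by rewrite add0n wN.
have := wN (k + M).+1; rewrite addSn /= => -[_ wk].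
rewrite -IHk; apply: (@eq_word_leq _ _ _ (k + M)); first exact: leq_addl.
by rewrite wN wk.
Qed.

Lemma quantile_cvg : u N @[N --> \oo] --> quantile m t.
Proof.
suff : cvg (u N @[N --> \oo]) by [].
apply: cauchy_cvg; apply: cauchy_exP => e e0.
have [N HN] := word_close (divr_gt0 e0 (ltr0n R 2)).
exists (u N); exists N => // k /= Nk; split=> // i j; rewrite ord1 /ball/=.
apply: (@le_lt_trans _ _ (e / 2)); last by rewrite ltr_pdivrMr// ltr_pMr// ltr1n.
apply: HN; [exact: cell_pointD|exact: cell_pointD|].
by rewrite !word_path_of.
Qed.

Lemma quantileD : D (quantile m t).
Proof.
apply: (closed_cvg D _ _ _ quantile_cvg).
  by apply: compact_closed => //; exact: norm_hausdorff.
by apply: nearW => N; exact: cell_pointD.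
Qed.

End quantile.
End binary_tree.

Section measurable_quantile.
Context (R : realType) (q : nat) (D : set 'rV[R]_q).
Context (cD : compact D) (D0 : D !=set0).

Lemma measurable_clip01 : measurable_fun setT (@clip01 R).
Proof.
apply: measurable_fun_ifT => //.
by apply: measurable_and => //; [exact: measurable_fun_ler|exact: measurable_fun_ltr].
Qed.

Section family.
Context d (T : measurableType d) (m : T -> seq bool -> R).
Hypotheses (hm : forall x, tree_mass D (m x))
  (mm : forall w, measurable_fun setT (fun x => m x w)).

Lemma measurable_left_end w : measurable_fun setT (fun x => left_end (m x) w).
Proof.
elim: w => [|b w IHw] /=; first exact: measurable_cst.
by apply: measurable_funD => //; case: b; [exact: mm|exact: measurable_cst].
Qed.

Lemma measurable_path_of N w : measurable [set z : T * measurableTypeR R |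
  path_of (m z.1) (clip01 z.2) N = w].
Proof.
elim: N w => [|N IHN] w /=.
  have [->|w0] := eqVneq w [::].
    by rewrite (_ : [set x | _] = setT)//; apply/seteqP.
  rewrite (_ : [set x | _] = set0)//; apply/seteqP; split=> // x /= /esym/eqP.
  by rewrite (negbTE w0).
case: w => [|b w].
  by rewrite (_ : [set x | _] = set0)//; apply/seteqP; split=> x.
pose g (z : T * measurableTypeR R) :=
  ~~ (clip01 z.2 < left_end (m z.1) w + m z.1 (false :: w)).
have mg : measurable_fun setT g.
  apply: measurable_neg; apply: measurable_fun_ltr.
    exact: measurableT_comp measurable_clip01 measurable_snd.
  apply: measurable_funD.
    exact: measurableT_comp (measurable_left_end w) measurable_fst.
  exact: measurableT_comp (mm _) measurable_fst.
rewrite (_ : [set x | _] = g @^-1` [set b] `&`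
    [set z | path_of (m z.1) (clip01 z.2) N = w]).
  by apply: measurableI => //; rewrite -[X in measurable X]setTI; exact: mg.
apply/seteqP; split=> z /= [gb pw]; first by split=> //; rewrite -gb /g pw.
by rewrite pw; congr (_ :: _).
Qed.

(** The map depends on a finite word only, hence has countably many values: the preimage of any set
    [Y], Borel or not, is a countable union of the sets of [measurable_path_of]. *)
Lemma measurable_cell_point_path N : measurable_fun setT
  (fun z : T * measurableTypeR R => cell_point D0 (path_of (m z.1) (clip01 z.2) N)).
Proof.
move=> _ Y _; rewrite setTI.
rewrite (_ : _ @^-1` Y = \bigcup_w (if `[< Y (cell_point D0 w) >]
    then [set z | path_of (m z.1) (clip01 z.2) N = w] else set0)).
  apply: countable_bigcupT_measurable => // w; case: asboolP => // _.
  exact: measurable_path_of.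
apply/seteqP; split=> z /= => [Yz|[w _]].
  by exists (path_of (m z.1) (clip01 z.2) N) => //; rewrite asboolT.
by case: asboolP => //= Yw ->.
Qed.

Lemma measurable_quantile : measurable_fun setT
  (fun z : T * measurableTypeR R => quantile D0 (m z.1) z.2).
Proof.
apply: measurable_fun_rV => i.
apply: (measurable_fun_cvg (h := fun N z =>
    cell_point D0 (path_of (m z.1) (clip01 z.2) N) 0 i)).
  move=> N.
  exact: (measurableT_comp (measurable_coord_rV i) (measurable_cell_point_path N)).
move=> z _; apply: (@continuous_cvg _ _ _ _ _ _ (fun x : 'rV[R]_q => x 0 i)).
  exact: coord_continuous.
exact: quantile_cvg.
Qed.

Lemma measurable_quantile2 x : measurable_fun setT (quantile D0 (m x) : measurableTypeR R -> _).
Proof. exact: (measurable_fun_pair2 x measurable_quantile). Qed.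

Lemma unif01_path_of x w :
  unif01 R [set t | path_of (m x) (clip01 t) (size w) = w] = (m x w)%:E.
Proof.
have [m1 m0 mD mz] := hm x.
have [a0 b1] := left_end_itv (hm x) w.
(* For [t] outside [0, 1) the path is that of 0; restricting to [0, 1) discards these [t]. *)
rewrite unif01_setI; last first.
  have := measurable_xsection x (measurable_path_of (size w) w).
  by congr measurable; apply/seteqP; split=> t; rewrite xsectionE.
transitivity (unif01 R `[left_end (m x) w, left_end (m x) w + m x w[%classic); last first.
  by rewrite unif01_itv ?lerDl// addrAC subrr add0r.
congr (unif01 R _); apply/seteqP; split=> t /=; rewrite !in_itv/=.
  move=> [wt t01]; have ct : clip01 t = t by rewrite /clip01 t01.
  by rewrite ct in wt; have := path_of_itv (hm x) (size w) t01; rewrite wt.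
move=> /[dup] tw /andP[t1 t2]; have t01 : 0 <= t < 1.
  by rewrite (le_trans a0 t1) (lt_le_trans t2 b1).
split=> //; rewrite /clip01 t01; apply: (itv_path_of (D := D)) => //; exact: hm.
Qed.

HB.instance Definition _ x := isMeasurableFun.Build _ _ _ _
  (quantile D0 (m x) : measurableTypeR R -> 'rV[R]_q) (measurable_quantile2 x).

Definition quantile_law (x : T) : probability 'rV[R]_q R :=
  distribution (unif01 R) (quantile D0 (m x) : {mfun measurableTypeR R >-> 'rV[R]_q}).

Lemma quantile_lawE x A : quantile_law x A = unif01 R (quantile D0 (m x) @^-1` A).
Proof. by []. Qed.

Lemma quantile_law_prob_on x : prob_on D (quantile_law x).
Proof.
rewrite /prob_on /mkset quantile_lawE -[RHS](probability_setT (unif01 R)).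
by congr (unif01 R _); apply/seteqP; split=> // t _; exact: quantileD.
Qed.

End family.
End measurable_quantile.

Lemma le_measure_bigcup_fin d (T : measurableType d) (R : realType)
    (mu : {measure set T -> \bar R}) (I : finType) (F : I -> set T) :
  (forall i, measurable (F i)) -> (mu (\bigcup_i F i) <= \sum_i mu (F i))%E.
Proof.
move=> mF; have -> : \bigcup_i F i = \big[setU/set0]_(i <- index_enum I) F i.
  rewrite -bigcup_seq; apply: eq_bigcupl; split=> i //= _.
  exact: mem_index_enum.
elim: (index_enum I) => [|i s IHs]; first by rewrite !big_nil measure0.
rewrite !big_cons; apply: le_trans (measureU2 _ _ _) _ => //.
  exact: bigsetU_measurable.
exact: leeD.
Qed.

(** * Measurability of quantile laws for the Wasserstein distance *)

Section quantile_law_L2.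
Context (R : realType) (q : nat) (D : set 'rV[R]_q).
Context (cD : compact D) (D0 : D !=set0).

Lemma quantile_cell_point (m : seq bool -> R) (hm : tree_mass D m) t (e : R) N :
  (forall x y, D x -> D y -> word N x = word N y -> forall i, `|x 0 i - y 0 i| <= e) ->
  forall i, `|quantile D0 m t 0 i - cell_point D0 (path_of m (clip01 t) N) 0 i| <= e.
Proof.
move=> HN i.
pose u k : R := `|cell_point D0 (path_of m (clip01 t) k) 0 i -
   cell_point D0 (path_of m (clip01 t) N) 0 i|.
have ucvg : u k @[k --> \oo] --> `|quantile D0 m t 0 i -
    cell_point D0 (path_of m (clip01 t) N) 0 i|.
  apply: cvg_norm; apply: cvgB; last exact: cvg_cst.
  apply: (@continuous_cvg _ _ _ _ _ _ (fun x : 'rV[R]_q => x 0 i)).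
    exact: coord_continuous.
  exact: quantile_cvg.
rewrite -(cvg_lim _ ucvg)//; apply: limr_le; first by apply/cvg_ex; eexists; exact: ucvg.
exists N => // k /= Nk; apply: HN; [exact: cell_pointD|exact: cell_pointD|].
by rewrite !(word_path_of D0 hm).
Qed.

Lemma unif01_itv_le (a b : R) : 0 <= a <= 1 -> 0 <= b <= 1 ->
  (unif01 R `[a, b[%classic <= `|b - a|%:E)%E.
Proof.
move=> /andP[a0 a1] /andP[b0 b1]; have [ab|ba] := leP a b.
  by rewrite unif01_itv// ger0_norm// subr_ge0.
rewrite (_ : `[a, b[%classic = set0) ?measure0 ?lee_fin//.
by apply: set_itv_ge; rewrite -leNgt bnd_simp ltW.
Qed.

Context d (T : measurableType d) (m : T -> seq bool -> R).
Hypotheses (hm : forall x, tree_mass D (m x))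
  (mm : forall w, measurable_fun setT (fun x => m x w)).
Local Notation law := (quantile_law cD D0 hm mm).

Let path_differ N x x' := [set t : measurableTypeR R |
  path_of (m x) (clip01 t) N <> path_of (m x') (clip01 t) N].

Let measurable_path1 N x w : measurable [set t : measurableTypeR R |
  path_of (m x) (clip01 t) N = w].
Proof.
have := measurable_xsection x (measurable_path_of mm N w).
by congr measurable; apply/seteqP; split=> t; rewrite xsectionE.
Qed.

Let measurable_differ N x x' : measurable (path_differ N x x').
Proof.
rewrite (_ : path_differ N x x' = \bigcup_(w : N.-tuple bool)
  ([set t | path_of (m x) (clip01 t) N = w] `\`
   [set t | path_of (m x') (clip01 t) N = w])).
  apply: fin_bigcup_measurable => // w _; apply: measurableD; exact: measurable_path1.
apply/seteqP; split=> t /=.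
  move=> tx; exists (tcast (size_path_of (m x) (clip01 t) N)
     (in_tuple (path_of (m x) (clip01 t) N))) => //=.
  by rewrite val_tcast/=; split=> // /esym.
by move=> [w _ /= [tw h]]; rewrite /path_differ/= tw => /esym.
Qed.

(** If [t] has path [w] for [x] but not for [x'], it lies before or after the interval of [w] for
    [x']. This leaves two intervals, of length at most [eta] and [2 * eta], since a right end is the
    sum of two perturbed terms; and there are [2 ^ N] words. *)
Let differ_le N x x' (eta : R) :
  (forall w : N.-tuple bool, `|left_end (m x) w - left_end (m x') w| <= eta) ->
  (forall w : N.-tuple bool, `|m x w - m x' w| <= eta) ->
  (unif01 R (path_differ N x x') <= (3 * eta * (2 ^ N)%:R)%:E)%E.
Proof.
move=> Ha Hm.
pose I (w : N.-tuple bool) := (`[left_end (m x) w, left_end (m x') w[%classic `|`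
  `[left_end (m x') w + m x' w, left_end (m x) w + m x w[%classic) : set (measurableTypeR R).
have mI w : measurable (I w) by apply: measurableU; exact: measurable_itv.
have sub : path_differ N x x' `&` `[0, 1[%classic `<=` \bigcup_w I w.
  move=> t [tx]; rewrite /= in_itv/= => t01.
  have ct : clip01 t = t by rewrite /clip01 t01.
  have wE := size_path_of (m x) t N.
  exists (tcast wE (in_tuple (path_of (m x) t N))) => //.
  rewrite /I !val_tcast /=.
  have /andP[t1 t2] := path_of_itv (hm x) N t01.
  rewrite !in_itv/= t1 t2 andbT/=; apply/orP; rewrite -implyNb -leNgt; apply/implyP => t3.
  rewrite leNgt; apply/negP => t4; apply: tx; rewrite ct.
  by rewrite -[in RHS]wE (itv_path_of (hm x'))// t3 t4.
have le01 y (w : seq bool) : 0 <= left_end (m y) w <= 1 /\ 0 <= left_end (m y) w + m y w <= 1.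
  have [a0 b1] := left_end_itv (hm y) w; have [_ m0 _ _] := hm y.
  by rewrite a0 b1 addr_ge0// (le_trans _ b1)// lerDl.
have eta0 : 0 <= eta by apply: le_trans (Ha (nseq_tuple N false)).
rewrite unif01_setI; last exact: measurable_differ.
apply: (@le_trans _ _ (\sum_(w : N.-tuple bool) unif01 R (I w))%E).
  apply: le_trans (le_measure_bigcup_fin (unif01 R) mI).
  apply: le_measure; rewrite ?inE//.
    by apply: measurableI; [exact: measurable_differ|exact: measurable_itv].
  exact: fin_bigcup_measurable.
apply: (@le_trans _ _ (\sum_(w : N.-tuple bool) (3 * eta)%:E)%E).
  apply: lee_sum => w _.
  apply: (le_trans (measureU2 (unif01 R) (measurable_itv _) (measurable_itv _))).
  have [l1 r1] := le01 x w; have [l2 r2] := le01 x' w.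
  apply: (le_trans (leeD (unif01_itv_le l1 l2) (unif01_itv_le r2 r1))).
  rewrite -EFinD lee_fin (_ : 3 * eta = eta + (eta + eta)); last by ring.
  apply: lerD; first by rewrite distrC.
  rewrite opprD addrACA; apply: le_trans (ler_normD _ _) _; exact: lerD.
by rewrite sumEFin lee_fin sumr_const card_tuple card_bool mulr_natr.
Qed.

Lemma measurable_left_end_box N (k : nat) (r : {ffun N.-tuple bool -> rat * rat}) :
  measurable [set x | forall w : N.-tuple bool,
    `|left_end (m x) w - ratr (r w).1| < k.+1%:R^-1 /\
    `|m x w - ratr (r w).2| < k.+1%:R^-1].
Proof.
pose B1 (w : N.-tuple bool) := [set x | `|left_end (m x) w - ratr (r w).1| < k.+1%:R^-1].
pose B2 (w : N.-tuple bool) := [set x | `|m x w - ratr (r w).2| < k.+1%:R^-1].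
have mB (f : T -> R) (c : R) : measurable_fun setT f -> measurable [set x : T | `|f x - c| < k.+1%:R^-1].
  move=> mf; rewrite -[X in measurable X]setTI.
  have -> : [set x | `|f x - c| < k.+1%:R^-1] = f @^-1` ball c k.+1%:R^-1.
    by apply/seteqP; split=> x; rewrite /ball/= distrC.
  by apply: mf => //; rewrite ball_itv; exact: measurable_itv.
rewrite (_ : [set x | _] = \bigcap_(w in [set: N.-tuple bool]) (B1 w `&` B2 w)).
  apply: fin_bigcap_measurable => // w _; apply: measurableI; apply: mB => //.
  exact: measurable_left_end.
by apply/seteqP; split=> x h w; [move=> _; exact: (h w)|exact: (h w I)].
Qed.

(* Under the uniform variable, the quantile maps of x and x' form a coupling,
   so that law is W_2-continuous with respect to finitely many of the
   measurable functions m _ w. *)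
Lemma measurable_W2_open_quantile_law (U : set (probability 'rV[R]_q R)) :
  W2_open D U -> measurable [set x | U (law x)].
Proof.
move=> [UD Uo].
pose A := [set x | U (law x)].
pose B N k (r : {ffun N.-tuple bool -> rat * rat}) : set T :=
  [set x | forall w : N.-tuple bool,
    `|left_end (m x) w - ratr (r w).1| < k.+1%:R^-1 /\
    `|m x w - ratr (r w).2| < k.+1%:R^-1].
suff near x : A x -> exists N k r, B N k r x /\ B N k r `<=` A.
  (* There are only countably many boxes with rational centres, so it is enough that each point of
     [A] lies in one contained in [A]. *)
  rewrite (_ : [set x | _] = \bigcup_N \bigcup_k \bigcup_r
      (if `[< B N k r `<=` A >] then B N k r else set0)).
    apply: bigcupT_measurable => N; apply: bigcupT_measurable => k.
    apply: countable_bigcupT_measurable => // r; case: asboolP => // _.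
    exact: measurable_left_end_box.
  apply/seteqP; split=> x.
    by move=> /near[N [k [r [Bx BA]]]]; exists N => //; exists k => //; exists r; rewrite ?asboolT.
  by move=> [N _ [k _ [r _]]]; case: asboolP => // BA; exact: BA.
move=> Ax; have [e e0 He] := Uo _ Ax.
have [M HM] : exists M : R, forall y y', D y -> D y' -> forall i, `|y 0 i - y' 0 i| <= M.
  have [M [_ HM]] := compact_bounded cD.
  have HM' y : D y -> forall i, `|y 0 i| <= M + 1.
    move=> Dy i; apply: (le_trans _ (HM (M + 1) _ y Dy)); last by rewrite ltrDl.
    by rewrite [leRHS]mx_normrE; apply: le_trans (le_bigmax _ _ (ord0, i)).
  exists ((M + 1) + (M + 1)) => y y' Dy Dy' i.
  by apply: le_trans (ler_normB _ _) _; apply: lerD; exact: HM'.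
pose Q : R := q%:R.
(* Where the two paths agree up to length [N], both quantiles are within [de] of the same cell
   point. The cost there is at most [Q * (2 * de) ^+ 2], that is [e ^+ 2 / 4 * (Q / (Q + 1) ^+ 2)],
   below [e ^+ 2 / 2]. *)
pose de := e / (4 * (Q + 1)).
have Q0 : 0 <= Q by exact: ler0n.
have de0 : 0 < de by rewrite divr_gt0// mulr_gt0// ltr_wpDl.
have [N HN] := word_close cD de0.
have QM0 : 0 <= Q * M ^+ 2 by apply: mulr_ge0 => //; exact: sqr_ge0.
have Qde0 : 0 <= Q * (2 * de) ^+ 2 by apply: mulr_ge0 => //; exact: sqr_ge0.
(* Where the paths differ the cost is at most [Q * M ^+ 2]. Two points of a box differ by at most
   twice its radius [1 / (k + 1)], so [differ_le] bounds the measure of that set by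
   [6 * 2 ^ N / (k + 1)]. [C] dominates the product generously, and the added 1 makes it
   positive. *)
pose C : R := Q * M ^+ 2 * 3 * 4 * (2 ^ N)%:R + 1.
have C0 : 0 < C.
  by rewrite /C ltr_wpDl// mulr_ge0// mulr_ge0// mulr_ge0.
have [k _ ke] := near_infty_natSinv_lt (PosNum (divr_gt0 (divr_gt0 (exprn_gt0 2 e0) (ltr0n R 2)) C0)).
have kE : k.+1%:R^-1 < e ^+ 2 / 2 / C := ke k (leqnn k).
have k0 : (0 : R) < k.+1%:R^-1 by rewrite invr_gt0 ltr0n.
have hr (c : R) : exists r : rat, `|c - ratr r| < k.+1%:R^-1.
  have lt1 : c - k.+1%:R^-1 < c + k.+1%:R^-1 :> R by rewrite ltrD2l gtrN.
  have [r] := rat_in_itvoo lt1.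
  by rewrite in_itv/= => /andP[r1 r2]; exists r; rewrite distrC ltr_distl r1 r2.
pose rr c := sval (cid (hr c)).
have rrP c : `|c - ratr (rr c)| < k.+1%:R^-1 := svalP (cid (hr c)).
exists N, k, [ffun w : N.-tuple bool => (rr (left_end (m x) w), rr (m x w))]; split.
  by move=> w; rewrite ffunE.
move=> x' Bx'; apply: He; first exact: quantile_law_prob_on.
pose Z (t : measurableTypeR R) := (quantile D0 (m x) t, quantile D0 (m x') t).
have mZ : measurable_fun setT Z.
  by apply: measurable_fun_pair; exact: (measurable_quantile2 cD D0 hm mm).
pose Zm : {mfun measurableTypeR R >-> ('rV[R]_q * 'rV[R]_q)%type} :=
  mfun_Sub (mem_set mZ).
have ZmE : Zm = Z :> (_ -> _) by rewrite /Zm mfun_valP.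
pose gam : probability ('rV[R]_q * 'rV[R]_q)%type R := distribution (unif01 R) Zm.
apply: (coupling_W2_lt (gam := gam)) => //.
  move=> V mV; have gamE W : gam W = unif01 R (Z @^-1` W) by rewrite -ZmE.
  rewrite !gamE !quantile_lawE; split; congr (unif01 R _).
    by apply/seteqP; split=> t //= -[].
  by apply/seteqP; split=> t //= -[].
rewrite /gam ge0_integral_distribution; last 2 first.
  - by apply/measurable_EFinP; exact: measurable_sqdist.
  - by move=> z; rewrite lee_fin sqdist_ge0.
rewrite ZmE /comp /=.
pose P := path_differ N x x'.
have mP : measurable P by exact: measurable_differ.
apply: (@le_lt_trans _ _ (\int[unif01 R]_t ((Q * (2 * de) ^+ 2)%:E +
    (Q * M ^+ 2)%:E * (\1_P t)%:E))%E).
  apply: ge0_le_integral => //.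
  - by move=> t _; rewrite lee_fin; exact: (sqdist_ge0 (Z t)).
  - apply/measurable_EFinP; apply: (measurableT_comp
      (f := fun z : 'rV[R]_q * 'rV[R]_q => \sum_i (z.1 0 i - z.2 0 i) ^+ 2) _ mZ).
    exact: measurable_sqdist.
  - apply/measurable_EFinP; apply: measurable_funD; first exact: measurable_cst.
    by apply: measurable_funM; [exact: measurable_cst|exact: measurable_indic].
  move=> t _; rewrite -EFinM -EFinD lee_fin.
  have [tP|tP] := pselect (P t).
    rewrite indicE mem_set// mulr1 -[leLHS]add0r; apply: lerD.
      exact: Qde0.
    rewrite (_ : Q * _ = \sum_(i < q) M ^+ 2); last by rewrite sumr_const card_ord -[RHS]mulr_natl.
    apply: ler_sum => i _; rewrite -real_normK ?num_real//.
    have HMi := HM _ _ (quantileD cD D0 (hm x) t) (quantileD cD D0 (hm x') t) i.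
    by apply: lerXn2r => //; rewrite nnegrE// (le_trans _ HMi).
  rewrite indicE memNset// mulr0 addr0.
  rewrite (_ : Q * _ = \sum_(i < q) (2 * de) ^+ 2); last by rewrite sumr_const card_ord -[RHS]mulr_natl.
  apply: ler_sum => i _; rewrite -real_normK ?num_real//.
  have tde0 : 0 <= 2 * de by apply: mulr_ge0 => //; exact: ltW.
  apply: lerXn2r; rewrite ?nnegrE//.
  have pE : path_of (m x) (clip01 t) N = path_of (m x') (clip01 t) N.
    by apply: contrapT.
  have h1 := quantile_cell_point (hm x) t HN i.
  have h2 := quantile_cell_point (hm x') t HN i.
  rewrite mulr_natl mulr2n; rewrite -pE distrC in h2.
  by apply: le_trans (ler_distD _ _ _) (lerD h1 h2).
rewrite ge0_integralD//; last 2 first.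
  - by move=> t _; rewrite -EFinM lee_fin mulr_ge0.
  - apply/measurable_EFinP.
    by apply: measurable_funM; [exact: measurable_cst|exact: measurable_indic].
rewrite integral_cst// ge0_integralZl//; last first.
  by apply/measurable_EFinP; exact: measurable_indic.
rewrite integral_indic// setIT [X in (_ * X + _)%E](probability_setT (unif01 R)) mule1.
have dP : (unif01 R P <= (3 * (2 * k.+1%:R^-1) * (2 ^ N)%:R)%:E)%E.
  apply: differ_le => w.
    have [+ _] := Bx' w; rewrite ffunE /= => h.
    rewrite mulr_natl mulr2n; apply: le_trans (ler_distD (ratr (rr (left_end (m x) w))) _ _) _.
    by apply: lerD; apply: ltW => //; rewrite distrC.
  have [_] := Bx' w; rewrite ffunE /= => h.
  rewrite mulr_natl mulr2n; apply: le_trans (ler_distD (ratr (rr (m x w))) _ _) _.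
  by apply: lerD; apply: ltW => //; rewrite distrC.
apply: (@le_lt_trans _ _ ((Q * (2 * de) ^+ 2)%:E + (Q * M ^+ 2)%:E *
    (3 * (2 * k.+1%:R^-1) * (2 ^ N)%:R)%:E)%E).
  by apply: leeD => //; apply: lee_wpmul2l.
rewrite -EFinM -EFinD lte_fin.
apply: (@lt_le_trans _ _ (e ^+ 2 / 2 + e ^+ 2 / 2)); last by rewrite -splitr.
apply: ler_ltD.
  rewrite /de (_ : Q * _ = e ^+ 2 / 4 * (Q / (Q + 1) ^+ 2)); last first.
    field; rewrite ?andbT; apply: lt0r_neq0; exact: ltr_wpDl.
  rewrite (_ : e ^+ 2 / 2 = e ^+ 2 / 4 * 2); last by field.
  apply: ler_wpM2l; first by rewrite divr_ge0// sqr_ge0.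
  rewrite ler_pdivrMr ?exprn_gt0 ?ltr_wpDl//; nra.
apply: (@le_lt_trans _ _ (C * k.+1%:R^-1)).
  rewrite /C; set K := k.+1%:R^-1 in k0 *; set L := (2 ^ N)%:R.
  have L0 : 0 <= L by exact: ler0n.
  have : 0 <= Q * M ^+ 2 * L * K by rewrite mulr_ge0 ?(ltW k0)// mulr_ge0.
  nra.
by move: kE; rewrite ltr_pdivlMr// mulrC.
Qed.

End quantile_law_L2.

(** * Ultralimits of maps into P(D) *)

Section ge0_integral_mfrestr.
Context d (T : measurableType d) (R : realType) (mu : {measure set T -> \bar R}).
Local Open Scope ereal_scope.

Lemma ge0_integral_mfrestr (D : set T) (mD : measurable D) (D_fin : mu D < +oo)
    (A : set T) (f : T -> \bar R) :
  measurable A -> measurable_fun setT f -> (forall x, 0 <= f x) ->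
  \int[mfrestr mD D_fin]_(x in A) f x = \int[mu]_(x in D `&` A) f x.
Proof.
move=> mA mf f0; rewrite [LHS]integral_mkcond [RHS]integral_mkcondr.
apply: (ge0_integral_functional (mu := mfrestr mD D_fin)
  (Phi := fun f => \int[mu]_(x in D) f x)) => //.
- by move=> B mB; rewrite integral_indic.
- by move=> g h mg mh g0 h0; rewrite ge0_integralD//; exact: measurable_funTS.
- by move=> r g r0 mg g0; rewrite ge0_integralZl//; exact: measurable_funTS.
- move=> f_ mf_ f_0 f_nd; rewrite monotone_convergence// => n.
  exact: measurable_funTS.
- by apply/(measurable_restrictT _ _).1 => //; exact: measurable_funTS.
- by move=> x; rewrite patchE; case: ifP.
Qed.

End ge0_integral_mfrestr.

(** Compactness of the segment gives a cluster point, and an ultrafilter converges to any of its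
    cluster points. *)
Lemma ultra_cvg_itv (R : realType) (G : set_system nat) (u : nat -> R) (a b : R) :
  UltraFilter G -> (forall n, a <= u n <= b) -> cvg (u n @[n --> G]).
Proof.
move=> UG uab.
have [|l [_ ul]] := @segment_compact R a b (u n @[n --> G]) _.
  by apply: (@filterE _ G) => n; rewrite /= in_itv/= uab.
apply/cvg_ex; exists l => B Bl; have [//|GB] := in_ultra_setVsetC (u @^-1` B) UG.
have [x [/= nBx Bx]] := ul (~` B) B GB Bl.
by [].
Qed.

Section ultralimit_measure.
Context d (T : measurableType d) (R : realType) (m : {finite_measure set T -> \bar R}).
Context (G : set_system nat) (UG : UltraFilter G).
Context (nu : nat -> {measure set T -> \bar R}).
Hypothesis num : forall n A, measurable A -> (nu n A <= m A)%E.

(* Domination by m makes the set-wise limit sigma-additive. *)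
Definition ultralim_measure (A : set T) : \bar R :=
  if `[< measurable A >] then (lim (fine (nu n A) @[n --> G]))%:E else 0%E.

Let nufin n A : measurable A -> nu n A \is a fin_num.
Proof.
move=> mA; rewrite ge0_fin_numE//; apply: le_lt_trans (num n mA) _.
by rewrite -ge0_fin_numE// fin_num_measure.
Qed.

Let num' n A : measurable A -> 0 <= fine (nu n A) <= fine (m A).
Proof.
by move=> mA; rewrite fine_ge0//= fine_le//; [exact: nufin|exact: fin_num_measure|exact: num].
Qed.

Lemma ultralim_measure_cvg A : measurable A ->
  fine (nu n A) @[n --> G] --> fine (ultralim_measure A).
Proof.
move=> mA; rewrite /ultralim_measure asboolT//=.
by apply: (@ultra_cvg_itv _ _ _ 0 (fine (m A))) => n; exact: num'.
Qed.

Let limE A : measurable A -> ultralim_measure A = (lim (fine (nu n A) @[n --> G]))%:E.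
Proof. by move=> mA; rewrite /ultralim_measure asboolT. Qed.

Let lim_unique A l : measurable A -> fine (nu n A) @[n --> G] --> l ->
  ultralim_measure A = l%:E.
Proof. by move=> mA h; rewrite limE//; congr (_%:E); exact: cvg_lim h. Qed.

Lemma ultralim_measure_ge0 A : (0 <= ultralim_measure A)%E.
Proof.
rewrite /ultralim_measure; case: asboolP => // mA; rewrite lee_fin.
apply: limr_ge; first by apply: (@ultra_cvg_itv _ _ _ 0 (fine (m A))) => n; exact: num'.
by apply: nearW => n; rewrite fine_ge0.
Qed.

Lemma ultralim_measure_le A : measurable A -> (ultralim_measure A <= m A)%E.
Proof.
move=> mA; rewrite limE// -(fineK (fin_num_measure m _ mA)) lee_fin.
apply: limr_le; first by apply: (@ultra_cvg_itv _ _ _ 0 (fine (m A))) => n; exact: num'.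
by apply: nearW => n; have /andP[] := num' n mA.
Qed.

Let lim0 : ultralim_measure set0 = 0%E.
Proof.
apply: lim_unique => //; rewrite (_ : (fun n => _) = cst 0); first exact: cvg_cst.
by apply/funext => n; rewrite measure0.
Qed.

Let limU A B : measurable A -> measurable B -> A `&` B = set0 ->
  ultralim_measure (A `|` B) = (ultralim_measure A + ultralim_measure B)%E.
Proof.
move=> mA mB AB; rewrite (limE mA) (limE mB) -EFinD.
apply: lim_unique; first exact: measurableU.
rewrite (_ : (fun n => _) = fun n => fine (nu n A) + fine (nu n B)).
  have := ultralim_measure_cvg mA; have := ultralim_measure_cvg mB.
  by rewrite (limE mA) (limE mB) => hB hA; exact: cvgD.
apply/funext => n; rewrite measureU// fineD//; exact: nufin.
Qed.

Let lim_sigma_additive : semi_sigma_additive ultralim_measure.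
Proof.
move=> F mF tF mUF.
have disj n : \big[setU/set0]_(i < n) F i `&` F n = set0.
  rewrite -bigcup_mkord; apply/seteqP; split=> // x [[i /= iltn Fix] Fnx].
  have := tF i n I I (ex_intro _ x (conj Fix Fnx)) => iE.
  by rewrite iE ltnn in iltn.
have finitely n : (\sum_(0 <= i < n) ultralim_measure (F i))%E =
    ultralim_measure (\big[setU/set0]_(i < n) F i).
  elim: n => [|n IHn]; first by rewrite big_nil big_ord0 lim0.
  rewrite big_nat_recr//= IHn big_ord_recr/= limU//.
    exact: bigsetU_measurable.
  exact: disj.
have mU n : measurable (\big[setU/set0]_(i < n) F i) by exact: bigsetU_measurable.
have subU n : \big[setU/set0]_(i < n) F i `<=` \bigcup_k F k by exact: bigsetU_bigcup.
have split n : ultralim_measure (\bigcup_k F k) =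
   (ultralim_measure (\big[setU/set0]_(i < n) F i) +
    ultralim_measure (\bigcup_k F k `\` \big[setU/set0]_(i < n) F i))%E.
  rewrite -limU ?setDIK//; last exact: measurableD.
  by rewrite setDUK.
have mcv : (m (\bigcup_k F k) - m (\big[setU/set0]_(i < n) F i))%E @[n --> \oo] --> 0%E.
  have cv : m (\big[setU/set0]_(i < n) F i) @[n --> \oo] --> m (\bigcup_k F k).
    rewrite (_ : (fun n => _) = fun n => (\sum_(0 <= i < n) m (F i))%E).
      exact: measure_semi_sigma_additive.
    apply/funext => n; elim: n => [|n IHn].
      by rewrite big_nil big_ord0 measure0.
    rewrite big_nat_recr//= -IHn big_ord_recr/= measureU//.
      exact: bigsetU_measurable.
    exact: disj.
  have fin := fin_num_measure m _ mUF.
  have := cvgeB (fin_num_adde_defr (- m (\bigcup_k F k))%E fin) (cvg_cst _) cv.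
  by rewrite (subee fin) => /(_ _ _).
rewrite (_ : (fun n => _) = fun n => ultralim_measure (\big[setU/set0]_(i < n) F i)); last first.
  by apply/funext => n; rewrite finitely.
have lfin A : measurable A -> ultralim_measure A \is a fin_num by move=> mA; rewrite limE.
have mD n : (m (\bigcup_k F k `\` \big[setU/set0]_(i < n) F i) =
    m (\bigcup_k F k) - m (\big[setU/set0]_(i < n) F i))%E.
  rewrite measureD//; last by rewrite ltey_eq fin_num_measure.
  by rewrite setIidr//; exact: subU.
(* Finite additivity survives the limit, and the missing tail has a limit mass between 0 and its
   [m]-mass, which tends to 0. *)
apply: (@squeeze_cvge _ _ _ _ (fun n => (ultralim_measure (\bigcup_k F k) -
    (m (\bigcup_k F k) - m (\big[setU/set0]_(i < n) F i)))%E) _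
    (fun=> ultralim_measure (\bigcup_k F k))).
- apply: nearW => n; apply/andP; split; last first.
    by rewrite [leRHS](split n) leeDl// ultralim_measure_ge0.
  rewrite -mD leeBlDr; last by apply: fin_num_measure; exact: measurableD.
  rewrite [leLHS](split n) leeD2l// ultralim_measure_le//; exact: measurableD.
- have := cvgeB (fin_num_adde_defr (- 0)%E (lfin _ mUF)) (cvg_cst _) mcv.
  by rewrite sube0 => /(_ _ _).
- exact: cvg_cst.
Qed.

HB.instance Definition _ := isMeasure.Build _ _ _ ultralim_measure
  lim0 ultralim_measure_ge0 lim_sigma_additive.

Let lim_fin : fin_num_fun ultralim_measure.
Proof. by move=> A mA; rewrite limE. Qed.

HB.instance Definition _ := Measure_isFinite.Build _ _ _ ultralim_measure lim_fin.

Lemma ultralim_measure_density : exists g : T -> R,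
  [/\ measurable_fun setT g, (forall x, 0 <= g x) &
    forall A, measurable A ->
      (ultralim_measure A = \int[m]_(x in A) (g x)%:E)%E].
Proof.
have dom : (ultralim_measure : {finite_measure set T -> \bar R}) `<< m.
  apply/null_content_dominatesP => A mA mA0.
  by apply/le_anti/andP; split; [rewrite -mA0 ultralim_measure_le|exact: ultralim_measure_ge0].
have [f [f0 ff fi fE]] := radon_nikodym_sigma_finite dom.
have mf : measurable_fun setT f by exact: measurable_int fi.
exists (fine \o f); split.
- exact: measurableT_comp mf.
- by move=> x; rewrite fine_ge0.
- by move=> A mA; rewrite [LHS]fE//; apply: eq_integral => x _; rewrite /= fineK.
Qed.

End ultralimit_measure.

Section Rintegral_labels.
Context d (T : measurableType d) (R : realType) (mu : {measure set T -> \bar R}).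
Context (A : set T) (mA : measurable A) (muA : (mu A < +oo)%E).

Lemma Rintegral_sum (I : Type) (s : seq I) (f : I -> T -> R) :
  (forall i, mu.-integrable A (EFin \o f i)) ->
  \int[mu]_(x in A) (\sum_(i <- s) f i x) = \sum_(i <- s) \int[mu]_(x in A) f i x /\
  mu.-integrable A (EFin \o (fun x => \sum_(i <- s) f i x)).
Proof.
move=> fi; elim: s => [|i s [IH1 IH2]].
  rewrite big_nil; have -> : (fun x => \sum_(i <- [::]) f i x) = cst 0.
    by apply/funext => x; rewrite big_nil.
  split; last exact: integrable0.
  by rewrite Rintegral_cst// mul0r.
have -> : (fun x => \sum_(j <- i :: s) f j x) = (fun x => f i x + \sum_(j <- s) f j x).
  by apply/funext => x; rewrite big_cons.
split; first by rewrite RintegralD// IH1 big_cons.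
have := integrableD mA (fi i) IH2.
by apply: eq_integrable => // x _; rewrite /= EFinD.
Qed.

(** A finite measurable labelling replaces an integral by a sum that depends on the measure only
    through the masses of the labels. It serves both for the maps of the sequence and for the limit
    law. *)
Lemma Rintegral_label_approx (I : finType) (L : T -> I) (F : I -> R) (f : T -> R) (e : R) :
  (forall i, measurable (A `&` L @^-1` [set i])) ->
  mu.-integrable A (EFin \o f) ->
  (forall x, A x -> `|f x - F (L x)| <= e) ->
  `|\int[mu]_(x in A) f x - \sum_i F i * fine (mu (A `&` L @^-1` [set i]))|
    <= e * fine (mu A).
Proof.
move=> mL fi fe; pose B i := A `&` L @^-1` [set i].
pose g i x := F i * \1_(B i) x.
have gi i : mu.-integrable A (EFin \o g i).
  apply: (bounded_integrable (M := `|F i|)) => //.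
    apply: measurable_funM; first exact: measurable_cst.
    by apply: measurable_funTS; apply: measurable_indic; exact: mL.
  move=> x _; rewrite normrM indicE; case: (_ \in _); rewrite ?normr1 ?mulr1//.
  by rewrite normr0 mulr0.
have [sumE sumi] := Rintegral_sum (index_enum I) gi.
have gE x : A x -> F (L x) = \sum_i g i x.
  move=> Ax; rewrite (bigD1 (L x))//= {1}/g indicE mem_set ?mulr1; last by split.
  rewrite big1 ?addr0// => i iL; rewrite /g indicE memNset ?mulr0// => -[_ /= Li].
  by rewrite Li eqxx in iL.
rewrite (eq_bigr (fun i => \int[mu]_(x in A) g i x)); last first.
  move=> i _; rewrite /g RintegralZl//; last first.
    apply: (bounded_integrable (M := 1)) => //.
      by apply: measurable_funTS; apply: measurable_indic; exact: mL.
    by move=> x _; rewrite indicE; case: (_ \in _); rewrite ?normr1 ?normr0.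
  congr (_ * _); rewrite /Rintegral integral_indic//; last exact: mL.
  by rewrite /B setIAC setIid.
rewrite -sumE -RintegralB//.
have e0 x : A x -> 0 <= e by move=> Ax; apply: le_trans (fe x Ax).
apply: le_trans (le_normr_Rintegral _ _) _ => //.
  have := integrableB mA fi sumi.
  by apply: eq_integrable => // x _; rewrite /= EFinB.
rewrite -Rintegral_cst//; apply: le_Rintegral => //.
- have := integrableB mA fi sumi => /integrable_abse.
  by apply: eq_integrable => // x _; rewrite /= -EFinB.
- apply: (bounded_integrable (M := `|e|)) => //.
- by move=> x Ax; rewrite /= -gE// fe.
Qed.

End Rintegral_labels.

(** * Densities of the limit masses of cells *)

Section limit_mass.
Context (R : realType) (p q : nat) (Omega : set 'rV[R]_p) (D : set 'rV[R]_q).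
Context (mO : measurable Omega) (O_fin : (lebesgue_rV R p Omega < +oo)%E).
Context (cD : compact D) (D0 : D !=set0).
Context (G : set_system nat) (UG : UltraFilter G).
Context (mu_ : nat -> 'rV[R]_p -> probability 'rV[R]_q R).
Hypotheses (muD : forall n x, Omega x -> prob_on D (mu_ n x))
  (mk : forall n C, measurable C -> measurable_fun Omega (fun x => mu_ n x C)).

Local Notation J n := (joint_measure mO O_fin (mk n)).

Definition cell (w : seq bool) : set 'rV[R]_q := [set y | word (size w) y = w].

Lemma measurable_cell w : measurable (cell w).
Proof. exact: measurable_word. Qed.

Lemma cell_split w : cell w = cell (false :: w) `|` cell (true :: w).
Proof.
rewrite /cell; apply/seteqP; split=> y /=.
  by move=> ->; case: (bit _ y); [right|left].
by move=> [] [].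
Qed.

Let slice_set_measurable w : measurable (setT `*` cell w : set ('rV[R]_p * 'rV[R]_q)).
Proof. by apply: measurableX => //; exact: measurable_cell. Qed.

(** For a fixed cell, its mass above a set of [xi] is a measure in that set, dominated by Lebesgue
    measure on [Omega]: this is the form in which the ultralimit applies. *)
Let slice w n : {measure set 'rV[R]_p -> \bar R} :=
  measure_function_pushforward__canonical__measure_function_Measure
    (mrestr (J n) (slice_set_measurable w)) measurable_fst.

Let sliceE w n A : slice w n A = J n (A `*` cell w).
Proof.
rewrite /slice /= /pushforward /mrestr; congr (J n _).
by apply/seteqP; split=> -[x y] /= => [[Ax [_ wy]]|[Ax wy]].
Qed.

Local Notation m := (mfrestr mO O_fin).

Let slice_le w n A : measurable A -> (slice w n A <= m A)%E.
Proof.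
move=> mA; rewrite sliceE joint_measureX//; last exact: measurable_cell.
rewrite /mfrestr /mrestr setIC -[leRHS]mul1e -integral_cst; last exact: measurableI.
apply: ge0_le_integral => //; first exact: measurableI.
- by apply: measurable_funS (mk n (measurable_cell w)) => // x [].
- by move=> x _; apply: probability_le1; exact: measurable_cell.
Qed.

Let Lam w := ultralim_measure G (slice w).

Let Lam_cvg w A : measurable A -> fine (slice w n A) @[n --> G] --> fine (Lam w A).
Proof. exact: (ultralim_measure_cvg UG (slice_le w)). Qed.

Let Lam_fin w A : measurable A -> Lam w A \is a fin_num.
Proof. by move=> mA; rewrite /Lam /ultralim_measure asboolT. Qed.

Let Lam_unique w A l : measurable A -> fine (slice w n A) @[n --> G] --> l -> Lam w A = l%:E.
Proof.
by move=> mA h; rewrite /Lam /ultralim_measure asboolT//; congr (_%:E); exact: cvg_lim h.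
Qed.

Let mass_exists w : exists g : 'rV[R]_p -> R,
  [/\ measurable_fun setT g, (forall x, 0 <= g x) &
    forall A, measurable A -> (Lam w A = \int[m]_(x in A) (g x)%:E)%E].
Proof. exact: (ultralim_measure_density UG (slice_le w)). Qed.

Let g w := sval (cid (mass_exists w)).

Let mg w : measurable_fun setT (g w).
Proof. by have [] := svalP (cid (mass_exists w)). Qed.

Let g0 w x : 0 <= g w x.
Proof. by have [_ h _] := svalP (cid (mass_exists w)); exact: h. Qed.

Let gE w A : measurable A -> (Lam w A = \int[m]_(x in A) (g w x)%:E)%E.
Proof. by have [_ _ h] := svalP (cid (mass_exists w)); exact: h. Qed.

Let gi w : m.-integrable setT (EFin \o g w).
Proof.
apply/integrableP; split; first exact/measurable_EFinP.
rewrite (eq_integral (fun x => (g w x)%:E)).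
  by rewrite -gE// -ge0_fin_numE ?Lam_fin// gE//; apply: integral_ge0 => x _; rewrite lee_fin.
by move=> x _; rewrite /= ger0_norm.
Qed.

(** This identity and the next two hold for each [n] after integration over any measurable set, pass
    to the limit in that form, and determine the densities almost everywhere. *)
Let mass_root : {ae m, forall x, g [::] x = 1}.
Proof.
have : ae_eq m setT (EFin \o g [::]) (cst 1%E).
  apply: integral_ae_eq => //.
  move=> E _ mE; rewrite -gE// integral_cst// mul1e.
  have mEf : m E \is a fin_num by exact: (fin_num_measure m).
  transitivity (fine (m E))%:E; last exact: fineK mEf.
  apply: Lam_unique => //.
  rewrite (_ : (fun n => _) = cst (fine (m E))); first exact: cvg_cst.
  apply/funext => n; rewrite sliceE joint_measureX//; last exact: measurable_cell.
  rewrite (eq_integral (cst 1%E)).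
    by rewrite integral_cst ?mul1e /mfrestr /mrestr ?(setIC E)//; exact: measurableI.
  move=> x _; rewrite -(probability_setT (mu_ n x)); congr (mu_ n x _).
  by apply/seteqP; split.
by apply: filterS => x /(_ I) [].
Qed.

Let mass_split w : {ae m, forall x, g w x = g (false :: w) x + g (true :: w) x}.
Proof.
have : ae_eq m setT (EFin \o g w)
    (fun x => (g (false :: w) x)%:E + (g (true :: w) x)%:E)%E.
  apply: integral_ae_eq => //.
    by apply/measurable_EFinP; exact: measurable_funD.
  move=> E _ mE; rewrite -gE// ge0_integralD//; last 4 first.
  - by move=> x _; rewrite lee_fin.
  - by apply/measurable_EFinP; exact: measurable_funTS.
  - by move=> x _; rewrite lee_fin.
  - by apply/measurable_EFinP; exact: measurable_funTS.
  rewrite -!gE// -(fineK (Lam_fin (false :: w) mE)) -(fineK (Lam_fin (true :: w) mE)).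
  rewrite -EFinD; apply: Lam_unique => //.
  rewrite (_ : (fun n => _) = fun n => fine (slice (false :: w) n E) +
    fine (slice (true :: w) n E)); first by apply: cvgD; exact: Lam_cvg.
  apply/funext => n; rewrite !sliceE -fineD; last 2 first.
  - by apply: fin_num_measure; apply: measurableX => //; exact: measurable_cell.
  - by apply: fin_num_measure; apply: measurableX => //; exact: measurable_cell.
  rewrite -measureU//; last 3 first.
  - by apply: measurableX => //; exact: measurable_cell.
  - by apply: measurableX => //; exact: measurable_cell.
  - by apply/seteqP; split=> // -[x y] /= [[_ [b1 _]] [_ [b2 _]]]; rewrite b1 in b2.
  congr (fine (J n _)); rewrite cell_split.
  by apply/seteqP; split=> -[x y] /= => [[Ex [wy|wy]]|[[Ex wy]|[Ex wy]]];
    [left|right|split=> //; left|split=> //; right].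
by apply: filterS => x /(_ I) [].
Qed.

Let mass_empty w : (forall y, D y -> word (size w) y <> w) -> {ae m, forall x, g w x = 0}.
Proof.
move=> wD.
have : ae_eq m setT (EFin \o g w) (cst 0%E).
  apply: integral_ae_eq => //.
  move=> E _ mE; rewrite -gE// integral0.
  apply: Lam_unique => //.
  rewrite (_ : (fun n => _) = cst 0); first exact: cvg_cst.
  apply/funext => n; rewrite sliceE joint_measureX//; last exact: measurable_cell.
  rewrite integral0_eq// => x [Ox _].
  have mD : measurable D by exact: compact_measurable_mx.
  apply: (@subset_measure0 _ _ _ (mu_ n x) _ (~` D)) => //.
  - exact: measurable_cell.
  - exact: measurableC.
  - by move=> y wy Dy; exact: wD wy.
  - transitivity (1 - mu_ n x D)%E; first exact: probability_setC.
    by rewrite muD// subee.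
by apply: filterS => x /(_ I) [].
Qed.

(** Each identity of a tree holds off a null set depending on the word; words being countable, one
    null set serves all. On it the tree is replaced by [dflt], that of the Dirac mass at a point of
    [D], so that [M x] is a tree for every [x]. *)
Lemma limit_mass : exists M : 'rV[R]_p -> seq bool -> R,
  [/\ (forall x, tree_mass D (M x)),
    (forall w, measurable_fun setT (fun x => M x w)) &
    forall w A, measurable A -> fine (J n (A `*` cell w)) @[n --> G] -->
      fine (\int[lebesgue_rV R p]_(x in Omega `&` A) (M x w)%:E)].
Proof.
pose good w x := g w x = g (false :: w) x + g (true :: w) x /\
   ((forall y, D y -> word (size w) y <> w) -> g w x = 0).
have : {ae m, forall x, g [::] x = 1 /\ forall w, good w x}.
  have h : {ae m, forall x, forall k w, unpickle k = Some w -> good w x}.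
    apply: ae_foralln => k; case: (unpickle k) => [w|]; last exact: nearW.
    have [wD|wD] := pselect (forall y, D y -> word (size w) y <> w).
      by have := mass_empty wD; have := mass_split w; apply: filterS2 => x h1 h2 w' [<-].
    by have := mass_split w; apply: filterS => x h1 w' [<-].
  move: mass_root h; apply: filterS2 => x h1 h2; split=> // w.
  by apply: (h2 (pickle w)); rewrite pickleK.
move=> [N [mN N0 subN]].
have [y0 Dy0] := D0.
pose dflt w : R := (word (size w) y0 == w)%:R.
pose M x w := if x \in N then dflt w else g w x.
have goodM x : x \notin N -> g [::] x = 1 /\ forall w, good w x.
  move=> xN; apply: contrapT => h; move: xN; apply/negP/negPn.
  by rewrite inE; exact: subN.
have mM w : measurable_fun setT (fun x => M x w).
  apply: measurable_fun_ifT; [|exact: measurable_cst|exact: mg].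
  apply: (measurable_fun_bool true); rewrite setTI (_ : _ @^-1` _ = N)//.
  by apply/seteqP; split=> x /= => [/set_mem|/mem_set].
have M0 x w : 0 <= M x w by rewrite /M; case: ifP => // _; exact: g0.
exists M; split=> //.
  move=> x; have [xN|xN] := boolP (x \in N); last first.
    have [g1 gx] := goodM x xN.
    have -> : M x = g ^~ x by apply/funext => w; rewrite /M (negbTE xN).
    by split=> // w; [have [] := gx w|have [_] := gx w; exact].
  have -> : M x = dflt by apply/funext => w; rewrite /M xN.
  split=> [||w|w]; rewrite /dflt ?eqxx//=.
    rewrite !eqseq_cons; case: (word _ _ == w); rewrite ?andbT ?andbF/= ?addr0//.
    by case: (bit _ _) => /=; rewrite ?addr0 ?add0r.
  by move=> /(_ y0 Dy0)/eqP/negbTE->.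
move=> w A mA; have := @Lam_cvg w A mA.
under eq_fun do rewrite sliceE.
rewrite gE// (_ : (\int[m]_(x in A) (g w x)%:E)%E = (\int[m]_(x in A) (M x w)%:E)%E).
  rewrite ge0_integral_mfrestr//.
  - by apply/measurable_EFinP; exact: mM.
  - by move=> x; rewrite lee_fin; exact: M0.
apply: ae_eq_integral => //.
- by apply/measurable_EFinP; exact: measurable_funTS.
- by apply/measurable_EFinP; exact: measurable_funTS.
exists N; split=> // x /= h; apply: contrapT => xN; apply: h => _.
by rewrite /M memNset.
Qed.

End limit_mass.

Lemma word_cell_point_word (R : realType) (n : nat) (D : set 'rV[R]_n) (D0 : D !=set0) N x :
  D x -> word N (cell_point D0 (word N x)) = word N x.
Proof.
move=> Dx; have := @word_cell_point _ _ _ D0 (word N x); rewrite size_word.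
by apply; exists x; rewrite ?size_word.
Qed.

(** * Compactness of the maps along an ultrafilter *)

Section pmap_compactness.
Context (R : realType) (p q : nat) (Omega : set 'rV[R]_p) (D : set 'rV[R]_q).
Context (cO : compact Omega) (O_fin : (lebesgue_rV R p Omega < +oo)%E).
Context (O0 : Omega !=set0) (cD : compact D) (D0 : D !=set0).
Let mO : measurable Omega := compact_measurable_mx cO.
Let mD : measurable D := compact_measurable_mx cD.
Local Notation K := (Omega `*` D).

Section joint_measure_of_L2_map.
Context (mu : 'rV[R]_p -> probability 'rV[R]_q R).
Hypothesis hmu : L2_map Omega D mu.
Local Notation J :=
  (joint_measure mO O_fin (measurable_mass_L2_map mO hmu)).

Lemma integral_pmap_joint (f : 'rV[R]_p * 'rV[R]_q -> R) :
  {within K, continuous f} ->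
  integral_pmap Omega D mu f = \int[J]_(z in K) f z.
Proof.
move=> fc; have [B fB] := within_continuous_bounded cO cD fc.
apply: Rintegral_joint_measure => //; last exact: fB.
exact: measurable_within_continuous.
Qed.

Lemma joint_measure_setIK (A : set 'rV[R]_p) (C : set 'rV[R]_q) :
  measurable A -> measurable C -> J ((Omega `&` A) `*` (D `&` C)) = J (A `*` C).
Proof.
move=> mA mC; rewrite !joint_measureX//; [|exact: measurableI|exact: measurableI].
rewrite setIA setIid; apply: eq_integral => x; rewrite inE => -[Ox _].
have muxD : mu x D = 1%E by have [+ _] := hmu; apply.
rewrite [RHS](measureDI (mu x) mC mD) setIC.
rewrite [X in (X + _)%E](_ : _ = 0%E) ?add0e//.
apply: (@subset_measure0 _ _ _ (mu x) _ (~` D)) => //.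
- exact: measurableD.
- exact: measurableC.
- transitivity (1 - mu x D)%E; first exact: probability_setC.
  by rewrite muxD subee.
Qed.

End joint_measure_of_L2_map.

Definition word_tuple n N (x : 'rV[R]_n) : N.-tuple bool :=
  Tuple (introT eqP (size_word N x)).

Definition path_tuple N (m : seq bool -> R) (t : R) : N.-tuple bool :=
  Tuple (introT eqP (size_path_of m t N)).

(** The error bound does not depend on [mu], hence is uniform along the sequence, and the sum
    involves only the masses whose convergence [limit_mass] provides. *)
Lemma integral_pmap_step (mu : 'rV[R]_p -> probability 'rV[R]_q R)
    (hmu : L2_map Omega D mu) (f : 'rV[R]_p * 'rV[R]_q -> R) (e : R) N :
  {within K, continuous f} ->
  (forall z z', K z -> K z' -> word N z.1 = word N z'.1 ->
    word N z.2 = word N z'.2 -> `|f z - f z'| <= e) ->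
  `|integral_pmap Omega D mu f - \sum_(vw : N.-tuple bool * N.-tuple bool)
     f (cell_point O0 vw.1, cell_point D0 vw.2) *
     fine (joint_measure mO O_fin (measurable_mass_L2_map mO hmu)
       (cell vw.1 `*` cell vw.2))| <= e * fine (lebesgue_rV R p Omega).
Proof.
move=> fc He; rewrite (integral_pmap_joint hmu fc).
set J := joint_measure _ _ _.
have mK : measurable K by exact: measurableX.
pose L (z : 'rV[R]_p * 'rV[R]_q) := (word_tuple N z.1, word_tuple N z.2).
have LE i : K `&` L @^-1` [set i] = (Omega `&` cell i.1) `*` (D `&` cell i.2).
  case: i => v w; apply/seteqP; split=> -[x y] /=.
    by move=> [[Ox Dy] [<- <-]] /=; rewrite /cell/= !size_word.
  move=> [[Ox /= xv] [Dy /= yw]]; split=> //; congr (_, _); apply/val_inj => /=.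
    by rewrite -[RHS]xv size_tuple.
  by rewrite -[RHS]yw size_tuple.
have JK : J K = lebesgue_rV R p Omega.
  have := joint_measure_setIK hmu measurableT measurableT.
  by rewrite !setIT setXTT -/J => ->; exact: joint_measureT.
have Jfin : (J K < +oo)%E by rewrite JK.
have [B fB] := within_continuous_bounded cO cD fc.
have fi : J.-integrable K (EFin \o f).
  by apply: (bounded_integrable (M := B)) => //; exact: measurable_within_continuous.
have mL i : measurable (K `&` L @^-1` [set i]).
  by rewrite LE; apply: measurableX; apply: measurableI => //; exact: measurable_cell.
have fe z : K z -> `|f z - f (cell_point O0 (L z).1, cell_point D0 (L z).2)| <= e.
  case: z => x y [Ox Dy] /=; apply: He => //=.
  - by split; exact: cell_pointD.
  - by rewrite word_cell_point_word.
  - by rewrite word_cell_point_word.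
have := @Rintegral_label_approx _ _ _ J K mK Jfin _ L
  (fun vw => f (cell_point O0 vw.1, cell_point D0 vw.2)) f e mL fi fe.
rewrite [X in _ <= _ * fine X -> _]JK; congr (`|_ - _| <= _).
apply: eq_bigr => i _; congr (_ * fine _); rewrite LE.
by apply: joint_measure_setIK; exact: measurable_cell.
Qed.

Section quantile_law_step.
Context (M : 'rV[R]_p -> seq bool -> R).
Hypotheses (hm : forall x, tree_mass D (M x))
  (mm : forall w, measurable_fun setT (fun x => M x w)).
Local Notation law := (quantile_law cD D0 hm mm).
Local Notation Rm := (measurableTypeR R).

Let mk : forall C, measurable C ->
  measurable_fun Omega (fun _ : 'rV[R]_p => unif01 R C).
Proof. by move=> C mC; exact: measurable_cst. Qed.

Local Notation J := (joint_measure mO O_fin mk).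

(** Writing the integral over pairs [(x, t)] allows labelling by the path of [t], whose masses are
    known exactly. *)
Lemma integral_pmap_quantile_law (f : 'rV[R]_p * 'rV[R]_q -> R) :
  {within K, continuous f} ->
  measurable_fun (Omega `*` setT)
    (fun z : 'rV[R]_p * Rm => f (z.1, quantile D0 (M z.1) z.2)) /\
  integral_pmap Omega D law f =
  \int[J]_(z in Omega `*` setT) f (z.1, quantile D0 (M z.1) z.2).
Proof.
move=> fc; have [B fB] := within_continuous_bounded cO cD fc.
have mK : measurable K by exact: measurableX.
have mf : measurable_fun setT (f \_ K).
  by apply/(measurable_restrictT _ _).1 => //; exact: measurable_within_continuous.
have mq : measurable_fun setT
    (fun z : 'rV[R]_p * Rm => (z.1, quantile D0 (M z.1) z.2)).
  by apply: measurable_fun_pair => //; exact: measurable_quantile.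
have mfq : measurable_fun (Omega `*` setT)
    (fun z : 'rV[R]_p * Rm => f (z.1, quantile D0 (M z.1) z.2)).
  apply: (eq_measurable_fun ((f \_ K) \o
      (fun z : 'rV[R]_p * Rm => (z.1, quantile D0 (M z.1) z.2)))).
    move=> [x t]; rewrite inE => -[Ox _] /=.
    by rewrite patchE mem_set//; split=> //=; exact: quantileD.
  by apply: measurable_funTS; exact: measurableT_comp mf mq.
split=> //.
rewrite -(Rintegral_joint_measure mO O_fin mk (f := fun z =>
    f (z.1, quantile D0 (M z.1) z.2)) (M := B)) //; last first.
  by move=> [x t] [Ox _]; apply: fB; split=> //=; exact: quantileD.
apply: eq_Rintegral => x; rewrite inE => Ox.
rewrite Rintegral_mkcond /Rintegral; congr fine.
have mfx : measurable_fun setT ((fun y => f (x, y)) \_ D).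
  apply: (eq_measurable_fun (fun y => (f \_ K) (x, y))).
    move=> y _; rewrite !patchE; congr (if _ then _ else _).
    by apply/idP/idP; rewrite !inE//= => -[].
  exact: measurable_fun_pair2.
have ifq : (unif01 R).-integrable setT
    (EFin \o (((fun y => f (x, y)) \_ D) \o quantile D0 (M x))).
  apply: (bounded_integrable (M := B)) => //.
  - by rewrite [X in (X < _)%E](probability_setT (unif01 R)) ltry.
  - by apply: measurableT_comp mfx _; exact: (measurable_quantile2 cD D0 hm mm).
  - move=> t _; rewrite /= patchE mem_set; last exact: quantileD.
    by apply: fB; split=> //=; exact: quantileD.
rewrite (integral_distribution _ ifq); last exact/measurable_EFinP.
by apply: eq_integral => t _ /=; rewrite patchE mem_set//; exact: quantileD.
Qed.

(** The second label is the path of [t] rather than the word of the quantile, which may have left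
    its cell. The error is estimated at the cell points of longer paths, whose words extend the
    label, and passes to the quantile by continuity of [f]. *)
Lemma integral_pmap_law_step (f : 'rV[R]_p * 'rV[R]_q -> R) (e : R) N :
  {within K, continuous f} ->
  (forall z z', K z -> K z' -> word N z.1 = word N z'.1 ->
    word N z.2 = word N z'.2 -> `|f z - f z'| <= e) ->
  `|integral_pmap Omega D law f - \sum_(vw : N.-tuple bool * N.-tuple bool)
     f (cell_point O0 vw.1, cell_point D0 vw.2) *
     fine (\int[lebesgue_rV R p]_(x in Omega `&` cell vw.1) (M x vw.2)%:E)|
     <= e * fine (lebesgue_rV R p Omega).
Proof.
move=> fc He; have [mfq ->] := integral_pmap_quantile_law fc.
have mA : measurable (Omega `*` setT : set ('rV[R]_p * Rm)) by exact: measurableX.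
pose L (z : 'rV[R]_p * Rm) := (word_tuple N z.1, path_tuple N (M z.1) (clip01 z.2)).
have LE i : (Omega `*` setT) `&` L @^-1` [set i] =
    ((Omega `&` cell i.1) `*` setT) `&`
    [set z | path_of (M z.1) (clip01 z.2) N = i.2].
  case: i => v w; apply/seteqP; split=> -[x t] /=.
    by move=> [[Ox _] [<- <-]] /=; rewrite /cell/= size_word.
  move=> [[[Ox /= xv] _] tw]; split=> //; congr (_, _); apply/val_inj => //=.
  by rewrite -[RHS]xv size_tuple.
have mL i : measurable ((Omega `*` setT) `&` L @^-1` [set i]).
  rewrite LE; apply: measurableI; last exact: measurable_path_of.
  by apply: measurableX => //; apply: measurableI => //; exact: measurable_cell.
have JA : J (Omega `*` setT) = lebesgue_rV R p Omega.
  rewrite joint_measureX// setIid (eq_integral (cst 1%E)).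
    by rewrite integral_cst// mul1e.
  by move=> x _; exact: probability_setT.
have Jfin : (J (Omega `*` setT) < +oo)%E by rewrite JA.
have [B fB] := within_continuous_bounded cO cD fc.
have fi : J.-integrable (Omega `*` setT)
    (EFin \o (fun z => f (z.1, quantile D0 (M z.1) z.2))).
  apply: (bounded_integrable (M := B)) => // -[x t] [Ox _].
  by apply: fB; split=> //=; exact: quantileD.
have fe z : (Omega `*` setT) z -> `|f (z.1, quantile D0 (M z.1) z.2) -
    f (cell_point O0 (L z).1, cell_point D0 (L z).2)| <= e.
  case: z => x t [Ox _] /=.
  pose u k := cell_point D0 (path_of (M x) (clip01 t) k).
  have ucvg : f (x, u k) @[k --> \oo] --> f (x, quantile D0 (M x) t).
    have /subspace_continuousP := fc.
    move=> /(_ (x, quantile D0 (M x) t)) fcx.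
    apply: (cvg_trans _ (fcx _)); last by split=> //=; exact: quantileD.
    apply: (@cvg_comp _ _ _ (fun k => (x, u k)) f _ (within K (nbhs (x, quantile D0 (M x) t)))) => //.
    move=> S [[U V] /= [Ux Vq] UV].
    have ucv : u k @[k --> \oo] --> quantile D0 (M x) t by exact: quantile_cvg.
    have [k _ kS] := ucv V Vq.
    exists k => // j kj; apply: (UV (x, u j)).
      by split; [exact: nbhs_singleton|exact: kS].
    by split=> //=; exact: cell_pointD.
  pose c := f (cell_point O0 (word N x), u N).
  have ncvg : `|f (x, u k) - c| @[k --> \oo] --> `|f (x, quantile D0 (M x) t) - c|.
    by apply: cvg_norm; apply: cvgB => //; exact: cvg_cst.
  rewrite -(cvg_lim _ ncvg)//; apply: limr_le; first by apply/cvg_ex; eexists; exact: ncvg.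
  exists N => // k /= Nk; apply: He => /=.
  - by split=> //=; exact: cell_pointD.
  - by split; exact: cell_pointD.
  - by rewrite word_cell_point_word.
  - by rewrite !(word_path_of D0 (hm x)).
have := @Rintegral_label_approx _ _ _ J _ mA Jfin _ L
  (fun vw => f (cell_point O0 vw.1, cell_point D0 vw.2)) _ e mL fi fe.
rewrite [X in _ <= _ * fine X -> _]JA; congr (`|_ - _| <= _).
apply: eq_bigr => -[v w] _ /=; congr (_ * fine _); rewrite LE /= /joint_measure.
rewrite integral_mkcondr; apply: eq_integral => x; rewrite inE => Ox.
rewrite patchE /zero_ext_kernel mem_set//.
rewrite xsectionE -(unif01_path_of hm mm x w) size_tuple; case: ifPn => [/set_mem xv|xv].
  by congr (unif01 R _); apply/seteqP; split=> t //= -[].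
rewrite (_ : _ @^-1` _ = set0) ?measure0//.
by apply/seteqP; split=> // t /= [[[_ /mem_set h] _] _]; rewrite h in xv.
Qed.

End quantile_law_step.

Context (G : set_system nat) (UG : UltraFilter G).
Context (mu_ : nat -> 'rV[R]_p -> probability 'rV[R]_q R).
Hypothesis hmu : forall n, L2_map Omega D (mu_ n).

Theorem pmap_ultracompact : exists mu, L2_map Omega D mu /\
  forall f, {within K, continuous f} ->
    integral_pmap Omega D (mu_ n) f @[n --> G] --> integral_pmap Omega D mu f.
Proof.
have muD n x : Omega x -> prob_on D (mu_ n x) by have [+ _] := hmu n; apply.
have [M [hm mm Mcvg]] := limit_mass mO O_fin cD D0 UG muD
  (fun n => measurable_mass_L2_map mO (hmu n)).
exists (quantile_law cD D0 hm mm); split.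
  split; first by move=> x _; exact: quantile_law_prob_on.
  move=> U UU; apply: measurableI => //.
  exact: measurable_W2_open_quantile_law.
move=> f fc; apply/cvgrPdist_le => e e0.
pose l := fine (lebesgue_rV R p Omega).
have l0 : 0 <= l by exact: fine_ge0.
have l10 : 0 < l + 1 by rewrite ltr_wpDl.
(* Dividing by [l + 1] avoids a case distinction on [l] and still gives [e' * l <= e / 3]. *)
pose e' := e / 3 / (l + 1).
have e'0 : 0 < e' by rewrite !divr_gt0.
have [N HN] := word_oscillation cO cD fc e'0.
have S2 := integral_pmap_law_step hm mm fc HN.
set s := \sum_(_ | _) _ in S2.
have scvg : \sum_(vw : N.-tuple bool * N.-tuple bool)
     f (cell_point O0 vw.1, cell_point D0 vw.2) *
     fine (joint_measure mO O_fin (measurable_mass_L2_map mO (hmu n))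
       (cell vw.1 `*` cell vw.2)) @[n --> G] --> s.
  apply: cvg_big => [|vw _]; first exact: add_continuous.
  by apply: cvgM; [exact: cvg_cst|apply: Mcvg; exact: measurable_cell].
have e30 : 0 < e / 3 by rewrite divr_gt0.
move/cvgrPdist_le : scvg => /(_ _ e30); apply: filterS => n Hn.
have S1 := integral_pmap_step (hmu n) fc HN.
have e'l : e' * l <= e / 3.
  rewrite /e' -mulrA ler_piMr ?(ltW e30)//.
  by rewrite mulrC ler_pdivrMr// mul1r lerDl.
rewrite -/l in S1 S2.
set sn := \sum_(_ | _) _ in S1 Hn.
have -> : integral_pmap Omega D (quantile_law cD D0 hm mm) f - integral_pmap Omega D (mu_ n) f =
  (integral_pmap Omega D (quantile_law cD D0 hm mm) f - s) + (s - sn) -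
  (integral_pmap Omega D (mu_ n) f - sn) by ring.
apply: le_trans (ler_normB _ _) _; apply: le_trans (lerD (ler_normD _ _) (lexx _)) _.
by rewrite (_ : e = e / 3 + e / 3 + e / 3); [lra|field].
Qed.

End pmap_compactness.

(** * Square-integrable densities *)

Section L2_limit.
Context (R : realType).

Lemma geometric_sqr_cvg (u : nat -> R) (H : R) :
  (forall k, 4 ^+ k * (u k.+1 - u k) ^+ 2 <= H) ->
  cvg (u k @[k --> \oo]) /\
  forall k, (lim (u n @[n --> \oo]) - u k) ^+ 2 <= 4 * H / 4 ^+ k.
Proof.
move=> uH.
have H0 : 0 <= H.
  by apply: le_trans (uH 0%N); apply: mulr_ge0; [rewrite expr0|exact: sqr_ge0].
pose s := Num.sqrt H; have s0 : 0 <= s by exact: sqrtr_ge0.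
have sE : s ^+ 2 = H by rewrite sqr_sqrtr.
have p0 k : 0 < (2 : R) ^+ k by rewrite exprn_gt0.
have step k : `|u k.+1 - u k| <= s / 2 ^+ k.
  rewrite ler_pdivlMr// -(ler_pXn2r (n := 2))// ?nnegrE ?mulr_ge0// ?(ltW (p0 k))//.
  rewrite exprMn real_normK ?num_real// sE -exprM mulnC exprM mulrC.
  by rewrite (_ : 2 ^+ 2 = 4); [exact: uH|ring].
(* The subtracted term is the remaining geometric tail; keeping it lets the induction close. *)
have far k n : `|u (n + k)%N - u k| <= 2 * s / 2 ^+ k - 2 * s / 2 ^+ (n + k).
  elim: n => [|n IHn]; first by rewrite add0n !subrr normr0.
  rewrite (_ : u (n.+1 + k)%N - u k = (u (n + k).+1 - u (n + k)%N) + (u (n + k)%N - u k));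
    last by rewrite addSn; ring.
  apply: le_trans (ler_normD _ _) _; apply: le_trans (lerD (step _) IHn) _.
  rewrite addSn exprS; set z := 2 ^+ (n + k).
  have z0 : z != 0 by rewrite gt_eqF//; exact: p0.
  by rewrite (_ : 2 * s / (2 * z) = s / z); [lra|field].
have far' k n : (k <= n)%N -> `|u n - u k| <= 2 * s / 2 ^+ k.
  move=> /subnK <-; apply: le_trans (far _ _) _.
  by rewrite gerBl divr_ge0// ?mulr_ge0// ltW.
have ucvg : cvg (u k @[k --> \oo]).
  apply: cauchy_cvg; apply: cauchy_exP => e e0.
  have : (fun k => 2 * s * (2^-1) ^+ k) k @[k --> \oo] --> (2 * s * 0 : R).
    apply: cvgM; first exact: cvg_cst.
    by apply: cvg_expr; rewrite ger0_norm ?invr_ge0// invf_lt1// ltr1n.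
  rewrite mulr0 => /cvgrPdist_lt /(_ _ e0) [k _ kE].
  exists (u k); exists k => // n /= kn; rewrite /ball/= distrC.
  apply: le_lt_trans (far' _ _ kn) _.
  have := kE k (leqnn k); rewrite sub0r normrN ger0_norm ?exprVn//.
  by rewrite divr_ge0// ?mulr_ge0// ltW.
split=> // k.
have ncvg : `|u n - u k| @[n --> \oo] --> `|lim (u n @[n --> \oo]) - u k|.
  by apply: cvg_norm; apply: cvgB => //; exact: cvg_cst.
have le : `|lim (u n @[n --> \oo]) - u k| <= 2 * s / 2 ^+ k.
  rewrite -(cvg_lim _ ncvg)//; apply: limr_le; first by apply/cvg_ex; eexists; exact: ncvg.
  by exists k => // n /= kn; exact: far'.
rewrite -real_normK ?num_real//.
apply: le_trans (_ : (2 * s / 2 ^+ k) ^+ 2 <= _).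
  by apply: lerXn2r => //; rewrite nnegrE// divr_ge0// ?mulr_ge0// ltW.
rewrite exprMn exprMn sE exprVn -exprM mulnC exprM.
by rewrite (_ : 2 ^+ 2 = 4 :> R)//; ring.
Qed.

Context d (T : measurableType d) (mu : {measure set T -> \bar R}).
Context (A : set T) (mA : measurable A).

(* The weights 4 ^ k turn L2-closeness into a pointwise geometric bound by an
   integrable function, which gives the limit everywhere that bound is finite. *)
Lemma L2_fast_limit (u : nat -> T -> R) :
  (forall k, measurable_fun A (u k)) ->
  (forall k, \int[mu]_(x in A) ((u k.+1 x - u k x) ^+ 2)%:E <= ((8 ^+ k)^-1)%:E)%E ->
  exists v : T -> R, measurable_fun A v /\
    forall k, (\int[mu]_(x in A) ((v x - u k x) ^+ 2)%:E <= (8 / 4 ^+ k)%:E)%E.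
Proof.
move=> mu_ uI.
pose g k x := (4 ^+ k * (u k.+1 x - u k x) ^+ 2)%:E.
have g0 k x : (0 <= g k x)%E by rewrite lee_fin mulr_ge0// ?sqr_ge0// exprn_ge0.
have mg k : measurable_fun A (g k).
  apply/measurable_EFinP; apply: measurable_funM; first exact: measurable_cst.
  by apply: measurable_funX; exact: measurable_funB.
pose h x := (\sum_(0 <= k <oo) g k x)%E.
have mh : measurable_fun A h by apply: ge0_emeasurable_sum.
have h0 x : (0 <= h x)%E by apply: nneseries_ge0.
have gh k x : (g k x <= h x)%E.
  apply: (@le_trans _ _ (\sum_(0 <= i < k.+1) g i x)%E); last first.
    by apply: nneseries_lim_ge => i _ _; exact: g0.
  by rewrite big_nat_recr//= leeDr// sume_ge0.
have Ih : (\int[mu]_(x in A) h x <= 2%:E)%E.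
  rewrite integral_nneseries//.
  (* The weight [4 ^+ k] against the rate [8 ^- k] leaves [2 ^- k], whose sum is 2. *)
  apply: (@le_trans _ _ (\sum_(0 <= k <oo) (2 / (2 ^ (k + 0.+1))%:R)%:E)%E); last first.
    have := @cvg_geometric_eseries_half R 2 0; rewrite expr0 divr1 => /cvg_lim <-//.
  apply: lee_nneseries => [k _ _|k _]; first by apply: integral_ge0.
  rewrite /g; under eq_integral do rewrite EFinM.
  rewrite ge0_integralZl ?lee_fin ?exprn_ge0//; last 2 first.
    by apply/measurable_EFinP; apply: measurable_funX; exact: measurable_funB.
    by move=> x _; rewrite lee_fin sqr_ge0.
  apply: le_trans (lee_wpmul2l _ (uI k)) _; first by rewrite lee_fin exprn_ge0.
  rewrite -EFinM lee_fin addn1 natrX exprS.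
  have E : 8 ^+ k = 4 ^+ k * 2 ^+ k :> R by rewrite -exprMn; congr (_ ^+ _); ring.
  rewrite E.
  have n4 : 4 ^+ k != 0 :> R by rewrite expf_neq0.
  have n2 : 2 ^+ k != 0 :> R by rewrite expf_neq0.
  by rewrite invfM mulrA divff// mul1r invfM mulrA divff// mul1r.
(* Truncating to 0 where [h] is infinite makes the limit exist at every point; there the final bound
   is trivial, its right-hand side being infinite. *)
pose u' k x := if (h x < +oo)%E then u k x else 0.
have mu' k : measurable_fun A (u' k).
  apply: measurable_fun_if => //.
  - by apply: measurable_fun_lte => //; exact: measurable_cst.
  - exact: measurable_funS (mu_ k).
have u'cvg x : cvg (u' k x @[k --> \oo]) /\
    (h x < +oo -> forall k, ((lim (u' n x @[n --> \oo]) - u k x) ^+ 2)%:E <= (4 / 4 ^+ k)%:E * h x)%E.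
  have -> : u' ^~ x = if (h x < +oo)%E then u ^~ x else cst 0.
    by apply/funext => k; rewrite /u'; case: ifP.
  case: ifPn => hx; last by split=> //; exact: is_cvg_cst.
  have hE : h x = (fine (h x))%:E by rewrite fineK// ge0_fin_numE.
  have [|c b] := @geometric_sqr_cvg (fun k => u k x) (fine (h x)).
    by move=> k; rewrite -lee_fin -hE; exact: gh.
  split=> // _ k; rewrite hE -EFinM lee_fin; apply: le_trans (b k) _.
  by rewrite mulrAC.
exists (fun x => lim (u' n x @[n --> \oo])); split.
  apply: (measurable_fun_cvg (h := u')) => // x _.
  by have [] := u'cvg x.
move=> k.
apply: (@le_trans _ _ (\int[mu]_(x in A) ((4 / 4 ^+ k)%:E * h x))%E); last first.
  have c0 : (0 <= (4 / 4 ^+ k : R)%:E)%E by rewrite lee_fin divr_ge0// exprn_ge0.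
  rewrite ge0_integralZl//.
  apply: le_trans (lee_wpmul2l _ Ih) _; first by rewrite lee_fin divr_ge0// exprn_ge0.
  by rewrite -EFinM lee_fin [leLHS](_ : _ = 8 / 4 ^+ k)// mulrAC; congr (_ / _); ring.
apply: ge0_le_integral => //.
- by move=> x _; rewrite lee_fin sqr_ge0.
- apply/measurable_EFinP; apply: measurable_funX; apply: measurable_funB => //.
  apply: (measurable_fun_cvg (h := u')) => // x _.
  by have [] := u'cvg x.
- by apply: measurable_funeM.
move=> x _; have [hx|] := ltP (h x) +oo%E; first by have [_] := u'cvg x; apply.
rewrite leye_eq => /eqP ->; rewrite gt0_muley ?leey// lte_fin divr_gt0// exprn_gt0//.
Qed.

End L2_limit.

Section L2_families.
Context d (T : measurableType d) (R : realType) (J : {measure set T -> \bar R}).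
Context (K : set T) (mK : measurable K) (I : finType).

Definition L2_fun (f : T -> R) :=
  measurable_fun K f /\ J.-integrable K (fun x => (f x ^+ 2)%:E).

Lemma L2_fun_mul f g : L2_fun f -> L2_fun g ->
  J.-integrable K (fun x => (f x * g x)%:E).
Proof.
move=> [mf f2] [mg g2].
apply: (le_integrable mK _ _ (integrableD mK f2 g2)).
  by apply/measurable_EFinP; exact: measurable_funM.
move=> x _; rewrite -EFinD !abse_EFin lee_fin [leRHS]ger0_norm; last first.
  by rewrite addr_ge0// sqr_ge0.
rewrite normrM -(real_normK (num_real (f x))) -(real_normK (num_real (g x))).
have := sqr_ge0 (`|f x| - `|g x|); have := sqr_ge0 (`|f x|); have := sqr_ge0 (`|g x|).
rewrite sqrrB mulr2n; nra.
Qed.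

Lemma L2_fun_comb (a : R) f g : L2_fun f -> L2_fun g ->
  L2_fun (fun x => a * f x + g x).
Proof.
move=> Lf Lg; have [mf f2] := Lf; have [mg g2] := Lg; split.
  by apply: measurable_funD => //; apply: measurable_funM => //; exact: measurable_cst.
have fg := L2_fun_mul Lf Lg.
rewrite (_ : (fun x => _) = (fun x => ((a ^+ 2)%:E * (f x ^+ 2)%:E +
    ((a *+ 2)%:E * (f x * g x)%:E + (g x ^+ 2)%:E))%E)).
  apply: integrableD => //; first exact: integrableZl.
  by apply: integrableD => //; exact: integrableZl.
by apply/funext => x; rewrite -!EFinM -!EFinD; congr EFin; rewrite mulr2n; ring.
Qed.

Lemma L2_fun_bounded (f : T -> R) (M : R) : (J K < +oo)%E -> measurable_fun K f ->
  (forall x, K x -> `|f x| <= M) -> L2_fun f.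
Proof.
move=> JK mf fM; split=> //.
apply: (bounded_integrable (M := M ^+ 2)) => //; first exact: measurable_funX.
move=> x Kx; rewrite normrX; apply: lerXn2r; rewrite ?nnegrE//; last exact: fM.
by apply: le_trans (fM _ Kx).
Qed.

Lemma L2_fun_integrable f : (J K < +oo)%E -> L2_fun f -> J.-integrable K (EFin \o f).
Proof.
move=> JK Lf.
have L1 : L2_fun (cst 1).
  by apply: (L2_fun_bounded (M := 1)) => // x _; rewrite normr1.
by apply: eq_integrable (L2_fun_mul Lf L1) => // x _; rewrite /= mulr1.
Qed.

Definition L2_fam (f : I -> T -> R) := forall i, L2_fun (f i).

Definition L2_dot (f g : I -> T -> R) := \sum_i \int[J]_(x in K) (f i x * g i x).

Lemma L2_dotC f g : L2_dot f g = L2_dot g f.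
Proof. by apply: eq_bigr => i _; apply: eq_Rintegral => x _; rewrite mulrC. Qed.

Lemma L2_dot_ge0 f : 0 <= L2_dot f f.
Proof.
apply: sumr_ge0 => i _; apply: Rintegral_ge0 => x _.
by rewrite -expr2 sqr_ge0.
Qed.

Lemma eq_L2_dot f f' g g' : (forall i x, K x -> f i x = f' i x) ->
  (forall i x, K x -> g i x = g' i x) -> L2_dot f g = L2_dot f' g'.
Proof.
move=> ff gg; apply: eq_bigr => i _; apply: eq_Rintegral => x.
by rewrite inE => Kx; rewrite ff// gg.
Qed.

Lemma L2_dot_comb a f g h : L2_fam f -> L2_fam g -> L2_fam h ->
  L2_dot (fun i x => a * f i x + g i x) h = a * L2_dot f h + L2_dot g h.
Proof.
move=> Lf Lg Lh; rewrite /L2_dot mulr_sumr -big_split/=.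
apply: eq_bigr => i _.
have fh := L2_fun_mul (Lf i) (Lh i); have gh := L2_fun_mul (Lg i) (Lh i).
rewrite -RintegralZl// -RintegralD//; last first.
  by apply: eq_integrable (integrableZl mK a fh) => // x _; rewrite -EFinM.
by apply: eq_Rintegral => x _; ring.
Qed.

Lemma L2_dot_comb_sqr a f g : L2_fam f -> L2_fam g ->
  L2_dot (fun i x => a * f i x + g i x) (fun i x => a * f i x + g i x) =
  a ^+ 2 * L2_dot f f + a *+ 2 * L2_dot f g + L2_dot g g.
Proof.
move=> Lf Lg; have Lc : L2_fam (fun i x => a * f i x + g i x).
  by move=> i; exact: L2_fun_comb.
rewrite L2_dot_comb// 2!(L2_dotC _ (fun i x => a * f i x + g i x)) !L2_dot_comb//.
by rewrite (L2_dotC g f) mulr2n; ring.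
Qed.

Lemma L2_fam_complete (u : nat -> I -> T -> R) :
  (forall k, L2_fam (u k)) ->
  (forall k, L2_dot (fun i x => u k.+1 i x - u k i x)
                    (fun i x => u k.+1 i x - u k i x) <= (8 ^+ k)^-1) ->
  exists2 v, L2_fam v & forall k,
    L2_dot (fun i x => v i x - u k i x) (fun i x => v i x - u k i x)
      <= #|I|%:R * (8 / 4 ^+ k).
Proof.
move=> Lu uI.
have LB f g : L2_fun f -> L2_fun g -> L2_fun (fun x => f x - g x).
  move=> Lf Lg; rewrite (_ : (fun x => _) = (fun x => -1 * g x + f x)).
    exact: L2_fun_comb.
  by apply/funext => x; ring.
have uIi i k : (\int[J]_(x in K) ((u k.+1 i x - u k i x) ^+ 2)%:E <= ((8 ^+ k)^-1)%:E)%E.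
  have [_ L2i] := LB _ _ (Lu k.+1 i) (Lu k i).
  rewrite -[leLHS]fineK ?integrable_fin_num// lee_fin.
  apply: le_trans (uI k); rewrite /L2_dot (bigD1 i)//=.
  under eq_Rintegral do rewrite -expr2.
  rewrite lerDl; apply: sumr_ge0 => j _; apply: Rintegral_ge0 => x _.
  by rewrite -expr2 sqr_ge0.
have H i : exists v : T -> R, measurable_fun K v /\
    forall k, (\int[J]_(x in K) ((v x - u k i x) ^+ 2)%:E <= (8 / 4 ^+ k)%:E)%E.
  by apply: L2_fast_limit => // k; have [] := Lu k i.
pose v i := sval (cid (H i)).
have mv i : measurable_fun K (v i) by have [] := svalP (cid (H i)).
have vI i k : (\int[J]_(x in K) ((v i x - u k i x) ^+ 2)%:E <= (8 / 4 ^+ k)%:E)%E.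
  by have [_] := svalP (cid (H i)).
have Lvu i k : L2_fun (fun x => v i x - u k i x).
  split; first by apply: measurable_funB => //; have [] := Lu k i.
  apply/integrableP; split.
    apply/measurable_EFinP; apply: measurable_funX; apply: measurable_funB => //.
    by have [] := Lu k i.
  apply: le_lt_trans (ltry _); apply: le_trans (vI i k).
  rewrite le_eqVlt; apply/orP; left; apply/eqP; apply: eq_integral => x _.
  by rewrite abse_EFin ger0_norm// sqr_ge0.
exists v.
  move=> i; rewrite (_ : v i = fun x => 1 * (v i x - u 0%N i x) + u 0%N i x).
    exact: (L2_fun_comb 1 (Lvu i 0%N) (Lu 0%N i)).
  by apply/funext => x; ring.
move=> k; rewrite /L2_dot -sum1_card natr_sum mulr_suml; apply: ler_sum => i _.
rewrite mul1r -lee_fin; apply: le_trans (vI i k).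
rewrite /Rintegral fineK; last first.
  by apply: integrable_fin_num => //; exact: L2_fun_mul.
rewrite le_eqVlt; apply/orP; left; apply/eqP; apply: eq_integral => x _.
by rewrite expr2.
Qed.

End L2_families.

(** * Representation of a linear form bounded by a quadratic one *)

Section Riesz.
Context d (T : measurableType d) (R : realType) (J : {measure set T -> \bar R}).
Context (K : set T) (mK : measurable K) (I : finType).
Local Notation dot := (L2_dot J K).
Local Notation fam := (@L2_fam _ _ _ J K I).

Let dotr a f g h : fam f -> fam g -> fam h ->
  dot h (fun i x => a * f i x + g i x) = a * dot h f + dot h g.
Proof. by move=> *; rewrite L2_dotC L2_dot_comb// ![dot _ h]L2_dotC. Qed.

Let famc a f g : fam f -> fam g -> fam (fun i x => a * f i x + g i x).
Proof. by move=> Lf Lg i; apply: L2_fun_comb. Qed.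

Context (V : lmodType R) (C : set V) (G : V -> I -> T -> R) (l : V -> R).
Hypotheses (C0 : C !=set0)
  (CD : forall a x y, C x -> C y -> C (a *: x + y))
  (LG : forall x, C x -> fam (G x))
  (GD : forall a x y, C x -> C y ->
    forall i z, K z -> G (a *: x + y) i z = a * G x i z + G y i z)
  (lD : forall a x y, C x -> C y -> l (a *: x + y) = a * l x + l y).

(* v is the L2-limit of the gradients G x along a sequence x minimizing
   |G x|^2 / 2 - l x, whose Cauchy property comes from the parallelogram law. *)
Lemma bounded_quadratic_representation (M : R) :
  (forall x, C x -> l x - 2^-1 * dot (G x) (G x) <= M) ->
  exists2 v, fam v & (forall x, C x -> l x = dot v (G x)) /\ 2^-1 * dot v v <= M.
Proof.
move=> lM; pose F x := 2^-1 * dot (G x) (G x) - l x.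
have FE t x y : C x -> C y -> F (t *: y + x) =
    F x + t * (dot (G x) (G y) - l y) + 2^-1 * t ^+ 2 * dot (G y) (G y).
  move=> Cx Cy; have Lx := LG Cx; have Ly := LG Cy.
  rewrite /F lD// (eq_L2_dot _ (GD t Cy Cx) (GD t Cy Cx)) L2_dot_comb_sqr//.
  by rewrite (L2_dotC _ _ (G y) (G x)) mulr2n; field.
have FM x : C x -> - M <= F x by move=> Cx; have := lM _ Cx; rewrite /F; lra.
pose m := inf (F @` C).
have hinf : has_inf (F @` C).
  split; first by have [x Cx] := C0; exists (F x), x.
  by exists (- M) => _ [x Cx <-]; exact: FM.
have mF x : C x -> m <= F x by move=> Cx; apply: ge_inf; [exact: hinf.2|exists x].
(* With a gap [e] at step [k] and [e / 8] at the next, comparison with the midpoint bounds the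
   squared distance of consecutive gradients by [9 / 2 * e], hence by [8 * e], which is the rate
   [8 ^- k] that [L2_fam_complete] asks for. *)
have e0 k : 0 < (8 : R)^-1 / 8 ^+ k by rewrite divr_gt0// exprn_gt0.
have hx k : exists x, C x /\ F x < m + 8^-1 / 8 ^+ k.
  have [_ [x Cx <-] xk] := inf_adherent (e0 k) hinf.
  by exists x.
pose x k := sval (cid (hx k)).
have Cx k : C (x k) by have [] := svalP (cid (hx k)).
have Fx k : F (x k) < m + 8^-1 / 8 ^+ k by have [] := svalP (cid (hx k)).
have Gd k : forall i z, K z ->
    G (-1 *: x k + x k.+1) i z = G (x k.+1) i z - G (x k) i z.
  by move=> i z Kz; rewrite GD//; ring.
have [||v Lv vk] := @L2_fam_complete _ _ _ J K mK I (fun k => G (x k)).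
- by move=> k; exact: LG.
- move=> k; rewrite -(eq_L2_dot _ (Gd k) (Gd k)).
  set y := -1 *: x k + x k.+1.
  have Cy : C y by exact: CD.
  have F1 : F (x k.+1) = F (1 *: y + x k).
    by rewrite /y scale1r scaleN1r addrAC addNr add0r.
  have F2 := mF _ (CD 2^-1 Cy (Cx k)).
  rewrite FE// in F1; rewrite FE// in F2.
  have Fk := Fx k; have Fk1 := Fx k.+1.
  rewrite exprS in Fk1; have := e0 k.
  have E : 8^-1 / (8 * 8 ^+ k) = 8^-1 * (8^-1 / 8 ^+ k) :> R by rewrite invfM; ring.
  rewrite E in Fk1.
  have -> : (8 ^+ k)^-1 = 8 * (8^-1 / 8 ^+ k) :> R by rewrite mulrA divff// mul1r.
  move: (8^-1 / 8 ^+ k) Fk Fk1 F1 F2 => e; rewrite expr1n exprVn.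
  move: (dot (G y) (G y)) => Q; move: (dot (G (x k)) (G y) - l y) => s.
  move=> *; lra.
pose r k := fun i z => -1 * G (x k) i z + v i z.
have Lr k : fam (r k) by apply: famc => //; exact: LG.
pose a k : R := 2^-1 * (#|I|%:R * (8 / 4 ^+ k)) + 8^-1 / 8 ^+ k.
have acvg : a k @[k --> \oo] --> (0 : R).
  have geo c : 1 < c -> (c ^+ k)^-1 @[k --> \oo] --> (0 : R).
    move=> c1; have c0 : 0 < c by exact: lt_trans c1.
    under eq_fun do rewrite -exprVn.
    by apply: cvg_expr; rewrite ger0_norm ?invr_ge0 ?(ltW c0)// invf_lt1.
  rewrite (_ : 0 = 2^-1 * (#|I|%:R * (8 * 0)) + 8^-1 * 0 :> R); last by ring.
  apply: cvgD; last by apply: cvgMr; apply: geo; rewrite ltr1n.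
  by do 3!apply: cvgMr; apply: geo; rewrite ltr1n.
have rk k : 2^-1 * dot (r k) (r k) <= 2^-1 * (#|I|%:R * (8 / 4 ^+ k)).
  rewrite ler_pM2l ?invr_gt0//; apply: le_trans (vk k).
  by rewrite le_eqVlt; apply/orP; left; apply/eqP; apply: eq_L2_dot => i z _; rewrite /r; ring.
have lea c : (forall k, c <= 0 + a k) -> c <= 0.
  move=> ca; apply/ler_addgt0Pr => e eps0.
  have /cvgrPdist_lt /(_ e eps0) [N _ /(_ N (leqnn N))] := acvg.
  rewrite /= sub0r normrN => aN; apply: le_trans (ca N) _.
  by rewrite lerD2l (le_trans (ler_norm _))// ltW.
have vG y : C y -> l y = dot v (G y).
  move=> Cy; have Ly := LG Cy; apply/eqP; rewrite -subr_eq0.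
  set w := l y - _; set Q := dot (G y) (G y).
  have Q0 : 0 <= Q by exact: L2_dot_ge0.
  (* Comparing [F] at [x k] and at its translate by [t *: y] gives this inequality with [G (x k)] in
     place of [v] and half of the quadratic term. The non-negative square of [t * G y + r k] pays
     for the replacement with the other half, and [a k] collects the errors. *)
  have pos t : t * w - t ^+ 2 * Q <= 0.
    apply: lea => k.
    have F1 := mF _ (CD t Cy (Cx k)); rewrite FE// -/Q in F1.
    have S0 := L2_dot_ge0 J K (fun i z => t * G y i z + r k i z).
    rewrite L2_dot_comb_sqr// -/Q dotr// in S0; last exact: LG.
    have Fk := Fx k; have rkk := rk k.
    rewrite /w (L2_dotC _ _ v (G y)).
    rewrite (L2_dotC _ _ (G y) (G (x k))) in S0.
    rewrite mulr2n in S0; rewrite /a.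
    move: (dot (G (x k)) (G y)) (dot (G y) v) F1 S0 => g1 g2 F1 S0; lra.
  (* For this [t] the left-hand side is the square of [t] itself, even when [Q] is 0, so [w]
     vanishes. *)
  have := pos (w / (Q + 1)).
  have Q1 : 0 < Q + 1 by lra.
  rewrite (_ : _ - _ = (w / (Q + 1)) ^+ 2); last by field; rewrite gt_eqF.
  move=> h; have : (w / (Q + 1)) ^+ 2 == 0 by rewrite eq_le h sqr_ge0.
  by rewrite sqrf_eq0 mulf_eq0 invr_eq0 (gt_eqF Q1) orbF.
exists v => //; split=> //.
(* Since [l] is now the product with [v], half the square of [v] is the value of [l - |G|^2 / 2] at
   [x k], at most [M], plus half the square of [r k]. *)
rewrite -subr_le0; apply: lea => k.
have := rk k; have := lM _ (Cx k); have ek := e0 k.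
rewrite {1}/r L2_dot_comb_sqr//; last exact: LG.
rewrite vG// (L2_dotC _ _ v) (_ : (-1) *+ 2 = - 2 :> R); last by rewrite mulr2n; ring.
rewrite /a => h1 h2.
by move: (dot (G (x k)) v) (dot v v) h1 h2 => g1 g2 h1 h2; lra.
Qed.

End Riesz.

Section induced_charge_integral.
Context d (T : measurableType d) (R : realType).
Context (J : {finite_measure set T -> \bar R}) (K : set T) (mK : measurable K).
Context (v : T -> R) (iv : J.-integrable setT (EFin \o v)).
Local Notation nu := (induced_charge iv).
Context (P N : set T) (nuPN : hahn_decomposition nu P N).

Let nuJ : nu `<< J.
Proof.
apply/null_content_dominatesP => A mA JA; apply: null_set_integral => //.
by apply: measurable_funTS; exact: measurable_int iv.
Qed.

(** The Radon-Nikodym densities of the two Jordan parts have a difference with the same integrals as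
    [v], hence equal to [v] almost everywhere, whichever Hahn decomposition [integral_charge] has
    picked. *)
Lemma Rintegral_jordan_induced (b : T -> R) (M : R) : measurable_fun K b ->
  (forall x, K x -> `|b x| <= M) ->
  \int[jordan_pos nuPN]_(x in K) b x - \int[jordan_neg nuPN]_(x in K) b x =
  \int[J]_(x in K) (b x * v x).
Proof.
move=> mb bM.
have ib (m : {finite_measure set T -> \bar R}) : m.-integrable K (EFin \o b).
  by apply: (bounded_integrable (M := M)) => //; rewrite ltey_eq fin_num_measure.
have bb : [bounded b x | x in K].
  exists M; split; first exact: num_real.
  by move=> y My x Kx; apply: le_trans (ltW My); exact: bM.
have posJ := jordan_pos_dominates nuPN nuJ.
have negJ := jordan_neg_dominates nuPN nuJ.
set gp := Radon_Nikodym (charge_of_finite_measure (jordan_pos nuPN)) J.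
set gn := Radon_Nikodym (charge_of_finite_measure (jordan_neg nuPN)) J.
have ip : J.-integrable setT gp by exact: Radon_Nikodym_integrable.
have in_ : J.-integrable setT gn by exact: Radon_Nikodym_integrable.
have ipK : J.-integrable K gp by exact: integrableS ip.
have inK : J.-integrable K gn by exact: integrableS in_.
have ivK : J.-integrable K (EFin \o v) by exact: integrableS iv.
have ibp : J.-integrable K (fun x => (b x)%:E * gp x)%E by exact: integrableMr.
have ibn : J.-integrable K (fun x => (b x)%:E * gn x)%E by exact: integrableMr.
have ae : ae_eq J K (gp \- gn)%E (EFin \o v).
  apply: integral_ae_eq => //.
  - exact: integrableB.
  - exact: measurable_int ivK.
  - move=> A AK mA; rewrite integralB//; last 2 first.
      exact: integrableS ipK.
      exact: integrableS inK.
    rewrite -Radon_Nikodym_integral// -Radon_Nikodym_integral//.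
    by rewrite [RHS](jordan_decomp nuPN mA) /cadd/= cscaleN1.
rewrite /Rintegral.
rewrite -(Radon_Nikodym_change_of_variables posJ mK (ib _)).
rewrite -(Radon_Nikodym_change_of_variables negJ mK (ib _)).
rewrite -/gp -/gn -fineB; [|exact: integrable_fin_num..].
rewrite -integralB//; congr fine.
transitivity (\int[J]_(x in K) ((b x)%:E * (gp x - gn x)))%E.
  apply: eq_integral => x xK; rewrite muleBr// fin_num_adde_defl//.
  by rewrite fin_numN /gn; apply: Radon_Nikodym_fin_num; exact: negJ.
transitivity (\int[J]_(x in K) ((b x)%:E * (v x)%:E))%E; last first.
  by apply: eq_integral => x _; rewrite EFinM.
apply: ae_eq_integral => //.
- apply: emeasurable_funM; first exact/measurable_EFinP.
  by apply: emeasurable_funB; [exact: measurable_int ipK|exact: measurable_int inK].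
- apply: emeasurable_funM; first exact/measurable_EFinP.
  exact: measurable_int ivK.
- exact: ae_eqe_mul2l.
Qed.

End induced_charge_integral.

(** * Vector measures and their energy *)

Section vector_measures.
Context (R : realType) (p q : nat) (Omega : set 'rV[R]_p) (D : set 'rV[R]_q).
Context (cO : compact Omega) (O_fin : (lebesgue_rV R p Omega < +oo)%E).
Context (cD : compact D).
Local Notation X := ('rV[R]_p * 'rV[R]_q)%type.
Local Notation K := (Omega `*` D).
Local Notation vmeas := ('I_p -> 'I_q -> {charge set X -> \bar R}).

Let mK : measurable K.
Proof. by apply: measurableX; exact: compact_measurable_mx. Qed.

Lemma within_continuous_integrable (m : {finite_measure set X -> \bar R}) (f : X -> R) :
  {within K, continuous f} -> m.-integrable K (EFin \o f).
Proof.
move=> fc; have [M fM] := within_continuous_bounded cO cD fc.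
apply: (bounded_integrable (M := M)) => //.
  by rewrite ltey_eq fin_num_measure.
exact: measurable_within_continuous.
Qed.

Lemma within_continuous_comb (a : R) (f g : X -> R) :
  {within K, continuous f} -> {within K, continuous g} ->
  {within K, continuous (fun z => a * f z + g z)}.
Proof. by move=> fc gc z; apply: cvgD (gc z); apply: cvgMr; exact: fc. Qed.

Lemma Rintegral_within_comb (m : {finite_measure set X -> \bar R}) (a : R) (f g : X -> R) :
  {within K, continuous f} -> {within K, continuous g} ->
  \int[m]_(z in K) (a * f z + g z) = a * \int[m]_(z in K) f z + \int[m]_(z in K) g z.
Proof.
move=> fc gc; have fi := within_continuous_integrable m fc.
have gi := within_continuous_integrable m gc.
by rewrite RintegralD ?RintegralZl//; exact: (integrableZl mK a fi).
Qed.

Lemma integral_charge_comb (nu : {charge set X -> \bar R}) (a : R) (f g : X -> R) :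
  {within K, continuous f} -> {within K, continuous g} ->
  integral_charge Omega D nu (fun z => a * f z + g z) =
  a * integral_charge Omega D nu f + integral_charge Omega D nu g.
Proof. move=> fc gc; rewrite /integral_charge /=; set P := jordan_pos _; set N := jordan_neg _.
by rewrite !Rintegral_within_comb// mulrBr opprD addrACA. Qed.

Lemma within_continuous_coef (b : X -> 'M[R]_(p, q)) al i :
  {within K, continuous b} -> {within K, continuous (fun z => b z al i)}.
Proof.
move=> bc z; apply: (@cvg_comp _ _ _ b (fun y : 'M[R]_(p, q) => y al i) _ _ _ (bc z)).
exact: coord_continuous.
Qed.

Lemma integral_vmeas_comb (E : vmeas) (a : R) (b c : X -> 'M[R]_(p, q)) :
  {within K, continuous b} -> {within K, continuous c} ->
  integral_vmeas Omega D E (fun z => a *: b z + c z) =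
  a * integral_vmeas Omega D E b + integral_vmeas Omega D E c.
Proof.
move=> bc cc; rewrite /integral_vmeas mulr_sumr -big_split/=; apply: eq_bigr => al _.
rewrite mulr_sumr -big_split/=; apply: eq_bigr => i _.
rewrite -integral_charge_comb; [|exact: within_continuous_coef..].
by congr integral_charge; apply/funext => z; rewrite !mxE.
Qed.

Section fixed_map.
Context (mu : 'rV[R]_p -> probability 'rV[R]_q R) (hmu : L2_map Omega D mu).
Local Notation J := (joint_measure (compact_measurable_mx cO) O_fin
  (measurable_mass_L2_map (compact_measurable_mx cO) hmu)).

Lemma integral_pmap_comb (a : R) (f g : X -> R) :
  {within K, continuous f} -> {within K, continuous g} ->
  integral_pmap Omega D mu (fun z => a * f z + g z) =
  a * integral_pmap Omega D mu f + integral_pmap Omega D mu g.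
Proof.
move=> fc gc; rewrite !(integral_pmap_joint cO O_fin cD hmu)//.
  by rewrite Rintegral_within_comb.
exact: within_continuous_comb.
Qed.

Lemma integral_pmap0 : integral_pmap Omega D mu (fun _ => 0) = 0.
Proof.
rewrite (integral_pmap_joint cO O_fin cD hmu); last by move=> z; exact: cvg_cst.
by rewrite /Rintegral integral0_eq.
Qed.

Lemma le_integral_pmap (f g : X -> R) :
  {within K, continuous f} -> {within K, continuous g} ->
  (forall z, K z -> f z <= g z) ->
  integral_pmap Omega D mu f <= integral_pmap Omega D mu g.
Proof.
move=> fc gc fg; rewrite !(integral_pmap_joint cO O_fin cD hmu)//.
by apply: le_Rintegral => //; exact: within_continuous_integrable.
Qed.

Lemma within_continuous_sqnorm (b : X -> 'M[R]_(p, q)) :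
  {within K, continuous b} ->
  {within K, continuous (fun z => \sum_al \sum_i b z al i ^+ 2)}.
Proof.
move=> bc z.
apply: (@cvg_comp _ _ _ b (fun y : 'M[R]_(p, q) => \sum_al \sum_i y al i ^+ 2) _ _ _ (bc z)).
apply: cvg_big => [|al _]; first exact: add_continuous.
apply: cvg_big => [|i _]; first exact: add_continuous.
apply: (@cvg_comp _ _ _ (fun y : 'M[R]_(p, q) => y al i) (fun t : R => t ^+ 2) _ _ _
  (@coord_continuous R p q al i (b z))).
exact: exprn_continuous.
Qed.

(* Fenchel-Young: the maximal a for a given b is - |b|^2 / 2. *)
Lemma Dir_pair_ge (E : vmeas) (b : X -> 'M[R]_(p, q)) : {within K, continuous b} ->
  ((integral_vmeas Omega D E b
    - 2^-1 * integral_pmap Omega D mu (fun z => \sum_al \sum_i b z al i ^+ 2))%:E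
   <= Dir_pair Omega D mu E)%E.
Proof.
move=> bc; have b2 := within_continuous_sqnorm bc.
apply: ereal_sup_ubound => /=.
exists (fun z => - 2^-1 * (\sum_al \sum_i b z al i ^+ 2)), b; split => //.
- by move=> z; apply: cvgMr; exact: b2.
- by move=> z _; rewrite mulNr addNr.
- have c0 : {within K, continuous (cst (0 : R) : X -> R)} by move=> z; exact: cvg_cst.
  have := integral_pmap_comb (- 2^-1) b2 c0.
  rewrite (_ : (fun z => _ + cst 0 z) =
    (fun z => - 2^-1 * (\sum_al \sum_i b z al i ^+ 2))); last first.
    by apply/funext => z; rewrite /= addr0.
  move=> ->; rewrite [X in _ + X + _](_ : _ = 0).
    by congr EFin; ring.
  by rewrite integral_pmap0.
Qed.

(** The measure has density [v] with respect to [J], set to 0 off [K]. Its energy is bounded by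
    Young's inequality, from the square of [b - v], together with [a <= - |b|^2 / 2]. *)
Lemma vmeas_of_density (v : 'I_p * 'I_q -> X -> R) : L2_fam J K v ->
  exists E : vmeas, [/\ vmeas_on Omega D E,
    forall b, {within K, continuous b} ->
      integral_vmeas Omega D E b = L2_dot J K v (fun k z => b z k.1 k.2) &
    (Dir_pair Omega D mu E <= (2^-1 * L2_dot J K v v)%:E)%E].
Proof.
move=> Lv.
have JK : (J K < +oo)%E by rewrite ltey_eq fin_num_measure.
have iv k : J.-integrable setT (EFin \o (v k \_ K)).
  have := L2_fun_integrable mK JK (Lv k); rewrite (integrable_mkcond _ mK).
  by apply: eq_integrable => // z _; rewrite /= !patchE; case: ifP.
pose E : vmeas := fun al i => induced_charge (iv (al, i)).
have EI b : {within K, continuous b} ->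
    integral_vmeas Omega D E b = L2_dot J K v (fun k z => b z k.1 k.2).
  move=> bc; rewrite /integral_vmeas pair_bigA/=; apply: eq_bigr => -[al i] _ /=.
  rewrite /integral_charge.
  have bic := @within_continuous_coef b al i bc.
  have [M bM] := within_continuous_bounded cO cD bic.
  rewrite [LHS](@Rintegral_jordan_induced _ _ _ J K mK _ (iv (al, i)) _ _ _
    (fun z => b z al i) M)//.
    by apply: eq_Rintegral => z zK; rewrite patchE zK mulrC.
  exact: measurable_within_continuous.
exists E; split => //.
  move=> al i A mA AK; rewrite /E/= /induced_charge; apply: integral0_eq => z Az.
  rewrite /= patchE memNset// => Kz.
  by have : (A `&` K) z by []; rewrite AK.
apply: ge_ereal_sup => _ [a [b [ac bc ab ->]]]; rewrite lee_fin EI//.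
have b2 := within_continuous_sqnorm bc.
pose bb (k : 'I_p * 'I_q) (z : X) := b z k.1 k.2.
have Lb : L2_fam J K bb.
  move=> k; have bic := @within_continuous_coef b k.1 k.2 bc.
  have [M bM] := within_continuous_bounded cO cD bic.
  apply: (L2_fun_bounded mK (M := M)) => //.
  exact: measurable_within_continuous.
have := L2_dot_ge0 J K (fun k z => -1 * v k z + bb k z).
rewrite L2_dot_comb_sqr// => S0.
have bbE : L2_dot J K bb bb = integral_pmap Omega D mu (fun z => \sum_al \sum_i b z al i ^+ 2).
  rewrite (integral_pmap_joint cO O_fin cD hmu)// /L2_dot.
  have [] := @Rintegral_sum _ _ _ J K mK _ (index_enum _) (fun k z => bb k z * bb k z).
    by move=> k; exact: L2_fun_mul.
  move=> <- _; apply: eq_Rintegral => z _; rewrite pair_bigA.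
  by apply: eq_bigr => k _; rewrite expr2.
have : integral_pmap Omega D mu a <=
    integral_pmap Omega D mu (fun z => - 2^-1 * (\sum_al \sum_i b z al i ^+ 2) + 0).
  apply: le_integral_pmap => //.
    by apply: within_continuous_comb => // z; exact: cvg_cst.
  by move=> z Kz; rewrite addr0 mulNr -subr_le0 opprK; exact: ab.
rewrite integral_pmap_comb//; last by move=> z; exact: cvg_cst.
rewrite -bbE integral_pmap0.
move: S0; rewrite (_ : (-1) *+ 2 = - 2 :> R); last by rewrite mulr2n; ring.
move: (L2_dot J K v v) (L2_dot J K v bb) (L2_dot J K bb bb) (integral_pmap _ _ _ a) => x y z w.
by lra.
Qed.

End fixed_map.
End vector_measures.

Lemma continuous_matrix (R : realType) (T : topologicalType) (m n : nat) (f : T -> 'M[R]_(m, n)) :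
  (forall i j, continuous (fun t => f t i j)) -> continuous f.
Proof.
move=> fc t; apply/cvgrPdist_lt => e e0.
have : \forall s \near t, forall i j, `|f t i j - f s i j| < e.
  by apply: filter_forall => i; apply: filter_forall => j; move/cvgrPdist_lt : (fc i j t); apply.
apply: filterS => s fts; rewrite [ltLHS]mx_normrE.
by apply: bigmax_lt => // -[i j] _; rewrite !mxE/=; exact: fts.
Qed.

(** * The space of C^1 test maps *)

Section C1_maps.
Context (R : realType) (p q : nat).
Local Notation X := ('rV[R]_p * 'rV[R]_q)%type.
Implicit Types phi psi : X -> 'rV[R]_p.

Lemma C1_map_derivable phi v z : C1_map phi -> derivable phi z v.
Proof. by move=> [dphi _]; exact: diff_derivable. Qed.

Lemma derive_comb (a : R) phi psi v z : C1_map phi -> C1_map psi ->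
  'D_v (a *: phi + psi) z = a *: 'D_v phi z + 'D_v psi z.
Proof.
move=> hphi hpsi; have dphi := @C1_map_derivable _ v z hphi.
have dpsi := @C1_map_derivable _ v z hpsi.
have dadd := @deriveD _ _ _ (a *: phi) psi z v (derivableZ dphi) dpsi.
by rewrite dadd; congr (_ + _); exact: deriveZ.
Qed.

Lemma C1_map_comb (a : R) phi psi : C1_map phi -> C1_map psi ->
  C1_map (a *: phi + psi).
Proof.
move=> hphi hpsi; have [dphi cphi] := hphi; have [dpsi cpsi] := hpsi; split.
  by move=> z; apply: differentiableD => //; exact: differentiableZ.
move=> v; rewrite (_ : (fun z => _) = (fun z => a *: 'D_v phi z + 'D_v psi z)).
  by move=> z; apply: cvgD (cpsi v z); apply: cvgZr; exact: cphi.
by apply/funext => z; exact: derive_comb.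
Qed.

Lemma div_Omega_comb (a : R) phi psi z : C1_map phi -> C1_map psi ->
  div_Omega (a *: phi + psi) z = a * div_Omega phi z + div_Omega psi z.
Proof.
move=> hphi hpsi; rewrite /div_Omega mulr_sumr -big_split/=.
by apply: eq_bigr => al _; rewrite derive_comb// !mxE.
Qed.

Lemma grad_D_comb (a : R) phi psi z : C1_map phi -> C1_map psi ->
  grad_D (a *: phi + psi) z = a *: grad_D phi z + grad_D psi z.
Proof. by move=> hphi hpsi; apply/matrixP => al i; rewrite !mxE derive_comb// !mxE. Qed.

Lemma continuous_derive_coord phi v al : C1_map phi ->
  continuous (fun z => ('D_v phi z) 0 al).
Proof.
move=> [_ cphi] z; apply: (@cvg_comp _ _ _ _ (fun y : 'rV[R]_p => y 0 al) _ _ _ (cphi v z)).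
exact: coord_continuous.
Qed.

Lemma continuous_div_Omega phi : C1_map phi -> continuous (div_Omega phi).
Proof.
move=> hphi z; apply: cvg_big => [|al _]; first exact: add_continuous.
exact: continuous_derive_coord.
Qed.

Lemma continuous_grad_D phi : C1_map phi -> continuous (grad_D phi).
Proof.
move=> hphi; apply: continuous_matrix => al i.
under eq_fun do rewrite mxE; exact: continuous_derive_coord.
Qed.

Lemma C1_map0 : C1_map (0 : X -> 'rV[R]_p).
Proof.
split=> [z|v z]; first exact: differentiable_cst.
under eq_fun do rewrite derive_cst; exact: cvg_cst.
Qed.

End C1_maps.

Section C1_Riesz.
Context (R : realType) (p q : nat) (Omega : set 'rV[R]_p) (D : set 'rV[R]_q).
Context (cO : compact Omega) (O_fin : (lebesgue_rV R p Omega < +oo)%E).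
Context (cD : compact D).
Local Notation X := ('rV[R]_p * 'rV[R]_q)%type.
Local Notation K := (Omega `*` D).

(** The quadratic form is the squared norm of [grad_D phi] in L^2(mu). As [phi] ranges over all C^1
    maps, without support condition, the measure obtained can realize prescribed boundary terms. *)
Lemma vmeas_of_bounded_functional (mu : 'rV[R]_p -> probability 'rV[R]_q R)
    (l : (X -> 'rV[R]_p) -> R) (M : R) : L2_map Omega D mu ->
  (forall a phi psi, C1_map phi -> C1_map psi -> l (a *: phi + psi) = a * l phi + l psi) ->
  (forall phi, C1_map phi ->
    l phi - 2^-1 * integral_pmap Omega D mu
      (fun z => \sum_al \sum_i grad_D phi z al i ^+ 2) <= M) ->
  exists E, [/\ vmeas_on Omega D E,
    forall phi, C1_map phi -> integral_vmeas Omega D E (grad_D phi) = l phi &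
    (Dir_pair Omega D mu E <= M%:E)%E].
Proof.
move=> hmu lD lM.
pose J := joint_measure (compact_measurable_mx cO) O_fin
  (measurable_mass_L2_map (compact_measurable_mx cO) hmu).
have mK : measurable K by apply: measurableX; exact: compact_measurable_mx.
have JK : (J K < +oo)%E by rewrite ltey_eq fin_num_measure.
pose G (phi : X -> 'rV[R]_p) (k : 'I_p * 'I_q) z := grad_D phi z k.1 k.2.
have gc phi : C1_map phi -> {within K, continuous (grad_D phi)}.
  by move=> hphi; apply: continuous_subspaceT; exact: continuous_grad_D.
have LG phi : C1_map phi -> L2_fam J K (G phi).
  move=> hphi k; have bic := @within_continuous_coef _ _ _ Omega D _ k.1 k.2 (gc _ hphi).
  have [B bB] := within_continuous_bounded cO cD bic.
  apply: (L2_fun_bounded mK (M := B)) => //.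
  exact: measurable_within_continuous.
have GE phi : C1_map phi -> L2_dot J K (G phi) (G phi) =
    integral_pmap Omega D mu (fun z => \sum_al \sum_i grad_D phi z al i ^+ 2).
  move=> hphi; rewrite (integral_pmap_joint cO O_fin cD hmu)//; last first.
    by apply: within_continuous_sqnorm; exact: gc.
  rewrite /L2_dot.
  have [] := @Rintegral_sum _ _ _ J K mK _ (index_enum _) (fun k z => G phi k z * G phi k z).
    by move=> k; apply: L2_fun_mul => //; exact: LG.
  move=> <- _; apply: eq_Rintegral => z _; rewrite pair_bigA.
  by apply: eq_bigr => k _; rewrite expr2.
have [||||v Lv [lv vM]] := @bounded_quadratic_representation _ _ _ J K mK _
  (X -> 'rV[R]_p) (@C1_map R p q) G l _ _ LG _ lD M.
- by exists 0; exact: C1_map0.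
- by move=> a phi psi; exact: C1_map_comb.
- by move=> a phi psi hphi hpsi k z _; rewrite /G grad_D_comb// !mxE.
- by move=> phi hphi; rewrite GE//; exact: lM.
have [E [Eon EI ED]] := vmeas_of_density cD Lv.
exists E; split=> //.
- by move=> phi hphi; rewrite EI ?lv//; exact: gc.
- by apply: le_trans ED _; rewrite lee_fin.
Qed.

End C1_Riesz.

(** * Lebesgue measure of the boundary *)

Section lebesgue_shift.
Context (R : realType).

Lemma lebesgue_measure_shift (c : R) (A : set R) : measurable A ->
  @lebesgue_measure R ((fun y => y + c) @^-1` A) = lebesgue_measure A.
Proof.
move=> mA.
have mf : measurable_fun setT (fun y : measurableTypeR R => y + c : measurableTypeR R).
  by apply: measurable_funD => //; exact: measurable_cst.
have := @lebesgue_measure_unique R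
  (measure_function_pushforward__canonical__measure_function_Measure (@lebesgue_measure R) mf).
move=> /(_ _ A mA) ->// _ [[a b]] _ <-.
rewrite /= /pushforward (_ : _ @^-1` _ = `]a - c, b - c]%classic); last first.
  by apply/seteqP; split=> y /=; rewrite !in_itv/= ltrBlDr lerBrDr.
rewrite !lebesgue_measure_itv/= !lte_fin ltrBlDr subrK.
by case: ifP => // _; rewrite -!EFinB; congr EFin; ring.
Qed.

Lemma measurable_shift_rV n (c : 'rV[R]_n) : measurable_fun setT (fun x : 'rV[R]_n => x + c).
Proof.
apply: measurable_fun_rV => i; under eq_fun do rewrite mxE.
by apply: measurable_funD => //; exact: measurable_coord_rV.
Qed.

(** By induction on the dimension: the coordinate [ord0] is shifted inside each section, the
    remaining ones in the outer integral. *)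
Lemma lebesgue_rV_shift n (c : 'rV[R]_n) (A : set 'rV[R]_n) : measurable A ->
  lebesgue_rV R n ((fun x => x + c) @^-1` A) = lebesgue_rV R n A.
Proof.
elim: n => [|n IHn] in c A *; move=> mA.
  congr (_ _); apply/seteqP; split=> x /=; rewrite (_ : x + c = x)//;
    by apply/matrixP => i [].
pose B := @snoc_rV R n @^-1` A.
have mB : measurable B.
  by rewrite -[B]setTI; exact: measurable_snoc_rV.
pose c' : 'rV[R]_n := \row_i c 0 (lift ord0 i).
have mg := @measurable_fun_xsection _ _ _ _ R (@lebesgue_measure R) B mB.
pose g x := (@lebesgue_measure R) (xsection B x).
transitivity (\int[lebesgue_rV R n]_x (g \o (fun x : 'rV[R]_n => (x + c')%R)) x)%E.
  apply: eq_integral => x _ /=; rewrite /g.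
  rewrite -[RHS](@lebesgue_measure_shift (c 0 ord0) (xsection B (x + c')));
    last exact: measurable_xsection.
  congr (_ _); apply/funext => y; rewrite /xsection/= !in_setE /B/=.
  congr A; apply/rowP => i; rewrite mxE; case: (unliftP ord0 i) => [j ->|->].
    by rewrite !snoc_rVS !mxE.
  by rewrite !snoc_rV0.
have := @ge0_integral_pushforward _ _ _ _ _ _ (measurable_shift_rV c') (lebesgue_rV R n) setT g
  measurableT mg.
rewrite preimage_setT => <-//.
transitivity (\int[lebesgue_rV R n]_x g x)%E; last by [].
apply: (@eq_measure_integral _ _ _ setT (lebesgue_rV R n)
  (measure_function_pushforward__canonical__measure_function_Measure
    (lebesgue_rV R n) (measurable_shift_rV c'))) => S mS _.
exact: IHn.
Qed.

(** By the last hypothesis a line of direction [e] meets [S] at most once, so the translates of [S]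
    by multiples [1 / (k + 1)] of [e] are disjoint. They have equal measure and share one bounded
    box, which forces that measure to be 0. *)
Lemma shift_disjoint_null n (S : set 'rV[R]_n) (e : 'rV[R]_n) (M : R) :
  measurable S -> (forall x, S x -> forall i, `|x 0 i| <= M) ->
  (forall x s t, S (x + s *: e) -> S (x + t *: e) -> s = t) ->
  lebesgue_rV R n S = 0%E.
Proof.
move=> mS SM dS.
pose F (k : nat) := (fun x => x + (k.+1%:R^-1 : R) *: e) @^-1` S.
have mF k : measurable (F k) by rewrite -[F k]setTI; exact: measurable_shift_rV.
have FE k : lebesgue_rV R n (F k) = lebesgue_rV R n S by exact: lebesgue_rV_shift.
have tF : trivIset setT F.
  apply/trivIsetP => i j _ _ ij; rewrite -subset0 => x [xi xj].
  have := dS _ _ _ xi xj => /invr_inj /eqP; rewrite eqr_nat eqSS => /eqP ijE.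
  by rewrite ijE eqxx in ij.
pose a : 'rV[R]_n := \row_i (- (`|M| + `|e 0 i|)).
pose b : 'rV[R]_n := \row_i (`|M| + `|e 0 i|).
pose B : set 'rV[R]_n := [set x | forall i, a 0 i <= x 0 i <= b 0 i].
have Bfin : (lebesgue_rV R n B < +oo)%E.
  by rewrite lebesgue_rV_box ?ltry// => i; rewrite !mxE; have := normr_ge0 M;
    have := normr_ge0 (e 0 i); lra.
have FB k : F k `<=` B.
  move=> x Fx i; rewrite !mxE -ler_norml.
  have := SM _ Fx i; rewrite !mxE => xM.
  have -> : x 0 i = (x 0 i + k.+1%:R^-1 * e 0 i) - k.+1%:R^-1 * e 0 i by ring.
  apply: le_trans (ler_normB _ _) _; apply: lerD; first exact: le_trans (ler_norm M).
  rewrite normrM ler_piMl// ger0_norm// invf_le1// ler1n//.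
have mB : measurable B.
  rewrite (_ : B = \bigcap_(i in [set: 'I_n])
      (fun x : 'rV[R]_n => x 0 i) @^-1` `[a 0 i, b 0 i]%classic).
    apply: fin_bigcap_measurable => // i _; rewrite -[X in measurable X]setTI.
    exact: (measurable_coord_rV i measurableT (measurable_itv `[a 0 i, b 0 i])).
  apply/seteqP; split=> [x Bx i _|x Bx i] /=; first by rewrite in_itv/=.
  by have := Bx i I; rewrite /= in_itv/=.
have NS N : (N%:R%:E * lebesgue_rV R n S <= lebesgue_rV R n B)%E.
  have := @measure_bigsetU _ _ _ (lebesgue_rV R n) F mF tF N.
  rewrite (eq_bigr (fun=> lebesgue_rV R n S)); last by move=> i _; exact: FE.
  have -> : (\sum_(i < N) lebesgue_rV R n S = N%:R%:E * lebesgue_rV R n S)%E.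
    elim: N => [|N IHN]; first by rewrite big_ord0 mul0e.
    by rewrite big_ord_recr/= IHN -natr1 EFinD ge0_muleDl// mul1e.
  move=> <-; apply: le_measure; rewrite ?inE//.
    exact: bigsetU_measurable.
  by rewrite -bigcup_mkord => x [k _ Fx]; exact: FB Fx.
have Sfin : lebesgue_rV R n S \is a fin_num.
  rewrite ge0_fin_numE//; apply: le_lt_trans Bfin.
  by have := NS 1%N; rewrite mul1e.
apply/eqP; rewrite eq_le measure_ge0 andbT leNgt; apply/negP.
rewrite -(fineK Sfin) lte_fin => s0.
have Bf : lebesgue_rV R n B \is a fin_num by rewrite ge0_fin_numE.
have := NS (Num.bound (fine (lebesgue_rV R n B) / fine (lebesgue_rV R n S))).
rewrite -(fineK Sfin) -[leRHS](fineK Bf) -EFinM lee_fin leNgt => /negP; apply.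
by rewrite -ltr_pdivrMr//; apply: archi_boundP; rewrite divr_ge0// ?fine_ge0// ltW.
Qed.

End lebesgue_shift.

Section lipschitz_boundary_null.
Context (R : realType).

Lemma lipschitz_continuous (V W : normedModType R) (f : V -> W) :
  lipschitz f -> continuous f.
Proof.
move=> lf x; have [M [_ fM]] := lf.
have {}fM : forall u, `|f x - f u| <= (`|M| + 1) * `|x - u|.
  move=> u; apply: (fM (`|M| + 1) _ (x, u)) => //.
  by rewrite (le_lt_trans (ler_norm M))// ltrDl.
have M0 : 0 < `|M| + 1 by rewrite ltr_wpDl.
apply/cvgrPdist_lt => e e0.
have : \forall u \near x, `|x - u| < e / (`|M| + 1).
  by have /cvgrPdist_lt := @cvg_id _ (nbhs x); apply; rewrite divr_gt0.
apply: filterS => u xu; apply: le_lt_trans (fM u) _.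
by rewrite mulrC -ltr_pdivlMr.
Qed.

Lemma continuous_mx_coord m n (T : topologicalType) (f : T -> 'M[R]_(m, n)) i j :
  continuous f -> continuous (fun t => f t i j).
Proof.
move=> fc t; apply: (@cvg_comp _ _ _ f (fun y : 'M[R]_(m, n) => y i j) _ _ _ (fc t)).
exact: coord_continuous.
Qed.

Lemma continuous_mulmxr m n k (T : topologicalType) (f : T -> 'M[R]_(m, n)) (Q : 'M[R]_(n, k)) :
  continuous f -> continuous (fun t => mulmx (f t) Q).
Proof.
move=> fc; apply: continuous_matrix => i l t.
rewrite (_ : (fun _ => _) = (fun t => \sum_h f t i h * Q h l)); last first.
  by apply/funext => s; rewrite mxE.
apply: cvg_big => [|h _]; first exact: add_continuous.
by apply: cvgMl; exact: continuous_mx_coord.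
Qed.

Context (n : nat) (Omega : set 'rV[R]_n).

(* Translates of a graph along the vertical direction are disjoint. *)
Lemma lipschitz_boundary_null : closed Omega -> lipschitz_boundary Omega ->
  lebesgue_rV R n (Omega `\` interior Omega) = 0%E.
Proof.
move=> cO lipO; set B := Omega `\` _.
have mO : measurable Omega.
  by rewrite -(setCK Omega); apply: measurableC; apply: open_measurable_mx; exact: closed_openC.
have mB : measurable B.
  by apply: measurableD => //; apply: open_measurable_mx; exact: open_interior.
have loc xi0 : B xi0 -> exists2 a, base_box a xi0 & lebesgue_rV R n (B `&` base_box a) = 0%E.
  move=> Bxi0; have [Oxi0 nxi0] := Bxi0.
  have [|Q [j [f [QQ lf QO]]]] := lipO xi0.
    by rewrite -(closure_id _).1.
  (* Near [xi0], [Omega] is where the continuous function [g] is non-negative. A point with [g > 0]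
     is interior, so [g] vanishes on the boundary. *)
  pose g (xi : 'rV[R]_n) := (xi *m Q) 0 j - f (col' j (xi *m Q)).
  have cQ : continuous (fun xi : 'rV[R]_n => xi *m Q).
    by apply: continuous_mulmxr => xi; exact: cvg_id.
  have gc : continuous g.
    have c1 := @continuous_mx_coord _ _ _ _ 0 j cQ.
    have c2 : continuous (fun xi : 'rV[R]_n => col' j (xi *m Q)).
      apply: continuous_matrix => i k; under eq_fun do rewrite mxE.
      exact: continuous_mx_coord.
    have c3 : continuous (fun xi : 'rV[R]_n => f (col' j (xi *m Q))).
      by move=> xi; apply: continuous_comp; [exact: c2|exact: lipschitz_continuous].
    by move=> xi; exact: (continuousB (c1 xi) (c3 xi)).
  have gO : \forall xi \near xi0, Omega xi <-> 0 <= g xi.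
    by apply: filterS QO => xi ->; rewrite subr_ge0.
  have [a axi0 aO] := base_box_sub gO.
  exists a => //.
  have g0 xi : B xi -> base_box a xi -> g xi = 0.
    move=> [Oxi nxi] axi; apply/eqP; rewrite eq_le; apply/andP; split; last exact/(aO _ axi).1.
    rewrite leNgt; apply/negP => gxi; apply: nxi.
    have n1 := nbhs_base_box axi.
    have n2 : \forall u \near xi, 0 < g u by exact: (cvgr_gt _ (gc xi) _ gxi).
    by rewrite /interior/=; apply: filterS2 n1 n2 => u au gu; apply/(aO _ au).2/ltW.
  pose M := \sum_i (`|ratr (a.1 0 i)| + 1) : R.
  (* This vector is the vertical direction in the original coordinates: [Q] sends it to the [j]-th
     basis vector, so along it [g] grows at unit rate and vanishes only once. *)
  apply: (@shift_disjoint_null _ _ _ (delta_mx 0 j *m Q^T) M).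
  - by apply: measurableI => //; exact: measurable_base_box.
  - move=> x [_ ax] i; rewrite /M (bigD1 i)//= ler_wpDr//.
      by apply: sumr_ge0 => k _; rewrite addr_ge0.
    have := ax i; rewrite /ball/= => xi1.
    rewrite [x 0 i](_ : _ = ratr (a.1 0 i) - (ratr (a.1 0 i) - x 0 i)); last by ring.
    apply: le_trans (ler_normB _ _) _; rewrite lerD2l; apply: le_trans (ltW xi1) _.
    by rewrite invf_le1// ler1n.
  have Qd (x : 'rV[R]_n) s : (x + s *: (delta_mx 0 j *m Q^T)) *m Q = x *m Q + s *: delta_mx 0 j.
    by rewrite mulmxDl -scalemxAl -mulmxA (mulmx1C QQ) mulmx1.
  have gd x s : g (x + s *: (delta_mx 0 j *m Q^T)) = g x + s.
    rewrite /g Qd (_ : col' j _ = col' j (x *m Q)).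
      by rewrite !mxE !eqxx mulr1; ring.
    by apply/rowP => i; rewrite !mxE eq_sym (negbTE (neq_lift _ _)) andbF mulr0 addr0.
  move=> x s t [Bs as_] [Bt at_].
  have := g0 _ Bs as_; rewrite -(g0 _ Bt at_) !gd => /addrI; exact.
(* The boxes that meet [B] in a null set cover [B] by the local statement, and the base has only
   countably many boxes. *)
pose F (k : nat) := if unpickle k is Some a then
  if `[< lebesgue_rV R n (B `&` base_box a) = 0%E >] then B `&` base_box a else set0 else set0.
apply: measure_negligible => //.
apply: (@negligibleS _ _ _ _ (\bigcup_k F k)).
  move=> xi Bxi; have [a axi aB] := loc _ Bxi.
  by exists (pickle a) => //; rewrite /F pickleK; case: asboolP.
apply: negligible_bigcup => k; rewrite /F; case: unpickle => [a|]; last exact: negligible_set0.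
case: asboolP => [aB|_]; last exact: negligible_set0.
by apply/negligibleP => //; apply: measurableI => //; exact: measurable_base_box.
Qed.

End lipschitz_boundary_null.

(** * Cutoffs *)

Section C1_functions.
Context (R : realType).

Definition C1_fun (V : normedModType R) (g : V -> R) :=
  (forall z, differentiable g z) /\ (forall v, continuous (fun z => 'D_v g z)).

Section closure_properties.
Context (V : normedModType R).
Implicit Types f g : V -> R.

Lemma C1_fun_continuous g : C1_fun g -> continuous g.
Proof. by move=> [dg _] z; exact: differentiable_continuous. Qed.

Lemma C1_fun_cst (c : R) : C1_fun (fun _ : V => c).
Proof.
split=> [z|v z]; first exact: differentiable_cst.
under eq_fun do rewrite derive_cst; exact: cvg_cst.
Qed.

Lemma C1_funD f g : C1_fun f -> C1_fun g -> C1_fun (fun z => f z + g z).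
Proof.
move=> [df cf] [dg cg]; split=> [z|v]; first exact: (differentiableD (df z) (dg z)).
rewrite (_ : 'D_v _ = (fun z => 'D_v f z + 'D_v g z)).
  by move=> z; exact: (continuousD (cf v z) (cg v z)).
by apply/funext => z; apply: (@deriveD _ _ _ f g); exact: diff_derivable.
Qed.

Lemma C1_funM f g : C1_fun f -> C1_fun g -> C1_fun (fun z => f z * g z).
Proof.
move=> hf hg; have [df cf] := hf; have [dg cg] := hg.
split=> [z|v]; first exact: (differentiableM (df z) (dg z)).
rewrite (_ : 'D_v _ = (fun z => f z * 'D_v g z + g z * 'D_v f z)).
  have f0 := C1_fun_continuous hf; have g0 := C1_fun_continuous hg.
  by move=> z; exact: (continuousD (continuousM (f0 z) (cg v z)) (continuousM (g0 z) (cf v z))).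
by apply/funext => z; apply: (@deriveM _ _ f g); exact: diff_derivable.
Qed.

Lemma C1_fun_sum (I : Type) (s : seq I) (h : I -> V -> R) :
  (forall i, C1_fun (h i)) -> C1_fun (fun z => \sum_(i <- s) h i z).
Proof.
move=> hh; elim: s => [|i s IHs].
  by under eq_fun do rewrite big_nil; exact: C1_fun_cst.
by under eq_fun do rewrite big_cons; exact: C1_funD.
Qed.

Lemma C1_fun_prod (I : Type) (s : seq I) (h : I -> V -> R) :
  (forall i, C1_fun (h i)) -> C1_fun (fun z => \prod_(i <- s) h i z).
Proof.
move=> hh; elim: s => [|i s IHs].
  by under eq_fun do rewrite big_nil; exact: C1_fun_cst.
by under eq_fun do rewrite big_cons; exact: C1_funM.
Qed.

Lemma C1_fun_comp (f f' : R -> R) g : (forall x, is_derive (x : R) (1 : R) f (f' x)) ->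
  continuous f' -> C1_fun g -> C1_fun (f \o g).
Proof.
move=> ff' cf' hg; have [dg cg] := hg.
have df x : differentiable f x by apply/derivable1_diffP; exact: ex_derive.
split=> [z|v]; first exact: differentiable_comp.
rewrite (_ : 'D_v _ = (fun z => f' (g z) * 'D_v g z)).
  have g0 := C1_fun_continuous hg.
  by move=> z; exact: (continuousM (continuous_comp (g0 z) (cf' (g z))) (cg v z)).
apply/funext => z; rewrite deriveE; last exact: differentiable_comp.
rewrite diff_comp//= deriv1E; last exact: ex_derive.
by rewrite -deriveE// derive1E (@derive_val _ _ _ _ _ _ _ (ff' (g z))) mulrC.
Qed.

End closure_properties.

Lemma derive_invariant (V W : normedModType R) (f : V -> W) (z v : V) :
  (forall h : R, f (h *: v + z) = f z) -> 'D_v f z = 0.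
Proof.
move=> fh; rewrite /derive (_ : (fun h => _) = cst 0); first exact: lim_cst.
by apply/funext => h; rewrite /= fh subrr scaler0.
Qed.

(** The square of the positive part is C^1 and vanishes on a half-line, which is smooth enough to
    cut off C^1 maps. *)
Definition pos_sqr (x : R) := Num.max x 0 ^+ 2.

Lemma is_derive_quadratic_error (f : R -> R) (x a : R) :
  (forall h, `|f (h + x) - f x - h * a| <= h ^+ 2) -> is_derive (x : R) (1 : R) f a.
Proof.
move=> fa.
have c : h^-1 *: (f (h *: 1 + x) - f x) @[h --> 0^'] --> a.
  apply/cvgrPdist_lt => e e0; near=> h.
  have h0 : h != 0 by near: h; exact: nbhs_dnbhs_neq.
  have he : `|h| < e.
    by rewrite -normrN -sub0r; near: h; apply: nbhs_dnbhs; exact: nbhsx_ballx.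
  apply: le_lt_trans he; rewrite distrC -(ler_pM2l (x := `|h|)) ?normr_gt0//.
  rewrite -normrM -normrM -expr2 [leRHS]ger0_norm ?sqr_ge0//.
  rewrite (_ : h * _ = f (h + x) - f x - h * a)//.
  by rewrite /GRing.scale/= mulr1 mulrBr mulrA divff// mul1r.
split; first by apply/cvg_ex; exists a.
exact: cvg_lim c.
Unshelve. all: by end_near. Qed.

Lemma is_derive_pos_sqr (x : R) : is_derive (x : R) (1 : R) pos_sqr (2 * Num.max x 0).
Proof.
apply: is_derive_quadratic_error => h; rewrite /pos_sqr.
have [x0|x0] := lerP x 0; have [hx|hx] := lerP (h + x) 0.
- by rewrite (_ : _ - _ = 0) ?normr0 ?sqr_ge0//; ring.
- rewrite (_ : _ - _ = (h + x) ^+ 2); last by ring.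
  by rewrite ger0_norm ?sqr_ge0//; nra.
- rewrite ler_norml; apply/andP; split; nra.
- rewrite (_ : _ - _ = h ^+ 2); last by ring.
  by rewrite ger0_norm ?sqr_ge0.
Qed.

Lemma pos_sqr_ge0 x : 0 <= pos_sqr x.
Proof. exact: sqr_ge0. Qed.

Lemma pos_sqr_gt0 x : 0 < x -> 0 < pos_sqr x.
Proof. by move=> x0; rewrite /pos_sqr max_l ?exprn_gt0// ltW. Qed.

Lemma pos_sqr_eq0 x : x <= 0 -> pos_sqr x = 0.
Proof. by move=> x0; rewrite /pos_sqr max_r// expr0n. Qed.

Lemma C1_fun_pos_sqr (V : normedModType R) (g : V -> R) :
  C1_fun g -> C1_fun (fun z => pos_sqr (g z)).
Proof.
apply: (C1_fun_comp is_derive_pos_sqr) => x.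
by apply: cvgMr; apply: continuous_max => //; exact: cvg_cst.
Qed.

End C1_functions.

Section cutoffs.
Context (R : realType) (p q : nat).
Local Notation X := ('rV[R]_p * 'rV[R]_q)%type.

Lemma C1_map_coordP (phi : X -> 'rV[R]_p) :
  C1_map phi <-> forall al, C1_fun (fun z => phi z 0 al).
Proof.
split=> [hphi al|hphi].
  have [dphi cphi] := hphi; split=> [z|v].
    apply: (@differentiable_comp _ _ _ _ phi (fun y : 'rV[R]_p => y 0 al)) => //.
    exact: differentiable_coord.
  rewrite (_ : 'D_v _ = (fun z => ('D_v phi z) 0 al)).
    exact: continuous_derive_coord.
  by apply/funext => z; rewrite derive_mx ?mxE//; exact: C1_map_derivable.
have dphi z : differentiable phi z.
  rewrite (_ : phi = \sum_(al < p) (fun z => phi z 0 al *: (delta_mx 0 al : 'rV[R]_p))).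
    apply: differentiable_sum => al; apply: differentiableZl.
    by have [dal _] := hphi al; exact: dal.
  by apply/funext => y; rewrite fct_sumE -row_sum_delta.
split=> // v; rewrite (_ : (fun z => _) = (fun z => \row_al 'D_v (fun z => phi z 0 al) z)).
  apply: continuous_matrix => i al; under eq_fun do rewrite mxE.
  by have [_ cal] := hphi al; exact: cal.
apply/funext => z; rewrite derive_mx; last exact: diff_derivable.
by apply/matrixP => i j; rewrite !mxE ord1.
Qed.

Lemma C1_map_scale (g : X -> R) (phi : X -> 'rV[R]_p) :
  C1_fun g -> C1_map phi -> C1_map (fun z => g z *: phi z).
Proof.
move=> hg hphi; apply/C1_map_coordP => al.
under eq_fun do rewrite mxE.
by apply: C1_funM => //; move/C1_map_coordP : hphi; exact.
Qed.

(** The cutoff does not vary with [x], so the product rule leaves one term; the derivatives of [g]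
    in [xi] enter only [div_Omega]. *)
Lemma grad_D_scale (g : 'rV[R]_p -> R) (phi : X -> 'rV[R]_p) z :
  C1_fun (fun y : X => g y.1) -> C1_map phi ->
  grad_D (fun y => g y.1 *: phi y) z = g z.1 *: grad_D phi z.
Proof.
move=> hg hphi; apply/matrixP => al i; rewrite !mxE.
set v := (0, _) : X.
have dgphi : C1_map (fun y => g y.1 *: phi y) by exact: C1_map_scale.
have dphial : derivable (fun y => phi y 0 al) z v.
  by apply: diff_derivable; have /C1_map_coordP /(_ al) [] := hphi.
rewrite derive_mx ?mxE; last exact: C1_map_derivable.
rewrite [in RHS]derive_mx ?mxE; last exact: C1_map_derivable.
under eq_fun do rewrite mxE.
have -> : (fun y : X => g y.1 * phi y 0 al) = (fun y => g y.1) * (fun y => phi y 0 al) by [].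
rewrite deriveM//; last by apply: diff_derivable; have [] := hg.
rewrite [X in _ + _ *: X](_ : _ = 0) ?scaler0 ?addr0//.
by apply: derive_invariant => h; rewrite /= scaler0 add0r.
Qed.

Lemma C1_fun_coord (i : 'I_p) : C1_fun (fun z : X => z.1 0 i).
Proof.
have @f : {linear X -> R}.
  by exists (fun z : X => z.1 0 i); do 2![eexists]; do ?[constructor];
     rewrite ?mxE// => ? *; rewrite ?mxE//; move=> ?; rewrite !mxE.
have cf : continuous (f : X -> R).
  move=> z; apply: (@cvg_comp _ _ _ (fun z : X => z.1) (fun y : 'rV[R]_p => y 0 i)).
    exact: cvg_fst.
  exact: coord_continuous.
split=> [z|v]; first exact: (@linear_differentiable _ _ _ f).
rewrite (_ : 'D_v _ = cst (f v)); first exact: cst_continuous.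
apply/funext => z; rewrite deriveE; last exact: (@linear_differentiable _ _ _ f).
by have -> := (@diff_lin _ _ _ f z cf).
Qed.

Definition box_bump (a : 'rV[rat]_p * nat) (x : 'rV[R]_p) : R :=
  \prod_i pos_sqr (a.2.+1%:R^-1 ^+ 2 - (x 0 i - ratr (a.1 0 i)) ^+ 2).

Lemma C1_fun_box_bump a : C1_fun (fun z : X => box_bump a z.1).
Proof.
apply: C1_fun_prod => i; apply: C1_fun_pos_sqr; apply: C1_funD; first exact: C1_fun_cst.
have h : C1_fun (fun z : X => z.1 0 i + - ratr (a.1 0 i)).
  by apply: C1_funD; [exact: C1_fun_coord|exact: C1_fun_cst].
have := C1_funM (C1_fun_cst _ (-1)) (C1_funM h h).
by under eq_fun do rewrite mulN1r -expr2.
Qed.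

Lemma box_bump_ge0 a x : 0 <= box_bump a x.
Proof. by apply: prodr_ge0 => i _; exact: pos_sqr_ge0. Qed.

Lemma box_bump_gt0 a x : base_box a x -> 0 < box_bump a x.
Proof.
move=> ax; apply: prodr_gt0 => i _; apply: pos_sqr_gt0; rewrite subr_gt0.
rewrite -real_normK ?num_real// ltrXn2r// ?nnegrE//.
by have := ax i; rewrite /ball/= distrC.
Qed.

Lemma box_bump_eq0 a x : ~ base_box a x -> box_bump a x = 0.
Proof.
move=> ax; have [i ai] : exists i, ~ ball (ratr (a.1 0 i) : R) a.2.+1%:R^-1 (x 0 i).
  by apply: contrapT => /forallNP h; apply: ax => i; exact: contrapT (h i).
rewrite /box_bump (bigD1 i)//= pos_sqr_eq0 ?mul0r// subr_le0.
rewrite -[leRHS]real_normK ?num_real// lerXn2r ?nnegrE//.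
by rewrite leNgt; apply/negP => h; apply: ai; rewrite /ball/= distrC.
Qed.

(* eta k is one minus a cutoff: it is 1 near the complement of U and tends
   to 0 on U. *)
Lemma interior_cutoffs (U : set 'rV[R]_p) : open U ->
  exists eta : nat -> 'rV[R]_p -> R, [/\
    forall k, C1_fun (fun z : X => eta k z.1),
    forall k x, 0 <= eta k x <= 1,
    forall x, U x -> eta k x @[k --> \oo] --> (0 : R) &
    forall k, exists C : set 'rV[R]_p, [/\ closed C, C `<=` U &
      forall x, ~ C x -> eta k x = 1]].
Proof.
move=> oU.
(* Asking for the closed box inside [U] makes the support of its bump lie in [U]; regularity of the
   space shows that such boxes still cover [U]. *)
pose good (a : 'rV[rat]_p * nat) := `[< closure (@base_box R p a) `<=` U >].
pose b (j : nat) (x : 'rV[R]_p) : R :=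
  if unpickle j is Some a then if good a then box_bump a x else 0 else 0.
have b0 j x : 0 <= b j x.
  rewrite /b; case: unpickle => // a; case: ifP => // _; exact: box_bump_ge0.
have bC1 j : C1_fun (fun z : X => b j z.1).
  rewrite /b; case: unpickle => [a|]; last exact: C1_fun_cst.
  by case: (good a); [exact: C1_fun_box_bump|exact: C1_fun_cst].
pose C (j : nat) : set 'rV[R]_p :=
  if unpickle j is Some a then if good a then closure (base_box a) else set0 else set0.
have C_closed j : closed (C j).
  rewrite /C; case: unpickle => [a|]; last exact: closed0.
  by case: ifP => _; [exact: closed_closure|exact: closed0].
have CU j : C j `<=` U.
  rewrite /C; case: unpickle => [a|]; last exact: sub0set.
  by case: ifP => [/asboolP//|_]; exact: sub0set.
have bC j x : ~ C j x -> b j x = 0.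
  rewrite /b /C; case: unpickle => // a; case: ifP => // _ Cx.
  by apply: box_bump_eq0 => ax; apply: Cx; exact: subset_closure.
pose S k x := \sum_(j < k) b j x.
have S0 k x : 0 <= S k x by apply: sumr_ge0.
(* The value is 1 where the first [k] bumps vanish, and 0 as soon as [k] times their sum reaches 1,
   which happens eventually at every point of [U]. *)
exists (fun k x => pos_sqr (1 + - k%:R * S k x)); split.
- move=> k; apply: C1_fun_pos_sqr; apply: C1_funD; first exact: C1_fun_cst.
  by apply: C1_funM; [exact: C1_fun_cst|apply: C1_fun_sum => j; exact: bC1].
- move=> k x; rewrite pos_sqr_ge0/= /pos_sqr.
  have kS : 0 <= k%:R * S k x by rewrite mulr_ge0.
  rewrite -(expr1n R 2) lerXn2r ?nnegrE ?le_max ?lexx ?orbT//.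
  by rewrite ge_max ler01 andbT mulNr; lra.
- move=> x Ux.
  have [V nV VU] : exists2 V, nbhs x V & closure V `<=` U.
    by apply: (@uniform_regular 'rV[R]_p x U); exact: open_nbhs_nbhs.
  have [a ax aV] := base_box_sub nV.
  have ga : good a by apply/asboolP; apply: subset_trans VU; exact: closure_subset.
  pose j := pickle a; have bj : 0 < b j x by rewrite /b /j pickleK ga box_bump_gt0.
  apply: cvg_near_cst.
  near=> k; apply: pos_sqr_eq0.
  have jk : (j < k)%N by near: k; exact: nbhs_infty_gt.
  have kb : 1 <= k%:R * b j x.
    rewrite -ler_pdivrMr// mul1r.
    by near: k; exact: nbhs_infty_ger.
  rewrite mulNr subr_le0; apply: le_trans kb _; rewrite ler_wpM2l//.
  rewrite /S (bigD1 (Ordinal jk))//= lerDl; exact: sumr_ge0.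
- move=> k; exists (\bigcup_(j in [set j | (j < k)%N]) C j); split.
  + by apply: closed_bigcup => // j _; exact: C_closed.
  + by move=> x [j _]; exact: CU.
  + move=> x Cx; rewrite (_ : S k x = 0).
      by rewrite mulr0 addr0 /pos_sqr max_l ?expr1n.
    apply: big1 => j _; apply: bC => Cjx; apply: Cx; exists (j : nat) => /=.
Unshelve. all: by end_near. Qed.

End cutoffs.

(** * Independence of the boundary term from the momentum *)

Section boundary_term_uniqueness.
Context (R : realType) (p q : nat) (Omega : set 'rV[R]_p) (D : set 'rV[R]_q).
Context (cO : compact Omega) (O_fin : (lebesgue_rV R p Omega < +oo)%E).
Context (O_null : lebesgue_rV R p (Omega `\` interior Omega) = 0%E).
Context (cD : compact D).
Local Notation X := ('rV[R]_p * 'rV[R]_q)%type.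
Local Notation K := (Omega `*` D).
Let mO : measurable Omega := compact_measurable_mx cO.

Lemma measurable_continuous_rV n (f : 'rV[R]_n -> R) :
  continuous f -> measurable_fun setT f.
Proof.
move=> fc; apply: (measurability _ (measurable_realfun.RGenOInfty.measurableE R)).
move=> _ [_ [a ->] <-]; rewrite setTI; apply: open_measurable_mx.
by apply: open_comp (interval_open _ _) => // x _; exact: fc.
Qed.

Lemma cvg_Rintegral_cutoffs (eta : nat -> 'rV[R]_p -> R) :
  (forall k, continuous (eta k)) -> (forall k x, 0 <= eta k x <= 1) ->
  (forall x, interior Omega x -> eta k x @[k --> \oo] --> (0 : R)) ->
  \int[lebesgue_rV R p]_(x in Omega) eta k x @[k --> \oo] --> (0 : R).
Proof.
move=> ec e01 e0.
have me k : measurable_fun Omega (eta k).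
  by apply: measurable_funTS; exact: measurable_continuous_rV.
have i1 : (lebesgue_rV R p).-integrable Omega (EFin \o cst (1 : R)).
  by apply: (bounded_integrable (M := 1)) => // x _; rewrite /= normr1.
have [|||||_ _ h] := @dominated_convergence _ _ _ (lebesgue_rV R p) Omega mO
  (fun k => EFin \o eta k) (cst 0%E) (EFin \o cst 1).
- by move=> k; exact/measurable_EFinP.
- exact: measurable_cst.
- exists (Omega `\` interior Omega); split=> //.
    by apply: measurableD => //; apply: open_measurable_mx; exact: open_interior.
  move=> x /= /not_implyP[Ox etax]; split=> // ix; apply: etax.
  by apply: cvg_EFin; [exact: nearW|exact: e0].
- exact: i1.
- apply: aeW => x k _; rewrite /= lee_fin ger0_norm; first by have /andP[] := e01 k x.
  by have /andP[] := e01 k x.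
- by rewrite integral0 in h; apply: (fine_cvg (f := fun k => \int[lebesgue_rV R p]_(x in Omega) (eta k x)%:E)%E).
Qed.

Lemma integral_pmap_fst (mu : 'rV[R]_p -> probability 'rV[R]_q R) (h : 'rV[R]_p -> R) :
  L2_map Omega D mu ->
  integral_pmap Omega D mu (fun z => h z.1) = \int[lebesgue_rV R p]_(x in Omega) h x.
Proof.
move=> [muD _]; apply: eq_Rintegral => x; rewrite inE => Ox.
have mD : measurable D by exact: compact_measurable_mx.
transitivity (\int[mu x]_(y in D) cst (h x) y); first by [].
by rewrite Rintegral_cst// [X in fine X](muD _ Ox) mulr1.
Qed.

Lemma integral_pmapZ (mu : 'rV[R]_p -> probability 'rV[R]_q R) (a : R) (f : X -> R) :
  L2_map Omega D mu -> {within K, continuous f} ->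
  integral_pmap Omega D mu (fun z => a * f z) = a * integral_pmap Omega D mu f.
Proof.
move=> hmu fc; have := integral_pmap_comb cO O_fin cD hmu (a - 1) fc fc.
rewrite (_ : (fun z => _) = (fun z => a * f z)); last first.
  by apply/funext => z; ring.
by move=> ->; ring.
Qed.

Lemma integral_vmeasZ (E : 'I_p -> 'I_q -> {charge set X -> \bar R}) (a : R)
    (b : X -> 'M[R]_(p, q)) : {within K, continuous b} ->
  integral_vmeas Omega D E (fun z => a *: b z) = a * integral_vmeas Omega D E b.
Proof.
move=> bc; have := integral_vmeas_comb cO cD E (a - 1) bc bc.
rewrite (_ : (fun z => _) = (fun z => a *: b z)); last first.
  by apply/funext => z; rewrite scalerBl scale1r subrK.
by move=> ->; ring.
Qed.

(* By the continuity equation only eta k * phi matters, and the integral of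
   its gradient against a momentum of energy at most c is bounded by
   c / t + t / 2 * s k for every t > 0, where s k tends to 0. *)
Lemma boundary_term_unique (mu : 'rV[R]_p -> probability 'rV[R]_q R) E1 E2 phi :
  L2_map Omega D mu -> finite_momentum Omega D mu E1 -> finite_momentum Omega D mu E2 ->
  C1_map phi -> boundary_term Omega D mu E1 phi = boundary_term Omega D mu E2 phi.
Proof.
move=> hmu [CE1 fE1] [CE2 fE2] hphi.
have [eta [eC1 e01 e0 esupp]] := interior_cutoffs q (@open_interior _ Omega).
have gc psi : C1_map psi -> {within K, continuous (grad_D psi)}.
  by move=> hpsi; apply: continuous_subspaceT; exact: continuous_grad_D.
pose etaphi k := fun z : X => eta k z.1 *: phi z.
have hetaphi k : C1_map (etaphi k) by exact: C1_map_scale.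
pose psi k := -1 *: etaphi k + phi.
have hpsi k : C1_map (psi k) by exact: (C1_map_comb (-1) (hetaphi k) hphi).
have psupp k : compact_support_Omega Omega D (psi k).
  have [C [cC CO eC]] := esupp k; exists C; split=> //.
    by apply: subclosed_compact cO _ => //; apply: subset_trans CO _; exact: interior_subset.
  move=> x y _ _ nCx; rewrite /psi/= /etaphi.
  by rewrite [LHS](_ : _ = -1 *: (eta k x *: phi (x, y)) + phi (x, y))// eC// scale1r scaleN1r addNr.
(* The divergence term involves [mu] but not [E], so it disappears when two momenta of the same map
   are compared: this is how the derivatives of [eta k], which are not controlled uniformly in [k],
   cancel. *)
have split E k : continuity_equation Omega D mu E ->
    integral_vmeas Omega D E (grad_D (etaphi k)) =
    integral_vmeas Omega D E (grad_D phi) + integral_pmap Omega D mu (div_Omega (psi k)).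
  move=> [_ /(_ _ (hpsi k) (psupp k))]; rewrite /boundary_term.
  rewrite (_ : grad_D (psi k) = fun z => -1 *: grad_D (etaphi k) z + grad_D phi z); last first.
    by apply/funext => z; exact: (grad_D_comb (-1) z (hetaphi k) hphi).
  rewrite (integral_vmeas_comb cO cD E (-1) (gc _ (hetaphi k)) (gc _ hphi)).
  move: (integral_pmap _ _ _ _) (integral_vmeas _ _ _ _) (integral_vmeas _ _ _ _) => x y z.
  by lra.
pose f z := \sum_al \sum_i grad_D phi z al i ^+ 2.
have [M fM] := within_continuous_bounded cO cD (within_continuous_sqnorm (gc _ hphi)).
pose s k := integral_pmap Omega D mu (fun z => \sum_al \sum_i grad_D (etaphi k) z al i ^+ 2).
have etac k : continuous (eta k).
  move=> x; have c1 := C1_fun_continuous (eC1 k).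
  apply: (@continuous_comp _ _ _ (fun x : 'rV[R]_p => (x, 0) : X) (fun z : X => eta k z.1)).
    move=> A [[P Q] /= [Px Q0] PQA]; apply: filterS Px => u Pu.
    by apply: PQA; split=> //=; exact: nbhs_singleton.
  exact: c1.
(* As [eta k] takes values in [0, 1], its square is at most itself. *)
have s0 k : s k <= `|M| * \int[lebesgue_rV R p]_(x in Omega) eta k x.
  rewrite -(integral_pmap_fst _ hmu).
  have ec : {within K, continuous (fun z : X => eta k z.1)}.
    by apply: continuous_subspaceT; exact: C1_fun_continuous.
  rewrite -integral_pmapZ//; apply: (le_integral_pmap cO O_fin cD hmu).
  - by apply: within_continuous_sqnorm; exact: (gc _ (hetaphi k)).
  - by move=> z; apply: cvgMr; exact: ec.
  move=> z Kz.
  rewrite (_ : \sum_al _ = eta k z.1 ^+ 2 * f z); last first.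
    rewrite /f mulr_sumr; apply: eq_bigr => al _; rewrite mulr_sumr; apply: eq_bigr => i _.
    by rewrite grad_D_scale// mxE exprMn.
  have /andP[h0 h1] := e01 k z.1.
  have f0 : 0 <= f z by apply: sumr_ge0 => al _; apply: sumr_ge0 => i _; exact: sqr_ge0.
  have fMz : f z <= `|M|.
    by apply: le_trans (ler_norm _) _; apply: le_trans (fM _ Kz) _; exact: ler_norm.
  rewrite mulrC; apply: ler_pM => //; first exact: sqr_ge0.
  by rewrite expr2 ler_piMl.
have scvg : `|M| * \int[lebesgue_rV R p]_(x in Omega) eta k x @[k --> \oo] --> (0 : R).
  rewrite -(mulr0 `|M|); apply: cvgMr; apply: cvg_Rintegral_cutoffs => //.
have Dub E : (Dir_pair Omega D mu E < +oo)%E -> exists c : R, (Dir_pair Omega D mu E <= c%:E)%E.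
  case: (Dir_pair Omega D mu E) => [r|//|] _; first by exists r.
  by exists 0; rewrite leNye.
have [c1 hc1] := Dub _ fE1; have [c2 hc2] := Dub _ fE2.
have bound E c : (Dir_pair Omega D mu E <= c%:E)%E -> forall t k,
    t * integral_vmeas Omega D E (grad_D (etaphi k)) - 2^-1 * t ^+ 2 * s k <= c.
  move=> hc t k; rewrite -lee_fin; apply: le_trans hc.
  pose b := fun z => t *: grad_D (etaphi k) z.
  have bc : {within K, continuous b}.
    by move=> z; apply: cvgZr; exact: (gc _ (hetaphi k)).
  have := Dir_pair_ge cO O_fin cD hmu E bc.
  rewrite integral_vmeasZ; last exact: (gc _ (hetaphi k)).
  rewrite (_ : (fun z => \sum_al \sum_i b z al i ^+ 2) =
    (fun z => t ^+ 2 * \sum_al \sum_i grad_D (etaphi k) z al i ^+ 2)).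
    rewrite integral_pmapZ//; last by apply: within_continuous_sqnorm; exact: (gc _ (hetaphi k)).
    by rewrite mulrA.
  apply/funext => z; rewrite mulr_sumr; apply: eq_bigr => al _.
  by rewrite mulr_sumr; apply: eq_bigr => i _; rewrite mxE exprMn.
apply/eqP; rewrite -subr_eq0 /boundary_term opprD addrACA subrr add0r; apply/eqP.
set delta := _ - _.
have deltaE k : delta = integral_vmeas Omega D E1 (grad_D (etaphi k)) -
    integral_vmeas Omega D E2 (grad_D (etaphi k)).
  by rewrite (split E1 k CE1) (split E2 k CE2) opprD addrACA subrr addr0.
(* The bound for [E1] is used at [t] and that for [E2] at [- t]; letting [k] grow removes the
   quadratic term. A linear function of [t] bounded above on the whole line has slope 0. *)
have lin t : t * delta <= c1 + c2.
  have scvg' : c1 + c2 + t ^+ 2 * (`|M| * \int[lebesgue_rV R p]_(x in Omega) eta k x)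
      @[k --> \oo] --> (c1 + c2 : R).
    by rewrite -[X in _ --> X]addr0 -(mulr0 (t ^+ 2)); apply: cvgD; [exact: cvg_cst|exact: cvgMr].
  rewrite -(cvg_lim _ scvg')//; apply: limr_ge; first by apply/cvg_ex; eexists; exact: scvg'.
  apply: nearW => k; have b1 := bound _ _ hc1 t k; have b2 := bound _ _ hc2 (- t) k.
  have := ler_wpM2l (sqr_ge0 t) (s0 k); rewrite sqrrN in b2; rewrite (deltaE k).
  move: b1 b2; move: (t ^+ 2 * (`|M| * _)) (integral_vmeas _ _ E1 _) (integral_vmeas _ _ E2 _).
  move=> u i1 i2; rewrite -!mulrA; move: (t ^+ 2 * s k) => v; rewrite mulNr mulrBr => b1 b2 uv.
  lra.
have [//|d0] := eqVneq delta 0.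
by have := lin ((c1 + c2 + 1) / delta); rewrite divfK//; lra.
Qed.

End boundary_term_uniqueness.

(** * Existence *)

Theorem theorem4p3 (R : realType) (p q : nat)
  (p_gt0 : (0 < p)%N) (q_gt0 : (0 < q)%N)
  (Omega : set 'rV[R]_p) (D : set 'rV[R]_q)
  (Omega_compact : compact Omega) (Omega_connected : connected Omega)
  (Omega_int : interior Omega !=set0)
  (Omega_lip : lipschitz_boundary Omega)
  (Omega_leb : lebesgue_rV R p Omega = 1%E)
  (D_compact : compact D) (D_convex : convex_set D)
  (D_int : interior D !=set0)
  (mub : 'rV[R]_p -> probability 'rV[R]_q R) :
  H1_map Omega D mub -> exists mu, dirichlet_solution Omega D mub mu.
Proof.
move=> [hmub Dmub].
have O_fin : (lebesgue_rV R p Omega < +oo)%E by rewrite Omega_leb ltry.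
have O0 : Omega !=set0 by have [x /interior_subset] := Omega_int; exists x.
have D0 : D !=set0 by have [x /interior_subset] := D_int; exists x.
have O_null : lebesgue_rV R p (Omega `\` interior Omega) = 0%E.
  apply: lipschitz_boundary_null => //.
  by apply: compact_closed => //; exact: norm_hausdorff.
have unique := @boundary_term_unique _ _ _ _ _ Omega_compact O_fin O_null D_compact.
have [_ [F CF <-] fF] := ereal_inf_lt Dmub.
have FF : finite_momentum Omega D mub F by [].
pose A := [set nu | H1_map Omega D nu /\ same_boundary_values Omega D nu mub].
(* Boundary values are compared over all pairs of momenta, so even the admissibility of the datum
   itself rests on uniqueness of the boundary term. *)
have Amub : A mub by split=> // E1 E2 h1 h2 phi hphi; exact: unique.
pose d := ereal_inf (Dir Omega D @` A).
(* Testing with [b = 0] gives 0; with the finite energy of [mub] this makes the infimum a real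
   number [r]. *)
have Dir_ge0 nu E : L2_map Omega D nu -> (0 <= Dir_pair Omega D nu E)%E.
  move=> hnu; have c0 : {within Omega `*` D, continuous
      (fun _ : 'rV[R]_p * 'rV[R]_q => 0 : 'M[R]_(p, q))} by move=> z; exact: cvg_cst.
  apply: le_trans (Dir_pair_ge Omega_compact O_fin D_compact hnu E c0).
  have := integral_vmeasZ Omega_compact D_compact E 0 c0.
  rewrite mul0r; under eq_fun do rewrite scaler0.
  move=> ->; rewrite (_ : (fun=> _) = (fun=> 0)); last first.
    by apply/funext => z; rewrite big1// => al _; rewrite big1// => i _; rewrite mxE expr0n.
  by rewrite (integral_pmap0 Omega_compact O_fin D_compact hnu) mulr0 subr0.
have d0 : (0 <= d)%E.
  apply: le_ereal_inf_tmp => _ [nu [[hnu _] _] <-].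
  by apply: le_ereal_inf_tmp => _ [E _ <-]; exact: Dir_ge0.
have dfin : d \is a fin_num.
  rewrite ge0_fin_numE//; apply: le_lt_trans Dmub.
  by apply: ereal_inf_lbound; exists mub.
pose r := fine d; have dE : d = r%:E by rewrite fineK.
have approx n : exists nuE : ('rV[R]_p -> probability 'rV[R]_q R) *
    ('I_p -> 'I_q -> {charge set ('rV[R]_p * 'rV[R]_q)%type -> \bar R}),
    [/\ A nuE.1, continuity_equation Omega D nuE.1 nuE.2 &
      (Dir_pair Omega D nuE.1 nuE.2 < (r + n.+1%:R^-1)%:E)%E].
  have : (d < (r + n.+1%:R^-1)%:E)%E by rewrite dE lte_fin ltrDl invr_gt0.
  move=> /ereal_inf_lt[_ [nu Anu <-]] /ereal_inf_lt[_ [E CE <-] hE].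
  by exists (nu, E).
pose nu n := (sval (cid (approx n))).1; pose E_ n := (sval (cid (approx n))).2.
have [Anu CE DE] : [/\ forall n, A (nu n),
    forall n, continuity_equation Omega D (nu n) (E_ n) &
    forall n, (Dir_pair Omega D (nu n) (E_ n) < (r + n.+1%:R^-1)%:E)%E].
  by split=> n; have [] := svalP (cid (approx n)).
have hnu n : L2_map Omega D (nu n) by have [[]] := Anu n.
(* The ultrafilter refines convergence at infinity, which sends the error [1 / (n + 1)] to 0. *)
have [G [GU Goo]] := @ultraFilterLemma nat \oo _.
have GP : ProperFilter G by exact: ultra_proper.
have [mu [hmu mucvg]] := pmap_ultracompact Omega_compact O_fin O0 D_compact D0 GU hnu.
pose T phi := boundary_term Omega D mub F phi.
(* This is the value that the integral of [grad_D phi] against a momentum of [mu] must take for its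
   boundary term to be [T]. *)
pose l phi := T phi - integral_pmap Omega D mu (div_Omega phi).
have dc phi : C1_map phi -> {within Omega `*` D, continuous (@div_Omega R p q phi)}.
  by move=> hphi; apply: continuous_subspaceT; exact: continuous_div_Omega.
have gc phi : C1_map phi -> {within Omega `*` D, continuous (@grad_D R p q phi)}.
  by move=> hphi; apply: continuous_subspaceT; exact: continuous_grad_D.
have pD nu' a phi psi : L2_map Omega D nu' -> C1_map phi -> C1_map psi ->
    integral_pmap Omega D nu' (div_Omega (a *: phi + psi)) =
    a * integral_pmap Omega D nu' (div_Omega phi) + integral_pmap Omega D nu' (div_Omega psi).
  move=> hnu' hphi hpsi.
  rewrite -(integral_pmap_comb Omega_compact O_fin D_compact hnu' a (dc _ hphi) (dc _ hpsi)).
  by congr integral_pmap; apply/funext => z; exact: (div_Omega_comb a z hphi hpsi).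
have lD a phi psi : C1_map phi -> C1_map psi -> l (a *: phi + psi) = a * l phi + l psi.
  move=> hphi hpsi; rewrite /l /T /boundary_term.
  rewrite (pD _ _ _ _ hmu hphi hpsi) (pD _ _ _ _ hmub hphi hpsi).
  have -> : grad_D (a *: phi + psi) = fun z => a *: grad_D phi z + grad_D psi z.
    by apply/funext => z; exact: (grad_D_comb a z hphi hpsi).
  rewrite (integral_vmeas_comb Omega_compact D_compact F a (gc _ hphi) (gc _ hpsi)).
  move: (integral_pmap _ _ _ _) (integral_pmap _ _ _ _) (integral_pmap _ _ _ _)
    (integral_pmap _ _ _ _) (integral_vmeas _ _ _ _) (integral_vmeas _ _ _ _) => *.
  by ring.
have lM phi : C1_map phi -> l phi - 2^-1 * integral_pmap Omega D mu
    (fun z => \sum_al \sum_i grad_D phi z al i ^+ 2) <= r.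
  move=> hphi.
  pose u n := T phi - integral_pmap Omega D (nu n) (div_Omega phi) -
    2^-1 * integral_pmap Omega D (nu n) (fun z => \sum_al \sum_i grad_D phi z al i ^+ 2)
    - n.+1%:R^-1.
  have ur n : u n <= r.
    have := Dir_pair_ge Omega_compact O_fin D_compact (hnu n) (E_ n) (gc _ hphi).
    move=> /le_lt_trans /(_ (DE n)); rewrite lte_fin => /ltW.
    have [_ bnu] := Anu n.
    have fm : finite_momentum Omega D (nu n) (E_ n).
      by split; [exact: CE|apply: lt_trans (DE n) (ltry _)].
    have := bnu _ _ fm FF _ hphi; rewrite /u -/(T phi) /boundary_term => <-.
    move: (integral_pmap _ _ _ (div_Omega phi)) (integral_vmeas _ _ _ _) (integral_pmap _ _ _ _).
    by move: (n.+1%:R^-1) => h x y z; lra.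
  have gcvg : n.+1%:R^-1 @[n --> G] --> (0 : R) by apply: cvg_trans (cvg_harmonic) => //; exact: cvg_app.
  have ucvg : u n @[n --> G] --> l phi - 2^-1 * integral_pmap Omega D mu
      (fun z => \sum_al \sum_i grad_D phi z al i ^+ 2) - 0.
    apply: cvgB gcvg; apply: cvgB; last first.
      by apply: cvgMr; apply: mucvg; apply: within_continuous_sqnorm; exact: gc.
    by apply: cvgB; [exact: cvg_cst|apply: mucvg; exact: dc].
  by rewrite subr0 in ucvg; apply: cvgr_to_le ucvg _; exact: nearW.
have [E [Eon EI ED]] := vmeas_of_bounded_functional Omega_compact O_fin D_compact hmu lD lM.
have ET phi : C1_map phi -> boundary_term Omega D mu E phi = T phi.
  by move=> hphi; rewrite /boundary_term EI// /l addrC subrK.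
have FE : finite_momentum Omega D mu E.
  split; last by apply: le_lt_trans ED (ltry _).
  (* On compactly supported maps [T] vanishes, because [F] solves the continuity equation for
     [mub]. *)
  split=> // phi hphi sphi; rewrite ET//.
  by have [_] := CF; apply.
have Dmu : (Dir Omega D mu <= d)%E.
  by rewrite dE; apply: le_trans ED; apply: ereal_inf_lbound; exists E => //; have [] := FE.
exists mu; split.
- split; first exact: hmu.
  by apply: le_lt_trans Dmu _; rewrite dE ltry.
(* Arbitrary momenta of [mu] and [mub] are exchanged for [E] and [F] by uniqueness. *)
- move=> E1 F1 h1 h2 phi hphi.
  rewrite (unique _ _ _ _ hmu h1 FE hphi) (ET _ hphi).
  exact: (unique _ _ _ _ hmub FF h2 hphi).
- move=> nu' h1 h2; apply: le_trans Dmu _.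
  apply: ereal_inf_lbound; exists nu'; first exact: (conj h1 h2).
  by [].
Qed.
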